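(* Let $q$ be a non-zero complex number which is not a root of unity, let $U^+=U_q^+(B_2)$, and let the torus $\mathcal{H}=(\mathbb{C}^* )^2$ act on $U^+$ by automorphisms via $(h_1,h_2).e_i=h_ie_i$ for $i\in\{1,2\}$. Then the orbits of the automorphism group $\mathrm{Aut}(U^+)$ within the set $\mathrm{Prim}(U^+)$ of (left) primitive ideals of $U^+$ coincide with the $\mathcal{H}$-strata $\mathrm{Prim}_J(U^+)$ of $\mathrm{Prim}(U^+)$, where $J$ runs over the $\mathcal{H}$-invariant prime ideals of $U^+$. In other words, the action of $\mathrm{Aut}(U^+)$ on $\mathrm{Prim}(U^+)$ has exactly $8$ orbits: 1. $\mathrm{Prim}_{\langle 0\rangle}(U^+)=\{\langle z-\alpha,z'-\beta\rangle\mid\alpha,\beta\in\mathbb{C}^*\}$, 2. $\mathrm{Prim}_{\langle z'\rangle}(U^+)=\{\langle z-\alpha,z'\rangle\mid\alpha\in\mathbb{C}^*\}$, 3. $\mathrm{Prim}_{\langle z\rangle}(U^+)=\{\langle z,z'-\beta\rangle\mid\beta\in\mathbb{C}^*\}$, 4. $\mathrm{Prim}_{\langle e_3\rangle}(U^+)=\{\langle e_3\rangle\}$, 5. $\mathrm{Prim}_{\langle\overline{e_3}\rangle}(U^+)=\{\langle\overline{e_3}\rangle\}$, 6. $\mathrm{Prim}_{\langle e_1\rangle}(U^+)=\{\langle e_1,e_2-\beta\rangle\mid\beta\in\mathbb{C}^*\}$, 7. $\mathrm{Prim}_{\langle e_2\rangle}(U^+)=\{\langle e_1-\alpha,e_2\rangle\mid\alpha\in\mathbb{C}^*\}$,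 8. $\mathrm{Prim}_{\langle e_1,e_2\rangle}(U^+)=\{\langle e_1,e_2\rangle\}$.
   Context: $U^+=U_q^+(B_2)$ is the unital associative $\mathbb{C}$-algebra generated by $e_1,e_2$ subject to the quantum Serre relations $e_1^2e_2-(q^2+q^{-2})e_1e_2e_1+e_2e_1^2=0$ and $e_2^3e_1-(q^2+1+q^{-2})e_2^2e_1e_2+(q^2+1+q^{-2})e_2e_1e_2^2-e_1e_2^3=0$. Set $e_3=e_1e_2-q^2e_2e_1$, $\overline{e_3}=e_1e_2-q^{-2}e_2e_1$, $z=e_2e_3-q^2e_3e_2$ and $z'=(1-q^{-2})\left(e_3\overline{e_3}+(1+q^{-2})ze_1\right)$; the center of $U^+$ is the polynomial ring $\mathbb{C}[z,z']$. $\langle\cdots\rangle$ denotes the two-sided ideal of $U^+$ generated by the listed elements. An ideal $I$ is $\mathcal{H}$-invariant if $h.I=I$ for all $h\in\mathcal{H}$. For an $\mathcal{H}$-invariant prime ideal $J$, the $\mathcal{H}$-stratum is $\mathrm{Spec}_J(U^+)=\{P\in\mathrm{Spec}(U^+)\mid\bigcap_{h\in\mathcal{H}}h.P=J\}$, and $\mathrm{Prim}_J(U^+)=\mathrm{Spec}_J(U^+)\cap\mathrm{Prim}(U^+)$. There are exactly eight $\mathcal{H}$-invariant prime ideals: $\langle0\rangle,\langle z\rangle,\langle z'\rangle,\langle e_3\rangle,\langle\overline{e_3}\rangle,\langle e_1\rangle,\langle e_2\rangle,\langle e_1,e_2\rangle$. *)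

(* Defs.v *)
From HB Require Import structures.
From mathcomp Require Import all_boot all_order all_algebra.
From mathcomp Require Import generic_quotient ring_quotient.
From mathcomp Require Import boolp classical_sets cardinality reals.
From mathcomp Require Import ring.
From mathcomp.multinomials Require Import monalg.
From mathcomp.real_closed Require Import complex.

Set Implicit Arguments.
Unset Strict Implicit.
Unset Printing Implicit Defensive.

Import Order.TTheory GRing.Theory Num.Theory.
Local Open Scope classical_set_scope.
Local Open Scope ring_scope.
Local Open Scope quotient_scope.

Section Ideals.
Variable R : nzRingType.
Implicit Types (I J P X : set R).

Definition two_sided_ideal I : Prop :=
  [/\ I 0, forall x y, I x -> I y -> I (x + y)
    & forall a x b, I x -> I (a * x * b)].

Definition ideal_gen X : set R := smallest two_sided_ideal X.

Definition prime_ideal P : Prop :=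
  [/\ two_sided_ideal P, P <> setT
    & forall I J, two_sided_ideal I -> two_sided_ideal J ->
        (forall x y, I x -> J y -> P (x * y)) -> I `<=` P \/ J `<=` P].

Definition submodule (M : lmodType R) (N : set M) : Prop :=
  [/\ N 0, forall x y, N x -> N y -> N (x + y)
    & forall (a : R) x, N x -> N (a *: x)].

Definition simple_module (M : lmodType R) : Prop :=
  (exists m : M, m <> 0) /\
  forall N : set M, submodule N -> N = [set 0] \/ N = setT.

Definition annihilator (M : lmodType R) : set R :=
  [set a | forall m : M, a *: m = 0].

Definition left_primitive P : Prop :=
  exists M : lmodType R, simple_module M /\ P = annihilator M.

Lemma ideal_gen_ideal X : two_sided_ideal (ideal_gen X).
Proof.
split; first by move=> I [[]].
- by move=> x y hx hy I hI; case: (hI) => -[_ hD _] _; apply: hD; [apply: hx|apply: hy].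
- by move=> a x b hx I hI; case: (hI) => -[_ _ hM] _; apply: hM; apply: hx.
Qed.

Lemma ideal_gen_sub X : X `<=` ideal_gen X.
Proof. exact: sub_gen_smallest. Qed.

Lemma ideal_gen_min X I : two_sided_ideal I -> X `<=` I -> ideal_gen X `<=` I.
Proof. exact: smallest_sub. Qed.

End Ideals.

Section FreeAlgebra.
Variable F : fieldType.

Definition freeA := {malg F[{fmonom bool}]}.
HB.instance Definition _ := GRing.Lalgebra.on freeA.

Fact freeA_scaleAr (k : F) (x y : freeA) : k *: (x * y) = x * (k *: y).
Proof.
have comm_malgC (g : freeA) : GRing.comm (malgC k) g.
  rewrite /GRing.comm [g]monalgE mulr_sumr mulr_suml; apply: eq_bigr => m _.
  by rewrite !malgM_def !fgmulUU mul1m mulm1 mulrC.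
by rewrite -!mul_malgC mulrA (comm_malgC x) mulrA.
Qed.
HB.instance Definition _ := GRing.Lalgebra_isAlgebra.Build F freeA freeA_scaleAr.

Definition freeX (b : bool) : freeA := << fmu b >>.

Variables (S : algType F) (x1 x2 : S).

(* true is the index of the first generator *)
Definition word_eval (m : fmonom bool) : S :=
  \prod_(b <- (m : seq bool)) (if b then x1 else x2).

Fact word_eval_mmorphism : mmorphism word_eval.
Proof.
by split=> [x y|]; rewrite /word_eval ?fmM ?fm1 ?big_cat ?big_nil.
Qed.
HB.instance Definition _ :=
  isMultiplicative.Build (fmonom bool) S word_eval word_eval_mmorphism.

Definition free_eval : freeA -> S := mmap (GRing.in_alg S) word_eval.

HB.instance Definition _ := GRing.Additive.on free_eval.

Fact free_eval_monoid_morphism : monoid_morphism free_eval.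
Proof.
have [hM h1] : GRing.multiplicative free_eval.
  apply: commr_mmap_is_multiplicative => g m m'.
  by rewrite /GRing.comm /= -scalerAl -scalerAr mul1r mulr1.
by split.
Qed.
HB.instance Definition _ :=
  GRing.isMonoidMorphism.Build freeA S free_eval free_eval_monoid_morphism.

Fact free_eval_scalable : scalable free_eval.
Proof. by move=> c g; rewrite /free_eval mmapZ /= -scalerAl mul1r. Qed.
HB.instance Definition _ :=
  GRing.isScalable.Build F freeA S _ free_eval free_eval_scalable.

Lemma free_evalX b : free_eval (freeX b) = if b then x1 else x2.
Proof.
rewrite /free_eval /freeX mmapU /= scale1r mul1r /word_eval fmU.
by rewrite big_seq1.
Qed.

End FreeAlgebra.

Section Serre.
Variables (F : fieldType) (q : F).

Definition serre1 (S : algType F) (x y : S) : S :=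
  x ^+ 2 * y - (q ^+ 2 + q ^- 2) *: (x * y * x) + y * x ^+ 2.

Definition serre2 (S : algType F) (x y : S) : S :=
  y ^+ 3 * x - (q ^+ 2 + 1 + q ^- 2) *: (y ^+ 2 * x * y)
  + (q ^+ 2 + 1 + q ^- 2) *: (y * x * y ^+ 2) - x * y ^+ 3.

Lemma serre1_morph (S T : algType F) (f : {lrmorphism S -> T}) x y :
  f (serre1 x y) = serre1 (f x) (f y).
Proof.
have fZ c u : f (c *: u) = c *: f u by exact: linearZ.
have fX u n : f (u ^+ n) = f u ^+ n by exact: rmorphXn.
have fM u v : f (u * v) = f u * f v by exact: rmorphM.
by rewrite /serre1 rmorphD rmorphB /= fZ !(fX, fM).
Qed.

Lemma serre2_morph (S T : algType F) (f : {lrmorphism S -> T}) x y :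
  f (serre2 x y) = serre2 (f x) (f y).
Proof.
have fZ c u : f (c *: u) = c *: f u by exact: linearZ.
have fX u n : f (u ^+ n) = f u ^+ n by exact: rmorphXn.
have fM u v : f (u * v) = f u * f v by exact: rmorphM.
by rewrite /serre2 rmorphB rmorphD rmorphB /= !fZ !(fX, fM).
Qed.

Lemma serre1_scale (S : algType F) (a b : F) (x y : S) :
  serre1 (a *: x) (b *: y) = (a ^+ 2 * b) *: serre1 x y.
Proof.
rewrite /serre1 !exprZn -!(scalerAl, scalerAr) !scalerDr !scalerN !scalerA.
by congr (_ *: _ - _ *: _ + _ *: _); ring.
Qed.

Lemma serre2_scale (S : algType F) (a b : F) (x y : S) :
  serre2 (a *: x) (b *: y) = (a * b ^+ 3) *: serre2 x y.
Proof.
rewrite /serre2 !exprZn -!(scalerAl, scalerAr) !scalerDr !scalerN !scalerA.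
by congr (_ *: _ - _ *: _ + _ *: _ - _ *: _); ring.
Qed.

Local Notation A := (freeA F).
Local Notation X1 := (freeX F true).
Local Notation X2 := (freeX F false).

Definition serre_ideal : set A :=
  ideal_gen [set serre1 X1 X2; serre2 X1 X2].

Definition serre_pred : {pred A} := fun x => `[< serre_ideal x >].

Fact serre_pred_zmod_closed : zmod_closed serre_pred.
Proof.
have [I0 ID IM] := ideal_gen_ideal [set serre1 X1 X2; serre2 X1 X2].
split; first exact/asboolP.
move=> x y /asboolP hx /asboolP hy; apply/asboolP; apply: ID => //.
by rewrite -[y]mulr1 -mulN1r mulrA; apply: IM.
Qed.
HB.instance Definition _ :=
  GRing.isZmodClosed.Build A serre_pred serre_pred_zmod_closed.

Lemma serre_predM a x b : serre_pred x -> serre_pred (a * x * b).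
Proof.
have [_ _ IM] := ideal_gen_ideal [set serre1 X1 X2; serre2 X1 X2].
by move=> /asboolP hx; apply/asboolP; apply: IM.
Qed.

Lemma serre_pred_min (S : algType F) (f : {lrmorphism A -> S}) :
  serre1 (f X1) (f X2) = 0 -> serre2 (f X1) (f X2) = 0 ->
  forall x, serre_pred x -> f x = 0.
Proof.
move=> h1 h2 x /asboolP hx.
suff: [set y | f y = 0] x by [].
apply: ideal_gen_min hx; first split => /=.
- exact: rmorph0.
- by move=> u v hu hv; rewrite rmorphD /= hu hv addr0.
- by move=> a u b hu; rewrite !rmorphM /= hu mulr0 mul0r.
- move=> y /= [] ->.
  + by rewrite serre1_morph.
  + by rewrite serre2_morph.
Qed.

Definition rawU : Type := Quotient.quot (serre_pred : zmodClosed A).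
HB.instance Definition _ := Choice.on rawU.
HB.instance Definition _ := EqQuotient.on rawU.
HB.instance Definition _ := GRing.Zmodule.on rawU.

Definition raw_pi (x : A) : rawU := \pi_rawU x.

Lemma raw_pi_eq x y : raw_pi x = raw_pi y <-> serre_pred (x - y).
Proof.
by have := @Quotient.idealrBE _ (serre_pred : zmodClosed A) x y; rewrite /in_mem /= => ->;
  split=> /eqP.
Qed.

Lemma raw_piK u : raw_pi (repr u) = u.
Proof. exact: reprK. Qed.

Fact raw_piD : {morph raw_pi : x y / x + y}.
Proof. by move=> x y; rewrite /raw_pi; exact: Quotient.pi_add. Qed.

Fact raw_pi0 : raw_pi 0 = 0.
Proof. by apply: (@addrI _ (raw_pi 0)); rewrite -raw_piD !addr0. Qed.

Definition raw_one : rawU := raw_pi 1.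
Definition raw_mul (u v : rawU) : rawU := raw_pi (repr u * repr v).
Definition raw_scale (c : F) (u : rawU) : rawU := raw_pi (c *: repr u).

Fact raw_piM : {morph raw_pi : x y / x * y >-> raw_mul x y}.
Proof.
move=> x y; apply/raw_pi_eq.
set x' := repr _; set y' := repr _.
have hx : serre_pred (x - x') by apply/raw_pi_eq; rewrite raw_piK.
have hy : serre_pred (y - y') by apply/raw_pi_eq; rewrite raw_piK.
have -> : x * y - x' * y' = 1 * (x - x') * y + x' * (y - y') * 1.
  by rewrite mul1r mulr1 mulrBl mulrBr addrA subrK.
by apply: (rpredD (S := serre_pred)); apply: serre_predM.
Qed.

Fact raw_piZ c : {morph raw_pi : x / c *: x >-> raw_scale c x}.
Proof.
move=> x; apply/raw_pi_eq; set x' := repr _.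
have hx : serre_pred (x - x') by apply/raw_pi_eq; rewrite raw_piK.
rewrite -scalerBr -[x - x']mul1r scalerAl -[_ * (x - x')]mulr1.
exact: serre_predM.
Qed.

Fact raw_mulA : associative raw_mul.
Proof.
by move=> u v w; rewrite -(raw_piK u) -(raw_piK v) -(raw_piK w) -!raw_piM mulrA.
Qed.
Fact raw_mul1 : left_id raw_one raw_mul.
Proof. by move=> u; rewrite -(raw_piK u) -raw_piM mul1r. Qed.
Fact raw_mulr1 : right_id raw_one raw_mul.
Proof. by move=> u; rewrite -(raw_piK u) -raw_piM mulr1. Qed.
Fact raw_mulDl : left_distributive raw_mul +%R.
Proof.
move=> u v w; rewrite -(raw_piK u) -(raw_piK v) -(raw_piK w).
by rewrite -raw_piD -!raw_piM mulrDl raw_piD.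
Qed.
Fact raw_mulDr : right_distributive raw_mul +%R.
Proof.
move=> u v w; rewrite -(raw_piK u) -(raw_piK v) -(raw_piK w).
by rewrite -raw_piD -!raw_piM mulrDr raw_piD.
Qed.

(* 1 <> 0 because the relations lie in the augmentation ideal. *)
Fact raw_one_neq0 : raw_one != 0.
Proof.
apply/eqP; rewrite -raw_pi0 => /raw_pi_eq; rewrite subr0.
move/(serre_pred_min (f := free_eval (0 : F^o) (0 : F^o))).
rewrite /= !free_evalX /serre1 /serre2 !expr0n /= !(mulr0, mul0r) !scaler0.
rewrite !(addr0, subr0) rmorph1 => /(_ erefl erefl) /eqP.
by rewrite oner_eq0.
Qed.

HB.instance Definition _ := GRing.Zmodule_isNzRing.Build rawU
  raw_mulA raw_mul1 raw_mulr1 raw_mulDl raw_mulDr raw_one_neq0.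

Fact raw_scaleA a b u : raw_scale a (raw_scale b u) = raw_scale (a * b) u.
Proof. by rewrite -(raw_piK u) -!raw_piZ scalerA. Qed.
Fact raw_scale1 : left_id 1 raw_scale.
Proof. by move=> u; rewrite -(raw_piK u) -raw_piZ scale1r. Qed.
Fact raw_scaleDr : right_distributive raw_scale +%R.
Proof.
move=> c u v; rewrite -(raw_piK u) -(raw_piK v).
by rewrite -raw_piD -!raw_piZ scalerDr raw_piD.
Qed.
Fact raw_scaleDl u : {morph raw_scale^~ u : a b / a + b}.
Proof. by move=> a b; rewrite -(raw_piK u) -!raw_piZ scalerDl raw_piD. Qed.

HB.instance Definition _ := GRing.Zmodule_isLmodule.Build F rawU
  raw_scaleA raw_scale1 raw_scaleDr raw_scaleDl.

Fact raw_scaleAl (a : F) (u v : rawU) : a *: (u * v) = (a *: u) * v.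
Proof.
rewrite -(raw_piK u) -(raw_piK v) -[raw_pi _ * raw_pi _]raw_piM.
by rewrite -[LHS]raw_piZ -[a *: raw_pi _]raw_piZ -[RHS]raw_piM scalerAl.
Qed.
HB.instance Definition _ := GRing.Lmodule_isLalgebra.Build F rawU raw_scaleAl.

Fact raw_scaleAr (a : F) (u v : rawU) : a *: (u * v) = u * (a *: v).
Proof.
rewrite -(raw_piK u) -(raw_piK v) -[raw_pi _ * raw_pi _]raw_piM.
by rewrite -[LHS]raw_piZ -[a *: raw_pi _]raw_piZ -[RHS]raw_piM scalerAr.
Qed.
HB.instance Definition _ := GRing.Lalgebra_isAlgebra.Build F rawU raw_scaleAr.

Fact raw_pi_zmod_morphism : zmod_morphism raw_pi.
Proof.
move=> x y; apply: (@addIr _ (raw_pi y)).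
by rewrite subrK -[LHS]raw_piD subrK.
Qed.
HB.instance Definition _ :=
  GRing.isZmodMorphism.Build A rawU raw_pi raw_pi_zmod_morphism.
Fact raw_pi_monoid_morphism : monoid_morphism raw_pi.
Proof. by split; [exact: erefl | exact: raw_piM]. Qed.
HB.instance Definition _ :=
  GRing.isMonoidMorphism.Build A rawU raw_pi raw_pi_monoid_morphism.
Fact raw_pi_scalable : scalable raw_pi.
Proof. by move=> c x; exact: raw_piZ. Qed.
HB.instance Definition _ :=
  GRing.isScalable.Build F A rawU _ raw_pi raw_pi_scalable.

(* The presentation is sealed: the quotient is then known only through its
   projection from the free algebra, which is onto with kernel the ideal
   generated by the relations. *)
Record presentation := Presentation {
  pres_alg : algType F;
  pres_pi : {lrmorphism A -> pres_alg};
  pres_surj : forall u, exists x, pres_pi x = u;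
  pres_ker : forall x, pres_pi x = 0 <-> serre_ideal x
}.

Fact UqB2_presentation : presentation.
Proof.
exists (rawU : algType F) (raw_pi : {lrmorphism A -> rawU}).
- by move=> u; exists (repr u); exact: raw_piK.
- move=> x; rewrite -[X in _ = X]raw_pi0; split.
  + by move/raw_pi_eq; rewrite subr0 => /asboolP.
  + by move=> hx; apply/raw_pi_eq; rewrite subr0; apply/asboolP.
Qed.

Definition UqB2 : algType F := pres_alg UqB2_presentation.
Definition Uq_pi : {lrmorphism A -> UqB2} := pres_pi UqB2_presentation.

Lemma Uq_pi_surj (u : UqB2) : exists x, Uq_pi x = u.
Proof. exact: pres_surj. Qed.

Lemma Uq_pi_ker x : Uq_pi x = 0 <-> serre_ideal x.
Proof. exact: pres_ker. Qed.

Definition e1 : UqB2 := Uq_pi X1.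
Definition e2 : UqB2 := Uq_pi X2.
Definition e3 : UqB2 := e1 * e2 - q ^+ 2 *: (e2 * e1).
Definition e3bar : UqB2 := e1 * e2 - q ^- 2 *: (e2 * e1).
Definition z : UqB2 := e2 * e3 - q ^+ 2 *: (e3 * e2).
Definition z' : UqB2 :=
  (1 - q ^- 2) *: (e3 * e3bar + (1 + q ^- 2) *: (z * e1)).

Lemma serre1_e : serre1 e1 e2 = 0.
Proof.
rewrite /e1 /e2 -(serre1_morph Uq_pi); apply/Uq_pi_ker.
by apply: ideal_gen_sub; left.
Qed.

Lemma serre2_e : serre2 e1 e2 = 0.
Proof.
rewrite /e1 /e2 -(serre2_morph Uq_pi); apply/Uq_pi_ker.
by apply: ideal_gen_sub; right.
Qed.

Definition torus : set (F * F) := [set h | h.1 != 0 /\ h.2 != 0].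

(* For every h in F^2 this is the endomorphism e_i |-> h_i e_i; it is
   invertible exactly when h lies in the torus. *)
Definition torus_act (h : F * F) (u : UqB2) : UqB2 :=
  free_eval (h.1 *: e1) (h.2 *: e2) (xget 0 [set x | Uq_pi x = u]).

Fact torus_act_pi h x :
  torus_act h (Uq_pi x) = free_eval (h.1 *: e1) (h.2 *: e2) x.
Proof.
rewrite /torus_act; set x' := xget _ _.
have hx' : Uq_pi x' = Uq_pi x by apply: (@xgetPex _ 0 [set y | Uq_pi y = _]); exists x.
apply/eqP; rewrite -subr_eq0 -rmorphB /=; apply/eqP.
apply: serre_pred_min; rewrite /= ?free_evalX.
- by rewrite serre1_scale serre1_e scaler0.
- by rewrite serre2_scale serre2_e scaler0.
- by apply/asboolP/Uq_pi_ker; rewrite rmorphB /= hx' subrr.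
Qed.

Fact torus_act_zmod_morphism h : zmod_morphism (torus_act h).
Proof.
move=> u v; have [x <-] := Uq_pi_surj u; have [y <-] := Uq_pi_surj v.
by rewrite -rmorphB !torus_act_pi rmorphB.
Qed.
HB.instance Definition _ h := GRing.isZmodMorphism.Build UqB2 UqB2
  (torus_act h) (torus_act_zmod_morphism h).

Fact torus_act_monoid_morphism h : monoid_morphism (torus_act h).
Proof.
split=> [|u v]; first by rewrite -(rmorph1 Uq_pi) torus_act_pi !rmorph1.
have [x <-] := Uq_pi_surj u; have [y <-] := Uq_pi_surj v.
by rewrite -rmorphM !torus_act_pi rmorphM.
Qed.
HB.instance Definition _ h := GRing.isMonoidMorphism.Build UqB2 UqB2
  (torus_act h) (torus_act_monoid_morphism h).

Fact torus_act_scalable h : scalable (torus_act h).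
Proof.
move=> c u; have [x <-] := Uq_pi_surj u.
by rewrite -linearZ !torus_act_pi linearZ.
Qed.
HB.instance Definition _ h := GRing.isScalable.Build F UqB2 UqB2 _
  (torus_act h) (torus_act_scalable h).

Lemma torus_act_e1 h : torus_act h e1 = h.1 *: e1.
Proof. by rewrite torus_act_pi free_evalX. Qed.

Lemma torus_act_e2 h : torus_act h e2 = h.2 *: e2.
Proof. by rewrite torus_act_pi free_evalX. Qed.

Definition Spec : set (set UqB2) := [set P | prime_ideal P].

Definition Prim : set (set UqB2) := [set P | left_primitive P].

Definition H_invariant (I : set UqB2) : Prop :=
  forall h, torus h -> torus_act h @` I = I.

Definition H_spec : set (set UqB2) := [set J | prime_ideal J /\ H_invariant J].

Definition Spec_stratum (J : set UqB2) : set (set UqB2) :=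
  [set P | Spec P /\ \bigcap_(h in torus) (torus_act h @` P) = J].

Definition Prim_stratum (J : set UqB2) : set (set UqB2) :=
  Spec_stratum J `&` Prim.

Definition Aut_orbit (P : set UqB2) : set (set UqB2) :=
  [set Q | exists2 phi : {lrmorphism UqB2 -> UqB2}, bijective phi
           & Q = phi @` P].

Definition Aut_orbits : set (set (set UqB2)) := Aut_orbit @` Prim.

End Serre.

Arguments e1 {F} q.
Arguments e2 {F} q.
Arguments e3 {F} q.
Arguments e3bar {F} q.
Arguments z {F} q.
Arguments z' {F} q.
Arguments H_spec {F} q.
Arguments Prim_stratum {F} q J.
Arguments Aut_orbits {F} q.

(* Main.v *)
(* By Dixmier's argument, z and z' act as scalars a and b modulo a primitive
   ideal. If (a, b) <> (0, 0), the algebra acts on functions on Z^2 through a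
   quantum torus generated by e1 and e3, with kernel <z - a, z' - b>; commuting
   with e1 and e3 isolates monomials in any larger ideal, so this kernel is
   maximal. If a = b = 0, then e3 or e3bar vanishes and a quantum plane is left,
   all of whose remaining primes contain e1 or e2. The torus acts transitively
   on each of the eight families so obtained.

   Automorphisms respect the families. They preserve <e1> and <e2>: the
   quotient F[x,y]/(xy) by commutators leaves only a swap of the two, which a
   nilpotent representation excludes; another one separates <e3> from <e3bar>,
   the only two primitive ideals that are not maximal. Finally, for b <> 0 the
   units modulo <z - a, z' - b> act as multiples of powers of e3; they are all
   scalars exactly when a <> 0, and they preclude a relation xy - q^2 yx = c
   with xy - yx invertible, which e2 and e3 satisfy for b = 0. *)

Require Import Defs.
From HB Require Import structures.
From mathcomp Require Import all_boot all_order all_algebra.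
From mathcomp Require Import boolp classical_sets cardinality reals.
From mathcomp Require Import generic_quotient ring_quotient ring lra zify.
From mathcomp.multinomials Require Import monalg.
From mathcomp.real_closed Require Import complex.
Set Implicit Arguments.
Unset Strict Implicit.
Unset Printing Implicit Defensive.
Import Order.TTheory GRing.Theory Num.Theory.
Local Open Scope classical_set_scope.
Local Open Scope ring_scope.

(** * Noncommutative polynomial identities *)

Section NoncommutativeNormalization.

(** Everything turns on [ww = e2 * e3 - e3 * e2]. It equals [(q^2 - 1) e3 e2 + z], and [ww e1] is a
    combination of [z'] and [e3^2]. Once [e1] and [e3] are invertible and [z], [z'] are scalars [a],
    [b], these two equations solve for [e2]: this is the origin of the operator [top2], where
    inverses are inverse shifts on functions on Z^2. The algebra is spanned over the polynomials in
    [z], [z'] by the monomials [e1^c e3^e e2^k] with one exponent zero. Their independence is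
    obtained after specialising [(z, z')] to some [(a, b) <> (0, 0)], from the vertices of the
    triangle that supports [e2^k]; enough specialisations then detect every nonzero coefficient,
    which yields the primality of the ideals of 0, [z], [z'] and the torus cores. Dixmier's argument
    is run for left ideals maximal among those avoiding the powers of a central [s]: [s = 1] serves
    primitive ideals, while [s] among [z], [z'], [z z'] serves invariant primes not containing [s].
    The last obstacle is that units of the quantum torus include the powers of [x]. They are
    excluded by a submodule supported on a half-plane, which exists for a square root [eps] of
    [b / (1 - q^-2)]. *)

Inductive ncexp (K : Type) :=
  | NCvar of nat | NC0 | NC1 | NCadd of ncexp K & ncexp K | NCopp of ncexp K
  | NCscale of K & ncexp K | NCmul of ncexp K & ncexp K.
Arguments NCvar {K}.
Arguments NC0 {K}.
Arguments NC1 {K}.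

(** Built from [Nat.eqb] and [if] so that it reduces under the restricted [cbv] of the tactic below,
    whatever the coefficients are. *)
Fixpoint nc_word_eq (v w : seq nat) : bool :=
  match v, w with
  | [::], [::] => true
  | i :: v', j :: w' => if Nat.eqb i j then nc_word_eq v' w' else false
  | _, _ => false
  end.

Lemma nc_word_eqP v w : nc_word_eq v w -> v = w.
Proof.
elim: v w => [|i v IHv] [|j w] //=.
by case: (PeanoNat.Nat.eqb_spec i j) => // -> /IHv ->.
Qed.

Variable K : fieldType.

Fixpoint nc_norm (e : ncexp K) : seq (K * seq nat) :=
  match e with
  | NCvar i => [:: (1, [:: i])]
  | NC0 => [::]
  | NC1 => [:: (1, [::])]
  | NCadd a b => cat (nc_norm a) (nc_norm b)
  | NCopp a => map (fun x => (- x.1, x.2)) (nc_norm a)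
  | NCscale c a => map (fun x => (c * x.1, x.2)) (nc_norm a)
  | NCmul a b =>
      flatten (map (fun x => map (fun y => (x.1 * y.1, cat x.2 y.2)) (nc_norm b))
                   (nc_norm a))
  end.

Fixpoint nc_insert (c : K) (w : seq nat) (l : seq (K * seq nat)) :=
  match l with
  | [::] => [:: (c, w)]
  | x :: l' => if nc_word_eq x.2 w then (x.1 + c, x.2) :: l'
               else x :: nc_insert c w l'
  end.

Fixpoint nc_collect (l : seq (K * seq nat)) : seq (K * seq nat) :=
  match l with
  | [::] => [::]
  | x :: l' => nc_insert x.1 x.2 (nc_collect l')
  end.

(** A conjunction in [Prop]: equality in [K] does not compute, so the vanishing of each collected
    coefficient is left as a goal for [field]. *)
Fixpoint nc_null (l : seq (K * seq nat)) : Prop :=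
  match l with
  | [::] => True
  | x :: l' => x.1 = 0 /\ nc_null l'
  end.

Variables (S : algType K) (env : seq S).

Fixpoint nc_eval (e : ncexp K) : S :=
  match e with
  | NCvar i => nth 0 env i
  | NC0 => 0
  | NC1 => 1
  | NCadd a b => nc_eval a + nc_eval b
  | NCopp a => - nc_eval a
  | NCscale c a => c *: nc_eval a
  | NCmul a b => nc_eval a * nc_eval b
  end.

Let word (w : seq nat) : S := \prod_(i <- w) nth 0 env i.
Let lincomb l : S := \sum_(x <- l) x.1 *: word x.2.

Lemma nc_eval_norm e : nc_eval e = lincomb (nc_norm e).
Proof.
rewrite /lincomb; elim: e => [i|||a IHa b IHb|a IHa|c a IHa|a IHa b IHb] /=; rewrite ?IHa ?IHb.
- by rewrite big_seq1 /= scale1r /word big_seq1.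
- by rewrite big_nil.
- by rewrite big_seq1 /= scale1r /word big_nil.
- by rewrite big_cat.
- by rewrite big_map -sumrN; apply: eq_bigr => x _; rewrite scaleNr.
- by rewrite big_map scaler_sumr; apply: eq_bigr => x _; rewrite scalerA.
- rewrite big_flatten /= big_map mulr_suml; apply: eq_bigr => x _.
  rewrite big_map mulr_sumr; apply: eq_bigr => y _ /=.
  by rewrite -scalerAl -scalerAr scalerA /word big_cat.
Qed.

Lemma nc_lincomb_collect l : lincomb (nc_collect l) = lincomb l.
Proof.
have ins c w l' : lincomb (nc_insert c w l') = c *: word w + lincomb l'.
  rewrite /lincomb; elim: l' => [|x l' IHl] /=.
    by rewrite big_seq1 big_nil addr0.
  case: ifP => [/nc_word_eqP ew|_]; rewrite !big_cons /=.
    by rewrite scalerDl ew -addrA addrCA.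
  by rewrite IHl addrCA.
elim: l => //= x l IHl; rewrite ins IHl /lincomb big_cons; congr (_ *: _ + _).
Qed.

Lemma nc_eq a b : nc_null (nc_collect (nc_norm (NCadd a (NCopp b)))) ->
  nc_eval a = nc_eval b.
Proof.
move=> h; apply/eqP; rewrite -subr_eq0; apply/eqP.
rewrite -[LHS]/(nc_eval (NCadd a (NCopp b))) nc_eval_norm -nc_lincomb_collect.
elim: (nc_collect _) h => [|x l IHl] /=; first by rewrite /lincomb big_nil.
by case=> x0 /IHl; rewrite /lincomb big_cons x0 scale0r add0r.
Qed.

End NoncommutativeNormalization.

Ltac nc_index x env :=
  lazymatch env with
  | x :: _ => constr:(O)
  | _ :: ?env' => let i := nc_index x env' in constr:(S i)
  end.

Ltac nc_add_var x env :=
  match env with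
  | _ => let _ := nc_index x env in env
  | _ => constr:(x :: env)
  end.

Ltac nc_vars t env :=
  lazymatch t with
  | (?a + ?b)%R => let env := nc_vars a env in nc_vars b env
  | (- ?a)%R => nc_vars a env
  | (_ *: ?a)%R => nc_vars a env
  | (?a * ?b)%R => let env := nc_vars a env in nc_vars b env
  | 0%R => env
  | 1%R => env
  | _ => nc_add_var t env
  end.

Ltac nc_reify K t env :=
  lazymatch t with
  | (?a + ?b)%R => let a := nc_reify K a env in let b := nc_reify K b env in
                   constr:(@NCadd K a b)
  | (- ?a)%R => let a := nc_reify K a env in constr:(@NCopp K a)
  | (?c *: ?a)%R => let a := nc_reify K a env in constr:(@NCscale K c a)
  | (?a * ?b)%R => let a := nc_reify K a env in let b := nc_reify K b env in
                   constr:(@NCmul K a b)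
  | 0%R => constr:(@NC0 K)
  | 1%R => constr:(@NC1 K)
  | _ => let i := nc_index t env in constr:(@NCvar K i)
  end.

(* Decides an identity between noncommutative polynomials, leaving as goals
   the identities between the coefficients of each word. *)
Ltac nc_coefs K :=
  rewrite ?exprS ?expr0;
  lazymatch goal with
  | |- @eq ?T ?a ?b =>
    let nil := constr:(@nil T) in
    let env := nc_vars a nil in
    let env := nc_vars b env in
    let ra := nc_reify K a env in
    let rb := nc_reify K b env in
    refine (@nc_eq K _ env ra rb _);
    cbv beta iota delta [nc_null nc_collect nc_norm nc_insert nc_word_eq
      Nat.eqb cat map flatten foldr fst snd];
    repeat split
  end.

Ltac nc K := nc_coefs K; try by [field | ring].

(** * The presented algebra and its normal form *)

Section Presentation.
Variables (K : fieldType) (q : K).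
Local Notation U := (UqB2 q).

Lemma fmonom_prod (m : fmonom bool) : << m >> = \prod_(b <- (m : seq bool)) freeX K b :> freeA K.
Proof.
case: m => w /=; elim: w => [|b w IHw].
  rewrite big_nil; congr (<< _ >>); apply/val_inj; by rewrite /= fm1.
rewrite big_cons -IHw malgM_def fgmulUU mul1r; congr (<< _ >>).
by apply/val_inj; rewrite /= fmM fmU.
Qed.

Lemma freeA_decomp (x : freeA K) : exists l : seq (K * seq bool),
  x = \sum_(t <- l) t.1 *: \prod_(b <- t.2) freeX K b.
Proof.
exists [seq (x@_m, fmonom_val m) | m <- finmap.enum_fset (msupp x)].
rewrite [LHS]monalgE big_map; apply: eq_bigr => m _ /=.
rewrite -fmonom_prod; apply/malgP => k.
by rewrite mcoeffZ !mcoeffU mulr_natr.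
Qed.

Definition Uq_word (w : seq bool) : U := \prod_(b <- w) if b then e1 q else e2 q.

Lemma Uq_decomp (u : U) : exists l : seq (K * seq bool),
  u = \sum_(t <- l) t.1 *: Uq_word t.2.
Proof.
have [x <-] := Uq_pi_surj u; have [l ->] := freeA_decomp x; exists l.
rewrite rmorph_sum; apply: eq_bigr => t _ /=; rewrite linearZ /= rmorph_prod.
by congr (_ *: _); apply: eq_bigr => -[].
Qed.

(** Words in the generators span, and a word grows by multiplication on the left. *)
Lemma Uq_ind (P : U -> Prop) :
  (forall c u v, P u -> P v -> P (c *: u + v)) -> P 1 ->
  (forall u, P u -> P (e1 q * u)) -> (forall u, P u -> P (e2 q * u)) ->
  forall u, P u.
Proof.
move=> PD P1 Pe1 Pe2 u.
have P0 : P 0 by rewrite -(subrr 1) addrC -scaleN1r; apply: PD.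
have [l ->] := Uq_decomp u; elim: l => [|t l IHl]; first by rewrite big_nil.
rewrite big_cons; apply: PD => //; rewrite /Uq_word; elim: t.2 => [|b w IHw].
  by rewrite big_nil.
by rewrite big_cons; case: b; [apply: Pe1 | apply: Pe2].
Qed.

Lemma Uq_central (u : U) : u * e1 q = e1 q * u -> u * e2 q = e2 q * u ->
  forall v, u * v = v * u.
Proof.
move=> h1 h2; apply: Uq_ind => [c v w hv hw||v hv|v hv].
- by rewrite mulrDr mulrDl -scalerAr -scalerAl hv hw.
- by rewrite mulr1 mul1r.
- by rewrite mulrA h1 -mulrA hv mulrA.
- by rewrite mulrA h2 -mulrA hv mulrA.
Qed.

Lemma Uq_hom_ext (S : algType K) (f g : {lrmorphism U -> S}) :
  f (e1 q) = g (e1 q) -> f (e2 q) = g (e2 q) -> f =1 g.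
Proof.
move=> h1 h2; apply: Uq_ind => [c u v hu hv||u hu|u hu].
- by rewrite !rmorphD /= !linearZ /= hu hv.
- by rewrite !rmorph1.
- by rewrite !rmorphM /= h1 hu.
- by rewrite !rmorphM /= h2 hu.
Qed.

Lemma Uq_lift (S : algType K) (x y : S) : serre1 q x y = 0 -> serre2 q x y = 0 ->
  exists f : {lrmorphism U -> S}, f (e1 q) = x /\ f (e2 q) = y.
Proof.
move=> s1 s2.
pose g (u : U) : S := free_eval x y (xget 0 [set t | Uq_pi q t = u]).
have gpi t : g (Uq_pi q t) = free_eval x y t.
  rewrite /g; set t' := xget _ _.
  have ht' : Uq_pi q t' = Uq_pi q t.
    by apply: (@xgetPex _ 0 [set s | Uq_pi q s = _]); exists t.
  apply/eqP; rewrite -subr_eq0 -rmorphB /=; apply/eqP.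
  apply: (serre_pred_min (q := q)); rewrite /= ?free_evalX //.
  by apply/asboolP/Uq_pi_ker; rewrite rmorphB /= ht' subrr.
have gB : zmod_morphism g.
  move=> u v; have [s <-] := Uq_pi_surj u; have [t <-] := Uq_pi_surj v.
  by rewrite -rmorphB !gpi rmorphB.
have gM : monoid_morphism g.
  split=> [|u v]; first by rewrite -(rmorph1 (Uq_pi q)) gpi rmorph1.
  have [s <-] := Uq_pi_surj u; have [t <-] := Uq_pi_surj v.
  by rewrite -rmorphM !gpi rmorphM.
have gZ : scalable g.
  by move=> c u; have [t <-] := Uq_pi_surj u; rewrite -linearZ !gpi linearZ.
pose f : {lrmorphism U -> S} := HB.pack g
  (GRing.isZmodMorphism.Build U S g gB) (GRing.isMonoidMorphism.Build U S g gM)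
  (GRing.isScalable.Build K U S _ g gZ).
by exists f; rewrite /f /= /e1 /e2 !gpi !free_evalX.
Qed.

(** With [t] the q-commutator of [x] and [y], [serre1] is [x t - q^-2 t x], and [- q^2 serre2] is
    the commutator of [y] with [y t - q^2 t y], which vanishes because the latter is a scalar. *)
Lemma Uq_lift_rel (S : algType K) (x y t : S) (a : K) : q != 0 ->
  x * y = q ^+ 2 *: (y * x) + t -> x * t = q ^- 2 *: (t * x) ->
  y * t = q ^+ 2 *: (t * y) + a *: 1 ->
  exists f : {lrmorphism U -> S},
    [/\ f (e1 q) = x, f (e2 q) = y, f (e3 q) = t & f (z q) = a *: 1].
Proof.
move=> q0 xy xt yt.
have tE : t = x * y - q ^+ 2 *: (y * x) by rewrite xy addrAC subrr add0r.
have aE : a *: 1 = y * t - q ^+ 2 *: (t * y) by rewrite yt addrAC subrr add0r.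
have [||f [fx fy]] := @Uq_lift S x y.
- have -> : serre1 q x y = x * t - q ^- 2 *: (t * x) by rewrite tE /serre1; nc K.
  by rewrite xt subrr.
- have : - q ^+ 2 *: serre2 q x y = y * (a *: 1) - (a *: 1) * y.
    by rewrite aE tE /serre2; nc K.
  rewrite -scalerAl -scalerAr mulr1 mul1r subrr => /eqP.
  by rewrite scaler_eq0 oppr_eq0 expf_eq0 (negPf q0) andbF /= => /eqP.
have ft : f (e3 q) = t by rewrite /e3 rmorphB /= linearZ /= !rmorphM /= fx fy tE.
exists f; split=> //.
by rewrite /z rmorphB /= linearZ /= !rmorphM /= fy ft aE.
Qed.

End Presentation.

Section Relations.
Variables (K : fieldType) (q : K).
Hypotheses (q0 : q != 0) (qn : forall n : nat, (0 < n)%N -> q ^+ n != 1).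
Local Notation U := (UqB2 q).
Local Notation x1 := (e1 q).
Local Notation x2 := (e2 q).
Local Notation x3 := (e3 q).
Local Notation zz := (z q).
Local Notation zz' := (z' q).

Lemma q2B1 : q ^+ 2 - 1 != 0.
Proof. by rewrite subr_eq0 qn. Qed.

Lemma q2D1 : q ^+ 2 + 1 != 0.
Proof.
apply: contra (qn (n := 4) isT) => /eqP h.
by rewrite -subr_eq0 (exprM q 2 2) -[1]mul1r -expr2 subr_sqr h mulr0.
Qed.

(* The non-vanishing conditions in the normal form in which field produces them. *)
Let q2B1_horner : q * q - 1 != 0.
Proof. by rewrite -expr2 q2B1. Qed.
Let q2D1_horner : q * q + 1 != 0.
Proof. by rewrite -expr2 q2D1. Qed.
Let q4B1_horner : q * (q * (q * q)) - 1 != 0.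
Proof. by have := qn (n := 4) isT; rewrite !exprS expr0 mulr1 subr_eq0. Qed.

Lemma e1e2 : x1 * x2 = q ^+ 2 *: (x2 * x1) + x3.
Proof. by rewrite /e3 addrC subrK. Qed.

Lemma e1e3 : x1 * x3 = q ^- 2 *: (x3 * x1).
Proof.
apply/eqP; rewrite -subr_eq0; apply/eqP; rewrite -[RHS](serre1_e q) /e3 /serre1.
nc K.
Qed.

Lemma e2e3 : x2 * x3 = q ^+ 2 *: (x3 * x2) + zz.
Proof. by rewrite /z addrC subrK. Qed.

Let r12 : x1 * x2 - q ^+ 2 *: (x2 * x1) - x3 = 0.
Proof. by rewrite e1e2 addrAC addrK subrr. Qed.
Let r13 : x1 * x3 - q ^- 2 *: (x3 * x1) = 0.
Proof. by rewrite e1e3 subrr. Qed.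
Let r23 : x2 * x3 - q ^+ 2 *: (x3 * x2) - zz = 0.
Proof. by rewrite e2e3 addrAC addrK subrr. Qed.

(** Commutation with [e2] is the second Serre relation rewritten; commutation with [e1] follows from
    [e1e2] and [e1e3]. Here and below, such an identity is certified by writing the difference of
    its sides as an explicit combination of relators that vanish. *)
Lemma z_central u : zz * u = u * zz.
Proof.
apply: Uq_central => {u}.
  apply/eqP; rewrite eq_sym -subr_eq0; apply/eqP.
  transitivity ((x1 * x2 - q ^+ 2 *: (x2 * x1) - x3) * x3
    + q ^+ 2 *: (x2 * (x1 * x3 - q ^- 2 *: (x3 * x1)))
    - q ^+ 2 *: ((x1 * x3 - q ^- 2 *: (x3 * x1)) * x2)
    - x3 * (x1 * x2 - q ^+ 2 *: (x2 * x1) - x3)).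
    by rewrite /z; nc K.
  by rewrite r12 r13 !(mul0r, mulr0) !scaler0 !(addr0, subr0).
apply/eqP; rewrite -subr_eq0; apply/eqP.
transitivity (q ^+ 2 *: serre2 q x1 x2); last by rewrite serre2_e scaler0.
by rewrite /z /e3 /serre2; nc K.
Qed.

(** This commutator q-commutes with [e2] and [e3], and [e3e2], [w_e1] express [e3 e2] and [ww e1] in
    terms of it, the center and [e3^2]. *)
Definition ww : U := x2 * x3 - x3 * x2.

Lemma wwE : ww = (q ^+ 2 - 1) *: (x3 * x2) + zz.
Proof. by rewrite /ww /z; nc K. Qed.

Lemma e3e2 : x3 * x2 = (q ^+ 2 - 1)^-1 *: (ww - zz).
Proof. by rewrite wwE addrK scalerA mulVf ?scale1r // q2B1. Qed.

Lemma w_e3 : ww * x3 = q ^+ 2 *: (x3 * ww).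
Proof.
apply/eqP; rewrite -subr_eq0; apply/eqP.
transitivity ((x2 * x3 - q ^+ 2 *: (x3 * x2) - zz) * x3 
  - x3 * (x2 * x3 - q ^+ 2 *: (x3 * x2) - zz) + (zz * x3 - x3 * zz)).
  by rewrite /ww; nc K.
by rewrite r23 z_central subrr !(mul0r, mulr0) subr0 addr0.
Qed.

Lemma e2_w : x2 * ww = q ^+ 2 *: (ww * x2).
Proof.
apply/eqP; rewrite -subr_eq0; apply/eqP.
transitivity (x2 * (x2 * x3 - q ^+ 2 *: (x3 * x2) - zz)
  - (x2 * x3 - q ^+ 2 *: (x3 * x2) - zz) * x2 - (zz * x2 - x2 * zz)).
  by rewrite /ww; nc K.
by rewrite r23 z_central subrr !(mul0r, mulr0) subr0 subrr.
Qed.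

Lemma e1_w : x1 * ww = ww * x1 + (1 - q ^- 2) *: (x3 * x3).
Proof.
apply/eqP; rewrite -subr_eq0; apply/eqP.
transitivity ((q ^+ 2 - 1) *: ((x1 * x3 - q ^- 2 *: (x3 * x1)) * x2)
   + (1 - q ^- 2) *: (x3 * (x1 * x2 - q ^+ 2 *: (x2 * x1) - x3)) - (zz * x1 - x1 * zz)).
  by rewrite wwE; nc K.
by rewrite r12 r13 z_central subrr !(mul0r, mulr0) !scaler0 addr0 subr0.
Qed.

Lemma z'E : zz' = (1 - q ^- 2) *: (x3 * x3 + (1 + q ^- 2) *: (ww * x1)).
Proof.
rewrite /z' wwE (_ : e3bar q = x3 + (q ^+ 2 - q ^- 2) *: (x2 * x1)); last first.
  by rewrite /e3bar /e3; nc K.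
by nc K.
Qed.

Lemma z'_central u : zz' * u = u * zz'.
Proof.
have rw1 : x1 * ww - ww * x1 - (1 - q ^- 2) *: (x3 * x3) = 0.
  by rewrite e1_w addrAC addrK subrr.
have rw2 : x2 * ww - q ^+ 2 *: (ww * x2) = 0 by rewrite e2_w subrr.
have rw3 : ww * x3 - q ^+ 2 *: (x3 * ww) = 0 by rewrite w_e3 subrr.
have rwE : ww - (q ^+ 2 - 1) *: (x3 * x2) - zz = 0 by rewrite wwE addrAC addrK subrr.
apply: Uq_central => {u}; apply/eqP; rewrite eq_sym -subr_eq0; apply/eqP.
  transitivity ((1 - q ^- 2) *: ((x1 * x3 - q ^- 2 *: (x3 * x1)) * x3
   + q ^- 2 *: (x3 * (x1 * x3 - q ^- 2 *: (x3 * x1)))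
   + (1 + q ^- 2) *: ((x1 * ww - ww * x1 - (1 - q ^- 2) *: (x3 * x3)) * x1))).
    by rewrite z'E; nc K.
  by rewrite r13 rw1 !(mul0r, mulr0) !scaler0 !addr0 scaler0.
transitivity ((1 - q ^- 2) *: ((x2 * x3 - q ^+ 2 *: (x3 * x2) - zz) * x3
   + q ^+ 2 *: (x3 * (x2 * x3 - q ^+ 2 *: (x3 * x2) - zz)) + (zz * x3 - x3 * zz)
   + (1 + q ^- 2) *: ((x2 * ww - q ^+ 2 *: (ww * x2)) * x1
     - ww * (x1 * x2 - q ^+ 2 *: (x2 * x1) - x3)
     - (ww * x3 - q ^+ 2 *: (x3 * ww)) - q ^+ 2 *: (x3 * (ww - (q ^+ 2 - 1) *: (x3 * x2) - zz))))).
  by rewrite z'E; nc K.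
by rewrite r23 rw2 r12 rw3 rwE z_central subrr !(mul0r, mulr0, scaler0, addr0, subr0).
Qed.

Lemma w_e1 : ww * x1 = (1 - q ^- 4)^-1 *: zz' - (1 + q ^- 2)^-1 *: (x3 * x3).
Proof.
have [h2 h4] := (q2D1_horner, q4B1_horner).
by rewrite z'E; nc_coefs K; field; rewrite ?q0 ?h2 ?h4.
Qed.

(** Moving [e1] to the right gives [e3 e2 e1 + q^-2 e3^2]; then [e3 e2] is replaced by a multiple of
    [ww - z], and [w_e1] removes [ww e1]. This is the rewriting rule that eliminates monomials
    involving all three of [e1], [e3], [e2]. *)
Lemma e1e3e2 : exists al be ga : K,
  x1 * x3 * x2 = al *: zz' + be *: (x3 * x3) + ga *: (zz * x1).
Proof.
exists ((q ^+ 2 - 1)^-1 * (1 - q ^- 4)^-1).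
exists (q ^- 2 - (q ^+ 2 - 1)^-1 * (1 + q ^- 2)^-1), (- (q ^+ 2 - 1)^-1).
have [h1 h2 h4] := And3 q2B1_horner q2D1_horner q4B1_horner.
transitivity ((x1 * x3 - q ^- 2 *: (x3 * x1)) * x2
 + q ^- 2 *: (x3 * (x1 * x2 - q ^+ 2 *: (x2 * x1) - x3)) + x3 * x2 * x1 + q ^- 2 *: (x3 * x3)).
  by nc K.
rewrite r12 r13 e3e2 -scalerAl [(ww - zz) * x1]mulrBl w_e1 !(mul0r, mulr0) scaler0.
by nc_coefs K; field; rewrite ?q0 ?h1 ?h2 ?h4.
Qed.

End Relations.

(* Unification would otherwise unfold the generators while matching sums and
   scalar multiples. *)
Notation "''e3_' q" := (locked (e3 q)) (at level 8, q at level 2, format "''e3_' q").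
Notation "''z_' q" := (locked (z q)) (at level 8, q at level 2, format "''z_' q").
Notation "''z'_' q" := (locked (z' q)) (at level 8, q at level 2, format "''z'_' q").

Section LockedRelations.
Variables (K : fieldType) (q : K).
Hypotheses (q0 : q != 0) (qn : forall n : nat, (0 < n)%N -> q ^+ n != 1).

Lemma x1x2 : e1 q * e2 q = q ^+ 2 *: (e2 q * e1 q) + 'e3_q.
Proof. by rewrite -lock e1e2. Qed.

Lemma x1x3 : e1 q * 'e3_q = q ^- 2 *: ('e3_q * e1 q).
Proof. by rewrite -lock e1e3. Qed.

Lemma x2x3 : e2 q * 'e3_q = q ^+ 2 *: ('e3_q * e2 q) + 'z_q.
Proof. by rewrite -!lock e2e3. Qed.

Lemma z_comm u : 'z_q * u = u * 'z_q.
Proof. by rewrite -lock z_central. Qed.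

Lemma z'_comm u : 'z'_q * u = u * 'z'_q.
Proof. by rewrite -lock z'_central. Qed.

Lemma x1x3x2 : exists al be ga : K,
  e1 q * 'e3_q * e2 q = al *: 'z'_q + be *: ('e3_q * 'e3_q) + ga *: ('z_q * e1 q).
Proof. by rewrite -!lock; exact: e1e3e2. Qed.

End LockedRelations.

Lemma big_fiber (V : nmodType) (I J : eqType) (h : I -> J) (l : seq I) (F : I -> V) :
  \sum_(x <- l) F x = \sum_(t <- undup (map h l)) \sum_(x <- l | h x == t) F x.
Proof.
rewrite (exchange_big_dep xpredT) //= [LHS]big_seq [RHS]big_seq.
apply: eq_bigr => x xl; rewrite -big_filter (_ : filter _ _ = [:: h x]) ?big_seq1 //.
apply/perm_small_eq => //; apply: uniq_perm; rewrite ?filter_uniq ?undup_uniq //.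
move=> t; rewrite mem_filter inE eq_sym mem_undup andb_idr // => /eqP ->.
exact: map_f.
Qed.

Section NormalForm.
Variables (K : fieldType) (q : K).
Hypotheses (q0 : q != 0) (qn : forall n : nat, (0 < n)%N -> q ^+ n != 1).
Local Notation U := (UqB2 q).
Local Notation x1 := (e1 q).
Local Notation x2 := (e2 q).
Local Notation x3 := 'e3_q.
Local Notation zz := 'z_q.
Local Notation zz' := 'z'_q.

Definition nf (t : nat * nat * nat) : U := x1 ^+ t.1.1 * x3 ^+ t.1.2 * x2 ^+ t.2.

(** The monomials left over by the rule [x1x3x2]. They span over the polynomials in [z] and [z'],
    and become linearly independent over [K] modulo [<z - a, z' - b>] for [(a, b) <> (0, 0)]. *)
Definition is_nf (t : nat * nat * nat) : bool :=
  [|| t.1.1 == 0%N, t.1.2 == 0%N | t.2 == 0%N].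

Lemma e1_e3X a : x1 * x3 ^+ a = q ^- (2 * a) *: (x3 ^+ a * x1).
Proof.
elim: a => [|a IHa]; first by rewrite expr0 mulr1 mul1r invr1 scale1r.
rewrite exprSr mulrA IHa -scalerAl -[x3 ^+ a * x1 * x3]mulrA (x1x3 q0) -scalerAr scalerA.
by rewrite -invfM -exprD mulrA mulnS addnC.
Qed.

Let r21 : x2 * x1 - q ^- 2 *: (x1 * x2) + q ^- 2 *: x3 = 0.
Proof.
by rewrite x1x2 scalerDr scalerA mulVf ?expf_neq0 // scale1r opprD addrA subrr add0r addNr.
Qed.

Let r31 : x3 * x1 - q ^+ 2 *: (x1 * x3) = 0.
Proof. by rewrite (x1x3 q0) scalerA divff ?expf_neq0 // scale1r subrr. Qed.

Lemma e2_e1X c : exists al be : K,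
  x2 * x1 ^+ c.+1 = al *: (x1 ^+ c.+1 * x2) + be *: (x1 ^+ c * x3).
Proof.
elim: c => [|c [al [be IHc]]].
  exists (q ^- 2), (- q ^- 2); apply/eqP; rewrite -subr_eq0; apply/eqP.
  by rewrite -[RHS]r21; nc K.
exists (al * q ^- 2), (be * q ^+ 2 - al * q ^- 2).
rewrite exprSr mulrA IHc !exprSr; move: (x1 ^+ c) => X.
apply/eqP; rewrite -subr_eq0; apply/eqP.
transitivity (al *: (X * x1 * (x2 * x1 - q ^- 2 *: (x1 * x2) + q ^- 2 *: x3)) +
  be *: (X * (x3 * x1 - q ^+ 2 *: (x1 * x3)))); first by nc K.
by rewrite r21 r31 !(mulr0, scaler0, addr0).
Qed.

Lemma e2_e3X a : exists al be : K,
  x2 * x3 ^+ a.+1 = al *: (x3 ^+ a.+1 * x2) + be *: (zz * x3 ^+ a).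
Proof.
elim: a => [|a [al [be IHa]]].
  by exists (q ^+ 2), 1; rewrite !expr1 expr0 mulr1 scale1r x2x3.
exists (al * q ^+ 2), (be + al).
rewrite exprSr mulrA IHa mulrDl -!scalerAl -(mulrA (x3 ^+ a.+1) x2) x2x3 mulrDr.
rewrite scalerDr -scalerAr scalerA mulrA -!exprSr -(z_comm q0) -addrA; congr (_ + _).
  by rewrite mulrA -exprSr.
by rewrite -[zz * _ * x3]mulrA -exprSr addrC -scalerDl.
Qed.

Section Span.
Variable Q : U -> Prop.
Hypotheses (QL : forall c u v, Q u -> Q v -> Q (c *: u + v))
  (Qz : forall u, Q u -> Q (zz * u)) (Qz' : forall u, Q u -> Q (zz' * u))
  (Qnf : forall t, is_nf t -> Q (nf t)).

Let Q0 : Q 0.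
Proof.
by have := QL (-1) (Qnf (t := (0, 0, 0)%N) isT) (Qnf (t := (0, 0, 0)%N) isT); rewrite scaleN1r addNr.
Qed.
Let QD u v : Q u -> Q v -> Q (u + v).
Proof. by move=> hu hv; rewrite -[u]scale1r; apply: QL. Qed.
Let QZ c u : Q u -> Q (c *: u).
Proof. by move=> hu; rewrite -[_ *: _]addr0; apply: QL. Qed.

(** Induction on the exponent of [x2]: if all three exponents are positive, one [x1] is moved past
    [x3 ^+ a] to form the factor [x1 * x3 * x2], and each term of its reduction has one [x2]
    less. *)
Let Q_nf_all c a b : Q (nf (c, a, b)).
Proof.
elim: b c a => [|b IHb] c a; first by apply: Qnf; rewrite /is_nf !orbT.
case: c => [|c]; first exact: Qnf.
case: a => [|a]; first by apply: Qnf; rewrite /is_nf !orbT.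
have -> : nf (c.+1, a.+1, b.+1) = q ^- (2 * a) *: (x1 ^+ c * x3 ^+ a * (x1 * x3 * x2) * x2 ^+ b).
  rewrite /nf /= (exprSr x1) (exprS x2) (exprSr x3) !mulrA -(mulrA (x1 ^+ c) x1) e1_e3X.
  by rewrite -!(scalerAl, scalerAr) !mulrA.
apply: (QZ); have [al [be [ga ->]]] := x1x3x2 q0 qn.
rewrite !mulrDr !mulrDl -!scalerAr -!scalerAl; apply: (QD); first apply: (QD); apply: QZ.
- by rewrite -(z'_comm q0) -mulrA; apply: Qz'; apply: IHb.
- have -> : x1 ^+ c * x3 ^+ a * (x3 * x3) * x2 ^+ b = nf (c, a.+2, b); last exact: IHb.
  by rewrite /nf /= !exprSr !mulrA.
- rewrite mulrA -(z_comm q0) -!mulrA; apply: Qz.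
  have -> : x1 ^+ c * (x3 ^+ a * (x1 * x2 ^+ b)) = q ^+ (2 * a) *: nf (c.+1, a, b); last first.
    by apply: QZ; apply: IHb.
  rewrite /nf /= exprSr -(mulrA (x1 ^+ c) x1) e1_e3X -!(scalerAr, scalerAl) scalerA.
  by rewrite divff ?scale1r ?expf_neq0 // !mulrA.
Qed.

(** A factor [x2] on the left is carried to the right: crossing a power of [x1] costs a term with
    one [x1] traded for an [x3], and crossing a power of [x3] costs a term with one [x3] traded for
    [z]. *)
Lemma nf_e1_e2 t : Q (x1 * nf t) /\ Q (x2 * nf t).
Proof.
case: t => [[c a] b]; split.
  have -> : x1 * nf (c, a, b) = nf (c.+1, a, b) by rewrite /nf /= exprS !mulrA.
  exact: Q_nf_all.
have aux c' : Q (x1 ^+ c' * x2 * (x3 ^+ a * x2 ^+ b)).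
  case: a => [|a].
    have -> : x1 ^+ c' * x2 * (x3 ^+ 0 * x2 ^+ b) = nf (c', 0, b.+1)%N; last exact: Q_nf_all.
    by rewrite /nf /= expr0 mul1r mulr1 -mulrA -exprS.
  have [al [be h]] := e2_e3X a.
  rewrite -mulrA (mulrA x2) h mulrDl mulrDr -!scalerAl -!scalerAr; apply: QD; apply: QZ.
    have -> : x1 ^+ c' * (x3 ^+ a.+1 * x2 * x2 ^+ b) = nf (c', a.+1, b.+1); last exact: Q_nf_all.
    by rewrite /nf /= (exprS x2) !mulrA.
  rewrite !mulrA -(z_comm q0) -!mulrA; apply: Qz.
  have -> : x1 ^+ c' * (x3 ^+ a * x2 ^+ b) = nf (c', a, b) by rewrite /nf /= mulrA.
  exact: Q_nf_all.
case: c => [|c].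
  have -> : x2 * nf (0, a, b)%N = x1 ^+ 0 * x2 * (x3 ^+ a * x2 ^+ b); last exact: aux.
  by rewrite /nf /= expr0 !mul1r.
have [al [be h]] := e2_e1X c.
have -> : x2 * nf (c.+1, a, b) = al *: (x1 ^+ c.+1 * x2 * (x3 ^+ a * x2 ^+ b)) + be *: nf (c, a.+1, b).
  rewrite /nf /= -(mulrA (x1 ^+ c.+1)) mulrA h mulrDl -!scalerAl (exprS x3).
  by rewrite !mulrA.
by apply: QD; apply: QZ; [apply: aux | apply: Q_nf_all].
Qed.

End Span.

Lemma nf_ind (Q : U -> Prop) :
  (forall c u v, Q u -> Q v -> Q (c *: u + v)) ->
  (forall u, Q u -> Q (zz * u)) -> (forall u, Q u -> Q (zz' * u)) ->
  (forall t, is_nf t -> Q (nf t)) -> forall u, Q u.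
Proof.
pose closed (Q : U -> Prop) := [/\ forall c u v, Q u -> Q v -> Q (c *: u + v),
  forall u, Q u -> Q (zz * u), forall u, Q u -> Q (zz' * u) &
  forall t, is_nf t -> Q (nf t)].
(* The predicate is generalised because the induction hypothesis for [u] is applied to
   [fun v => Q (x1 * v)], and likewise for [x2]. *)
suff key u : forall Q, closed Q -> Q u by move=> QL Qz Qz' Qnf u; apply: key; split.
move: u; clear Q; apply: Uq_ind => [c u v hu hv||u hu|u hu] Q cQ; have [QL Qz Qz' Qnf] := cQ.
- by apply: QL; [apply: hu | apply: hv].
- by have := Qnf (0, 0, 0)%N isT; rewrite /nf /= !expr0 !mulr1.
- apply: (hu (fun v => Q (x1 * v))); split => [c v w hv hw|v hv|v hv|t _].
  + by rewrite mulrDr -scalerAr; apply: QL.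
  + by rewrite mulrA -(z_comm q0) -mulrA; apply: Qz.
  + by rewrite mulrA -(z'_comm q0) -mulrA; apply: Qz'.
  + by have [] := nf_e1_e2 QL Qz Qz' Qnf t.
- apply: (hu (fun v => Q (x2 * v))); split => [c v w hv hw|v hv|v hv|t _].
  + by rewrite mulrDr -scalerAr; apply: QL.
  + by rewrite mulrA -(z_comm q0) -mulrA; apply: Qz.
  + by rewrite mulrA -(z'_comm q0) -mulrA; apply: Qz'.
  + by have [] := nf_e1_e2 QL Qz Qz' Qnf t.
Qed.

(* The image of a bivariate polynomial in the center: the inner variable is
   sent to z and the outer one to z'. *)
Definition cen (p : {poly {poly K}}) : U := (map_poly (horner_alg zz) p).[zz'].

Fact cen_is_additive : zmod_morphism cen.
Proof. by move=> p r; rewrite /cen rmorphB hornerD hornerN. Qed.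
HB.instance Definition _ :=
  GRing.isZmodMorphism.Build {poly {poly K}} U cen cen_is_additive.

Lemma cenCM c p : cen (c%:P * p) = horner_alg zz c * cen p.
Proof. by rewrite /cen rmorphM /= map_polyC hornerCM. Qed.

Lemma cenMX p : cen (p * 'X) = cen p * zz'.
Proof. by rewrite /cen rmorphM /= map_polyX hornerMX. Qed.

Lemma cenC c : cen c%:P = horner_alg zz c.
Proof. by rewrite /cen map_polyC hornerC. Qed.

Lemma nf_repr (u : U) : exists (s : seq (nat * nat * nat)) (p : nat * nat * nat -> {poly {poly K}}),
  [/\ uniq s, all is_nf s & u = \sum_(t <- s) cen (p t) * nf t].
Proof.
suff [l hl ->] : exists2 l : seq ({poly {poly K}} * (nat * nat * nat)),
    all (fun x => is_nf x.2) l & u = \sum_(x <- l) cen x.1 * nf x.2.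
  exists (undup (map snd l)), (fun t => \sum_(x <- l | x.2 == t) x.1).
  split; [exact: undup_uniq | |].
    by apply/allP => t; rewrite mem_undup => /mapP[x xl ->]; apply: (allP hl).
  under [RHS]eq_bigr do rewrite raddf_sum mulr_suml.
  rewrite (big_fiber snd); apply: eq_bigr => t _.
  by apply: eq_bigr => x /eqP ->.
move: u; apply: nf_ind => [c u v [l hl ->] [m hm ->]|u [l hl ->]|u [l hl ->]|t ht].
- exists ([seq (c%:P%:P * x.1, x.2) | x <- l] ++ m).
    by rewrite all_cat hm andbT all_map.
  rewrite big_cat big_map scaler_sumr; congr (_ + _); apply: eq_bigr => x _ /=.
  by rewrite cenCM /= horner_algC -scalerAl mul1r scalerAl.
- exists [seq ('X%:P * x.1, x.2) | x <- l]; first by rewrite all_map.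
  rewrite big_map mulr_sumr; apply: eq_bigr => x _ /=.
  by rewrite cenCM /= horner_algX mulrA.
- exists [seq (x.1 * 'X, x.2) | x <- l]; first by rewrite all_map.
  rewrite big_map mulr_sumr; apply: eq_bigr => x _ /=.
  by rewrite cenMX mulrA (z'_comm q0).
- exists [:: (1, t)]; first by rewrite /= ht.
  by rewrite big_seq1 /= cenC horner_algC scale1r mul1r.
Qed.

End NormalForm.

(** * The quantum torus *)

Section LatticeOperators.
Variable K : fieldType.
Local Notation V := (int * int -> K).

(** All functions on Z^2 are allowed, without a support condition, since constant and quasi-periodic
    vectors serve as test vectors later. Linearity is bundled so that the operators form an algebra,
    a possible target of [Uq_lift]. *)
Record zend := Zend {
  zend_fun :> V -> V;
  zend_lin : forall c v w, zend_fun (fun r => c * v r + w r) =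
                           (fun r => c * zend_fun v r + zend_fun w r)
}.

Lemma zend_ext (f g : zend) : (forall v, f v = g v) -> f = g.
Proof.
case: f g => f hf [g hg] /= fg; have {}fg : f = g by apply/funext.
by subst g; congr Zend; exact: Prop_irrelevance.
Qed.

HB.instance Definition _ := gen_eqMixin zend.
HB.instance Definition _ := gen_choiceMixin zend.

Fact zend_add_lin (f g : zend) c v w :
  (fun r => f (fun r => c * v r + w r) r + g (fun r => c * v r + w r) r) =
  (fun r => c * (f v r + g v r) + (f w r + g w r)).
Proof. by apply/funext => r; rewrite !zend_lin /=; ring. Qed.
Definition zend_add f g := Zend (zend_add_lin f g).

Fact zend_scale_lin a (f : zend) c v w :
  (fun r => a * f (fun r => c * v r + w r) r) =
  (fun r => c * (a * f v r) + a * f w r).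
Proof. by apply/funext => r; rewrite !zend_lin /=; ring. Qed.
Definition zend_scale a f := Zend (zend_scale_lin a f).

Fact zend_zero_lin c (v w : V) : (fun _ : int * int => 0 : K) = (fun r => c * 0 + 0).
Proof. by apply/funext => r; ring. Qed.
Definition zend_zero := @Zend (fun _ _ => 0) zend_zero_lin.

Definition zend_opp := zend_scale (-1).

Definition zend_one := @Zend id (fun c v w => erefl).

Fact zend_mul_lin (f g : zend) c v w :
  f (g (fun r => c * v r + w r)) = (fun r => c * f (g v) r + f (g w) r).
Proof. by rewrite !zend_lin. Qed.
Definition zend_mul f g := Zend (zend_mul_lin f g).

Fact zend_addA : associative zend_add.
Proof. by move=> f g h; apply: zend_ext => v; apply/funext => r /=; rewrite addrA. Qed.
Fact zend_addC : commutative zend_add.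
Proof. by move=> f g; apply: zend_ext => v; apply/funext => r /=; rewrite addrC. Qed.
Fact zend_add0 : left_id zend_zero zend_add.
Proof. by move=> f; apply: zend_ext => v; apply/funext => r /=; rewrite add0r. Qed.
Fact zend_addN : left_inverse zend_zero zend_opp zend_add.
Proof. by move=> f; apply: zend_ext => v; apply/funext => r /=; rewrite mulN1r addNr. Qed.
HB.instance Definition _ :=
  GRing.isZmodule.Build zend zend_addA zend_addC zend_add0 zend_addN.

Fact zend_mulA : associative zend_mul.
Proof. by move=> f g h; apply: zend_ext. Qed.
Fact zend_mul1 : left_id zend_one zend_mul.
Proof. by move=> f; apply: zend_ext. Qed.
Fact zend_mulr1 : right_id zend_one zend_mul.
Proof. by move=> f; apply: zend_ext. Qed.
Fact zend_mulDl : left_distributive zend_mul zend_add.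
Proof. by move=> f g h; apply: zend_ext. Qed.
Fact zend_mulDr : right_distributive zend_mul zend_add.
Proof.
move=> f g h; apply: zend_ext => v; apply/funext => r /=.
have := zend_lin f 1 (g v) (h v).
under [X in f X]eq_fun do rewrite mul1r.
by move=> ->; rewrite mul1r.
Qed.
Fact zend_one_neq0 : zend_one != 0.
Proof.
apply/eqP => /(congr1 (fun f : zend => f (fun _ => 1) 0)) /= /eqP.
by rewrite oner_eq0.
Qed.
HB.instance Definition _ := GRing.Zmodule_isNzRing.Build zend
  zend_mulA zend_mul1 zend_mulr1 zend_mulDl zend_mulDr zend_one_neq0.

Fact zend_scaleA a b f : zend_scale a (zend_scale b f) = zend_scale (a * b) f.
Proof. by apply: zend_ext => v; apply/funext => r /=; rewrite mulrA. Qed.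
Fact zend_scale1 : left_id 1 zend_scale.
Proof. by move=> f; apply: zend_ext => v; apply/funext => r /=; rewrite mul1r. Qed.
Fact zend_scaleDr : right_distributive zend_scale +%R.
Proof. by move=> a f g; apply: zend_ext => v; apply/funext => r /=; rewrite mulrDr. Qed.
Fact zend_scaleDl f : {morph zend_scale^~ f : a b / a + b}.
Proof. by move=> a b; apply: zend_ext => v; apply/funext => r /=; rewrite mulrDl. Qed.
HB.instance Definition _ := GRing.Zmodule_isLmodule.Build K zend
  zend_scaleA zend_scale1 zend_scaleDr zend_scaleDl.

Fact zend_scaleAl (a : K) (f g : zend) : a *: (f * g) = (a *: f) * g.
Proof. by apply: zend_ext. Qed.
HB.instance Definition _ := GRing.Lmodule_isLalgebra.Build K zend zend_scaleAl.

Fact zend_scaleAr (a : K) (f g : zend) : a *: (f * g) = f * (a *: g).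
Proof.
apply: zend_ext => v; apply/funext => r /=.
have := zend_lin f a (g v) (fun _ => 0).
under [X in f X]eq_fun do rewrite addr0.
have := zend_lin f (-1) v v.
move=> h ->.
(* Linearity with coefficient -1 on zero vectors gives that [f] maps zero to zero. *)
have := zend_lin f (-1) (fun _ => 0) (fun _ => 0).
under [X in f X]eq_fun do rewrite mulr0 addr0.
by move=> ->; rewrite mulN1r addNr addr0.
Qed.
HB.instance Definition _ := GRing.Lalgebra_isAlgebra.Build K zend zend_scaleAr.

Lemma zendD (f g : zend) v r : (f + g) v r = f v r + g v r. Proof. by []. Qed.
Lemma zendZ c (f : zend) v r : (c *: f) v r = c * f v r. Proof. by []. Qed.
Lemma zendM (f g : zend) v : (f * g) v = f (g v). Proof. by []. Qed.
Lemma zend_sum (I : Type) (s : seq I) (P : pred I) (f : I -> zend) v r :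
  (\sum_(i <- s | P i) f i) v r = \sum_(i <- s | P i) f i v r.
Proof.
by elim/big_rec2: _ => [//|i x y _ <-].
Qed.

End LatticeOperators.

Section QuantumTorus.
Variables (K : fieldType) (q : K).
Hypotheses (q0 : q != 0) (qn : forall n : nat, (0 < n)%N -> q ^+ n != 1).
Local Notation Q := (q ^+ 2).
Local Notation U := (UqB2 q).

Let Q0 : Q != 0. Proof. exact: expf_neq0. Qed.

Lemma Qexp_inj (m n : int) : Q ^ m = Q ^ n -> m = n.
Proof.
wlog: m n / m <= n => [hw|mn].
  by case: (leP m n) => [/hw//|/ltW/hw h /esym/h].
move=> h; have {h} : Q ^ (n - m) = 1 by rewrite expfzDr // -h -expfzDr // subrr.
have : 0 <= n - m by rewrite subr_ge0.
case: (n - m) (subrK m n) => // -[|k] <- _; first by rewrite add0r.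
by move/eqP; rewrite -exprnP -exprM (negPf (qn _)).
Qed.

Fact lop_lin (p : int * int) c (v w : int * int -> K) :
  (fun r => Q ^ (r.1 * p.2) * (c * v (r - p) + w (r - p))) =
  (fun r => c * (Q ^ (r.1 * p.2) * v (r - p)) + Q ^ (r.1 * p.2) * w (r - p)).
Proof. by apply/funext => r; ring. Qed.

(* The monomial x^i t^j of the quantum torus t x = q^2 x t, acting on its
   regular representation. *)
Definition lop (p : int * int) : zend K :=
  Zend (fun c v w => lop_lin p c v w).

Lemma lopE p v r : lop p v r = Q ^ (r.1 * p.2) * v (r - p).
Proof. by []. Qed.

Lemma lopM p r : lop p * lop r = Q ^ (- (p.1 * r.2)) *: lop (p + r).
Proof.
apply: zend_ext => v; apply/funext => s; rewrite zendM zendZ !lopE mulrA.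
rewrite mulrA -!expfzDr // opprD addrA; congr (Q ^ _ * _).
by rewrite /= mulrBl mulrDr; ring.
Qed.

Lemma lop0 : lop 0 = 1.
Proof.
by apply: zend_ext => v; apply/funext => r; rewrite lopE mulr0 expr0z mul1r subr0.
Qed.

Definition dirac0 (r : int * int) : K := (r == 0)%:R.

Definition bsum (c : int * int -> K) (s : seq (int * int)) : zend K :=
  \sum_(r <- s) c r *: lop r.

(** [lop p] carries the unit mass at the origin to [p], so applying an operator to [dirac0] reads
    off its coefficients; in particular the monomials are independent. *)
Lemma bsum_dirac0 c s r : uniq s ->
  bsum c s dirac0 r = if r \in s then c r * Q ^ (r.1 * r.2) else 0.
Proof.
move=> us; rewrite /bsum zend_sum.
under eq_bigr => p _ do rewrite zendZ lopE /dirac0 subr_eq0.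
case: ifP => rs.
  rewrite (bigD1_seq r) //= eqxx mulr1 big1 ?addr0 // => p.
  by rewrite eq_sym => /negPf ->; rewrite !mulr0.
rewrite big_seq big1 // => p ps; case: eqP => [rp|_]; last by rewrite !mulr0.
by rewrite rp ps in rs.
Qed.

(** Membership in the quantum torus, with a reduced expression, so that [s] is the true support. *)
Definition band (f : zend K) : Prop := exists c s,
  [/\ uniq s, all (fun r => c r != 0) s & f = bsum c s].

Lemma band_list (l : seq (K * (int * int))) : band (\sum_(x <- l) x.1 *: lop x.2).
Proof.
pose c r := \sum_(x <- l | x.2 == r) x.1.
exists c, [seq r <- undup (map snd l) | c r != 0]; split.
- by rewrite filter_uniq ?undup_uniq.
- exact: filter_all.
rewrite (big_fiber snd) /bsum big_filter [RHS]big_mkcond; apply: eq_bigr => r _.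
rewrite (eq_bigr (fun x => x.1 *: lop r)) => [|x /eqP -> //].
by rewrite -scaler_suml; case: eqP => //= h; rewrite [X in X *: _]h scale0r.
Qed.

Lemma band_morph (f : {lrmorphism U -> zend K}) l1 l2 :
  f (e1 q) = \sum_(x <- l1) x.1 *: lop x.2 ->
  f (e2 q) = \sum_(x <- l2) x.1 *: lop x.2 -> forall u, band (f u).
Proof.
move=> h1 h2 u.
suff [l ->] : exists l : seq (K * (int * int)), f u = \sum_(x <- l) x.1 *: lop x.2.
  exact: band_list.
have mulL l l' : exists m : seq (K * (int * int)),
    (\sum_(x <- l) x.1 *: lop x.2) * (\sum_(x <- l') x.1 *: lop x.2) =
    \sum_(x <- m) x.1 *: lop x.2.
  exists [seq (x.1 * y.1 * Q ^ (- (x.2.1 * y.2.2)), x.2 + y.2) | x <- l, y <- l'].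
  rewrite big_allpairs_dep mulr_suml; apply: eq_bigr => x _.
  rewrite mulr_sumr; apply: eq_bigr => y _ /=.
  by rewrite -scalerAl -scalerAr lopM !scalerA.
move: u; apply: Uq_ind => [c u v [l hl] [m hm]||u [l hl]|u [l hl]].
- exists ([seq (c * x.1, x.2) | x <- l] ++ m).
  rewrite rmorphD /= linearZ /= hl hm big_cat big_map scaler_sumr; congr (_ + _).
  by apply: eq_bigr => x _; rewrite scalerA.
- by exists [:: (1, 0)]; rewrite big_seq1 /= lop0 scale1r rmorph1.
- by have [m hm] := mulL l1 l; exists m; rewrite rmorphM /= h1 hl.
- by have [m hm] := mulL l2 l; exists m; rewrite rmorphM /= h2 hl.
Qed.

Section Regular.
Variables (a b : K).

Definition lij (i j : int) : zend K := lop (i, j).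

Lemma lijE i j v m n : lij i j v (m, n) = Q ^ (m * j) * v (m - i, n - j).
Proof. by []. Qed.

Lemma lijM (i j k l m n d : int) : i + k = m -> j + l = n -> - (i * l) = d ->
  lij i j * lij k l = Q ^ d *: lij m n.
Proof. by move=> <- <- <-; rewrite /lij lopM. Qed.

Lemma lij00 : lij 0 0 = 1.
Proof. exact: lop0. Qed.

Let A : K := - (1 + Q^-1)^-1.
Let B : K := b / (1 - q ^- 4).

Definition top1 : zend K := lij 1 0.
Definition top3 : zend K := lij 0 1.
(** The solution for [e2] of [e3 e2 = (ww - a) / (q^2 - 1)] and [ww e1 = b / (1 - q^-4) - e3^2 / (1
    + q^-2)], where [e1] and [e3] are the invertible operators [x] and [t]; thus [ww] becomes
    [A x^-1 t^2 + B x^-1]. *)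
Definition top2 : zend K :=
  (q ^+ 2 - 1)^-1 *: (A *: lij (-1) 1 + B *: lij (-1) (-1) - a *: lij 0 (-1)).

Lemma regular_rep : exists f : {lrmorphism U -> zend K},
  [/\ f (e1 q) = top1, f (e2 q) = top2, f (e3 q) = top3,
      f (z q) = a%:A & f (z' q) = b%:A].
Proof.
have hQ1 : Q - 1 != 0 by apply: q2B1.
have hQ2 : Q + 1 != 0 by apply: q2D1.
have h1 : q * q - 1 != 0 by rewrite -expr2.
have h2 : q * q + 1 != 0 by rewrite -expr2.
have h4 : q * (q * (q * q)) - 1 != 0.
  by have := qn (n := 4) isT; rewrite !exprS expr0 mulr1 subr_eq0.
have xt : top1 * top3 = Q ^-1 *: lij 1 1.
  by rewrite (lijM (d := -1) (m := 1) (n := 1)).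
have tx : top3 * top1 = lij 1 1.
  by rewrite (lijM (d := 0) (m := 1) (n := 1)) // expr0z scale1r.
have xy : top1 * top2 = (q ^+ 2 - 1)^-1 *:
    (A *: (Q^-1 *: lij 0 1) + B *: (Q *: lij 0 (-1)) - a *: (Q *: lij 1 (-1))).
  rewrite /top2 -scalerAr mulrDr mulrN mulrDr -!scalerAr.
  rewrite (lijM (d := -1) (m := 0) (n := 1)) // (lijM (d := 1) (m := 0) (n := -1)) //.
  by rewrite (lijM (d := 1) (m := 1) (n := -1)).
have yx : top2 * top1 = (q ^+ 2 - 1)^-1 *:
    (A *: lij 0 1 + B *: lij 0 (-1) - a *: lij 1 (-1)).
  rewrite /top2 -scalerAl mulrBl mulrDl -!scalerAl.
  rewrite (lijM (d := 0) (m := 0) (n := 1)) // (lijM (d := 0) (m := 0) (n := -1)) //.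
  by rewrite (lijM (d := 0) (m := 1) (n := -1)) // !expr0z !scale1r.
have yt : top2 * top3 = (q ^+ 2 - 1)^-1 *:
    (A *: (Q *: lij (-1) 2) + B *: (Q *: lij (-1) 0) - a%:A).
  rewrite /top2 -scalerAl mulrBl mulrDl -!scalerAl.
  rewrite (lijM (d := 1) (m := -1) (n := 2)) // (lijM (d := 1) (m := -1) (n := 0)) //.
  by rewrite (lijM (d := 0) (m := 0) (n := 0)) // expr0z scale1r lij00.
have ty : top3 * top2 = (q ^+ 2 - 1)^-1 *:
    (A *: lij (-1) 2 + B *: lij (-1) 0 - a%:A).
  rewrite /top2 -scalerAr mulrDr mulrN mulrDr -!scalerAr.
  rewrite (lijM (d := 0) (m := -1) (n := 2)) // (lijM (d := 0) (m := -1) (n := 0)) //.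
  by rewrite (lijM (d := 0) (m := 0) (n := 0)) // !expr0z !scale1r lij00.
have [|||f [f1 f2 f3 fz]] := @Uq_lift_rel K q (zend K) top1 top2 top3 a q0.
- rewrite xy yx /A /top3; nc_coefs K; field; rewrite ?q0 ?h1 ?h2 ?h4 //.
- by rewrite xt tx.
- by rewrite yt ty; nc_coefs K; field; rewrite ?q0 ?h1 ?h2 ?h4.
exists f; split => //.
have fw : f (ww q) = A *: lij (-1) 2 + B *: lij (-1) 0.
  rewrite /ww rmorphB /= !rmorphM /= f2 f3 yt ty.
  by nc_coefs K; field; rewrite ?q0 ?h1 ?h2 ?h4.
rewrite z'E // linearZ /= rmorphD /= linearZ /= !rmorphM /= f1 f3 fw mulrDl -!scalerAl.
rewrite /top1 /top3 (@lijM (-1) 2 1 0 0 2 0) // (@lijM (-1) 0 1 0 0 0 0) //.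
rewrite (@lijM 0 1 0 1 0 2 0) // expr0z !scale1r lij00 /A /B.
by nc_coefs K; field; rewrite ?q0 ?h1 ?h2 ?h4.
Qed.

End Regular.
End QuantumTorus.

Definition lexle (x y : int * int) : bool :=
  (x.1 < y.1) || ((x.1 == y.1) && (x.2 <= y.2)).

Lemma lexle_total x y : lexle x y || lexle y x.
Proof. by rewrite /lexle; lia. Qed.

Lemma lexle_trans y x z : lexle x y -> lexle y z -> lexle x z.
Proof. by rewrite /lexle; lia. Qed.

Lemma lexle_refl x : lexle x x.
Proof. by rewrite /lexle eqxx lexx orbT. Qed.

Lemma lexmax (T : eqType) (s : seq T) (h : T -> int * int) : s != [::] ->
  exists2 t, t \in s & forall x, x \in s -> lexle (h x) (h t).
Proof.
elim: s => // y s IHs _; have [->|/IHs[t ts ht]] := eqVneq s [::].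
  by exists y; rewrite ?mem_head // => x; rewrite inE => /eqP ->; exact: lexle_refl.
have [yt|/negPf yt] := boolP (lexle (h y) (h t)).
  exists t; first by rewrite inE ts orbT.
  by move=> x; rewrite inE => /orP[/eqP ->//|/ht].
have ty : lexle (h t) (h y) by have := lexle_total (h y) (h t); rewrite yt.
exists y; first exact: mem_head.
move=> x; rewrite inE => /orP[/eqP ->|/ht xt]; first exact: lexle_refl.
exact: lexle_trans xt ty.
Qed.

Section Independence.
Variables (K : fieldType) (q : K).
Hypotheses (q0 : q != 0) (qn : forall n : nat, (0 < n)%N -> q ^+ n != 1).
Local Notation Q := (q ^+ 2).
Local Notation U := (UqB2 q).
Variables (a b : K) (f : {lrmorphism U -> zend K}).
Hypotheses (f1 : f (e1 q) = top1 q) (f2 : f (e2 q) = top2 q a b) (f3 : f (e3 q) = top3 q).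

(** Up to powers of [q], the coefficients of [e2^k] on the monomials [x^m t^n]. Since [e2] has
    exponents (-1, 1), (-1, -1), (0, -1), they live in a triangle; its vertices (0, -k), (-k, k),
    (-k, -k) carry powers of [- ga], [al], [be] up to powers of [q], as computed in [D_right],
    [D_left] and [D_low] with their nonvanishing companions. *)
Let D (k : nat) (m n : int) : K := (top2 q a b ^+ k) (@dirac0 K) (m, n).
Let al : K := (Q - 1)^-1 * - (1 + Q^-1)^-1.
Let be : K := (Q - 1)^-1 * (b / (1 - q ^- 4)).
Let ga : K := (Q - 1)^-1 * a.

Let Qz m : Q ^ m != 0. Proof. by rewrite expfz_neq0 // expf_neq0. Qed.

Let al0 : al != 0.
Proof.
rewrite mulf_neq0 ?invr_neq0 ?oppr_eq0 ?invr_neq0 ?q2B1 //.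
have -> : 1 + Q^-1 = (Q + 1) / Q by rewrite mulrDl divff ?expf_neq0 // mul1r.
by rewrite mulf_neq0 ?q2D1 ?invr_neq0 ?expf_neq0.
Qed.

Let be0 : b != 0 -> be != 0.
Proof.
move=> b0; rewrite !mulf_neq0 ?invr_neq0 ?q2B1 // subr_eq0 eq_sym invr_eq1.
exact: qn.
Qed.

Let ga0 : a != 0 -> ga != 0.
Proof. by move=> a0; rewrite !mulf_neq0 ?invr_neq0 ?q2B1. Qed.

Let D0 m n : D 0 m n = ((m == 0) && (n == 0))%:R.
Proof. by rewrite /D expr0. Qed.

Let DS k m n : D k.+1 m n = al * Q ^ m * D k (m + 1) (n - 1)
  + be * Q ^ (- m) * D k (m + 1) (n + 1) - ga * Q ^ (- m) * D k m (n + 1).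
Proof.
rewrite /D exprS zendM /top2; move: (_ ^+ k) => Y.
rewrite zendZ !zendD -scaleN1r !zendZ !lijE mulr1 mulrN1 !subr0 !opprK.
by rewrite /al /be /ga; ring.
Qed.

Let D_supp k m n : D k m n != 0 -> - k%:Z <= m <= 0.
Proof.
elim: k m n => [|k IHk] m n.
  by rewrite D0; have [->|_] := eqVneq m 0; rewrite //= eqxx.
apply: contraNT => mk; rewrite DS.
have e0 m' n' : m' = m \/ m' = m + 1 -> D k m' n' = 0.
  move=> hm; apply/eqP; apply: contraNT mk => /IHk; lia.
by rewrite !e0 ?mulr0 ?addr0 ?subr0; auto.
Qed.

Let D_supp0 k m n : (m > 0) || (m < - k%:Z) -> D k m n = 0.
Proof. by move=> h; apply/eqP; apply: contraTT h => /D_supp; lia. Qed.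

Let D_right k n : D k 0 n = (- ga) ^+ k * (n == - k%:Z)%:R.
Proof.
elim: k n => [|k IHk] n; first by rewrite D0 eqxx expr0 mul1r oppr0.
rewrite DS !(D_supp0 (m := 0 + 1)) // !mulr0 !add0r oppr0 expr0z mulr1 IHk exprS.
by rewrite (_ : (n + 1 == - k%:Z) = (n == - k.+1%:Z)) ?mulrA ?mulNr //; lia.
Qed.

Let D_left k n : k%:Z < n -> D k (- k%:Z) n = 0.
Proof.
elim: k n => [|k IHk] n hn; first by rewrite D0 (_ : n == 0 = false) ?andbF //; lia.
rewrite DS (D_supp0 (m := - k.+1%:Z)) ?mulr0 ?subr0; last by lia.
have -> : - k.+1%:Z + 1 = - k%:Z by lia.
by rewrite !IHk ?mulr0 ?addr0 //; lia.
Qed.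

Let D_left_neq0 k : D k (- k%:Z) k%:Z != 0.
Proof.
elim: k => [|k IHk]; first by rewrite D0 /= oner_neq0.
rewrite DS (D_supp0 (m := - k.+1%:Z)) ?mulr0 ?subr0; last by lia.
have -> : - k.+1%:Z + 1 = - k%:Z by lia.
rewrite (D_left (n := k.+1%:Z + 1)) ?mulr0 ?addr0; last by lia.
have -> : k.+1%:Z - 1 = k%:Z by lia.
exact: mulf_neq0 (mulf_neq0 al0 (Qz _)) IHk.
Qed.

Let D_low k m n : m + n <= - (2 * k)%:Z -> (m, n) != (- k%:Z, - k%:Z) -> D k m n = 0.
Proof.
elim: k m n => [|k IHk] m n hmn hne.
  by rewrite D0 -xpair_eqE; move: hne; rewrite oppr0 => /negPf ->.
rewrite DS !IHk ?mulr0 ?addr0 ?subr0 //; rewrite ?xpair_eqE; try lia.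
by move: hne; rewrite xpair_eqE; lia.
Qed.

Let D_low_neq0 k : b != 0 -> D k (- k%:Z) (- k%:Z) != 0.
Proof.
move=> b0; elim: k => [|k IHk]; first by rewrite D0 /= oner_neq0.
rewrite DS (D_supp0 (m := - k.+1%:Z)) ?mulr0 ?subr0; last by lia.
have -> : - k.+1%:Z + 1 = - k%:Z by lia.
rewrite (D_low (n := - k.+1%:Z - 1)) ?xpair_eqE ?mulr0 ?add0r; try lia.
exact: mulf_neq0 (mulf_neq0 (be0 b0) (Qz _)) IHk.
Qed.

Lemma nf_dirac0 c e k m n :
  f (nf q (c, e, k)) (@dirac0 K) (m, n) = Q ^ ((m - c%:Z) * e%:Z) * D k (m - c%:Z) (n - e%:Z).
Proof.
have -> : f (nf q (c, e, k)) = top1 q ^+ c * top3 q ^+ e * top2 q a b ^+ k.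
  by rewrite /nf !rmorphM /= !rmorphXn /= f1 f2 -lock f3.
rewrite !zendM /D.
move: ((top2 q a b ^+ k) (@dirac0 K)) => v.
have t1 i v' m' n' : (top1 q ^+ i) v' (m', n') = v' (m' - i%:Z, n').
  elim: i m' n' => [|i IHi] m' n'; first by rewrite expr0 subr0.
  rewrite exprS zendM /top1 lijE mulr0 expr0z mul1r IHi subr0.
  by congr (v' (_, _)); lia.
have t3 i v' m' n' : (top3 q ^+ i) v' (m', n') = Q ^ (m' * i%:Z) * v' (m', n' - i%:Z).
  elim: i m' n' => [|i IHi] m' n'; first by rewrite expr0 mulr0 expr0z mul1r subr0.
  rewrite exprS zendM /top3 lijE IHi mulrA -expfzDr ?expf_neq0 // subr0.
  by congr (Q ^ _ * v' (_, _)); lia.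
by rewrite t1 t3.
Qed.

Variables (s : seq (nat * nat * nat)) (c : nat * nat * nat -> K).
Hypotheses (us : uniq s) (sn : s != [::]) (snf : all is_nf s)
  (c0 : all (fun t => c t != 0) s).
Let v := f (\sum_(t <- s) c t *: nf q t) (@dirac0 K).

Let vE m n : v (m, n) = \sum_(t <- s) c t *
  (Q ^ ((m - t.1.1%:Z) * t.1.2%:Z) * D t.2 (m - t.1.1%:Z) (n - t.1.2%:Z)).
Proof.
have fE : f (\sum_(t <- s) c t *: nf q t) = \sum_(t <- s) c t *: f (nf q t).
  by rewrite rmorph_sum; apply: eq_bigr => t _ /=; rewrite linearZ.
rewrite /v fE zend_sum; apply: eq_bigr => -[[i j] k] _.
by rewrite zendZ nf_dirac0.
Qed.

Let v_neq0 (t : nat * nat * nat) m n : t \in s -> D t.2 (m - t.1.1%:Z) (n - t.1.2%:Z) != 0 ->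
  (forall t' : nat * nat * nat, t' \in s -> t' != t -> D t'.2 (m - t'.1.1%:Z) (n - t'.1.2%:Z) = 0) ->
  v (m, n) != 0.
Proof.
move=> ts ht ht'; rewrite vE (bigD1_seq t) //= big_seq_cond big1 ?addr0.
  exact: mulf_neq0 (allP c0 _ ts) (mulf_neq0 (Qz _) ht).
by move=> t' /andP[t's t't]; rewrite ht' ?mulr0.
Qed.

Let smax (h : nat * nat * nat -> int * int) : exists2 t : nat * nat * nat,
  t \in s & forall r : nat * nat * nat, r \in s -> lexle (h r) (h t).
Proof. exact: lexmax. Qed.

(** The condition on the position goes beyond independence: it forbids an element of the algebra to
    act as a multiple of [t^n] with [n < 0]. *)
Lemma nf_indep_a : a != 0 -> exists m n, v (m, n) != 0 /\ (m != 0 \/ 0 <= n).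
Proof.
move=> a0.
have [t ts tmax] := smax (fun t => (t.1.1%:Z, 0)).
have [t0|t0] := posnP t.1.1.
  (* No term involves [x1]: the vertex (-k, k) of the term with largest [k], then largest power of
     [x3], is met by no other term. *)
  have [t' t's t'max] := smax (fun t => (t.2%:Z, t.1.2%:Z)).
  have c0' r : r \in s -> r.1.1%:Z = 0.
    by move=> /tmax; rewrite /lexle /= t0; clear; lia.
  exists (- t'.2%:Z), (t'.1.2%:Z + t'.2%:Z); split; last by clear; lia.
  apply: (v_neq0 t's) => [|r rs rt]; rewrite c0' // subr0.
    by rewrite (_ : _ - t'.1.2%:Z = t'.2%:Z) ?D_left_neq0 //; clear; lia.
  have := t'max r rs; rewrite /lexle /= => /orP[h|/andP[/eqP h1 h2]].
    by apply: D_supp0; clear -h; lia.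
  rewrite -h1; apply: D_left.
  have : r.1.2 != t'.1.2 :> nat.
    apply: contra rt => /eqP e.
    have e1 : r.1.1 = t'.1.1 by apply/eqP; rewrite -eqz_nat !c0'.
    by case: (r) (t') e1 e h1 => [[? ?] ?] [[? ?] ?] /= -> -> [->].
  by clear -h2; lia.
(* In the column of the largest power of [x1], only the vertices (0, -k) contribute. As that power
   is positive, one of the other two exponents is zero, so their difference determines the term. *)
exists t.1.1%:Z, (t.1.2%:Z - t.2%:Z); split; last by left; clear -t0; lia.
have nft := allP snf _ ts.
apply: (v_neq0 ts) => [|r rs rt].
  rewrite subrr D_right addrAC subrr add0r eqxx mulr1.
  by apply: expf_neq0; rewrite oppr_eq0 ga0.
have := tmax r rs; rewrite /lexle /= => /orP[h|/andP[/eqP h1 _]].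
  by apply: D_supp0; clear -h; lia.
rewrite h1 subrr D_right [_ == _]negbTE ?mulr0 //.
apply: contra rt => /eqP h; have := allP snf _ rs.
move: h1 t0 h nft; case: (r) (t) => [[i j] k] [[i' j'] k'] /=; rewrite /is_nf /= !xpair_eqE.
by clear; lia.
Qed.

(** The vertex (-k, -k) is the point of least coordinate sum in each triangle. A term minimising
    this sum is isolated there: two exponent triples with the same translated vertex differ by a
    multiple of (1, 1, 1), and normal triples have a zero entry. *)
Lemma nf_indep_b : b != 0 -> exists m n, v (m, n) != 0.
Proof.
move=> b0; pose h (t : nat * nat * nat) : int := t.1.1%:Z + t.1.2%:Z - t.2%:Z - t.2%:Z.
have [t ts tmax] := smax (fun t => (- h t, 0)).
exists (t.1.1%:Z - t.2%:Z), (t.1.2%:Z - t.2%:Z).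
apply: (v_neq0 ts) => [|r rs rt].
  by rewrite !(addrAC _ (- t.2%:Z)) !subrr !add0r D_low_neq0.
apply: D_low.
  by have := tmax r rs; rewrite /lexle /h /=; clear; lia.
apply: contra rt; have := allP snf _ rs; have := allP snf _ ts.
case: (r) (t) => [[i j] k] [[i' j'] k'] /=; rewrite /is_nf /= !xpair_eqE.
by clear; lia.
Qed.

End Independence.

(** * The ideals generated by z - a and z' - b *)

Section Ideals.
Variable R : nzRingType.
Implicit Types I J P : set R.

Lemma ideal0 I : two_sided_ideal I -> I 0. Proof. by case. Qed.
Lemma idealD I x y : two_sided_ideal I -> I x -> I y -> I (x + y).
Proof. by case=> _ hD _; apply: hD. Qed.
Lemma idealMl I a x : two_sided_ideal I -> I x -> I (a * x).
Proof. by case=> _ _ hM Ix; rewrite -[a * x]mulr1; apply: hM. Qed.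
Lemma idealMr I x a : two_sided_ideal I -> I x -> I (x * a).
Proof. by case=> _ _ hM Ix; rewrite -[x]mul1r; apply: hM. Qed.
Lemma idealN I x : two_sided_ideal I -> I x -> I (- x).
Proof. by move=> hI Ix; rewrite -mulN1r; apply: idealMl. Qed.
Lemma idealB I x y : two_sided_ideal I -> I x -> I y -> I (x - y).
Proof. by move=> hI Ix Iy; apply: idealD => //; apply: idealN. Qed.
Lemma ideal_sum I (T : Type) (s : seq T) (P : pred T) (F : T -> R) : two_sided_ideal I ->
  (forall i, P i -> I (F i)) -> I (\sum_(i <- s | P i) F i).
Proof.
move=> hI h; elim/big_rec: _ => [|i x Pi Ix]; first exact: ideal0.
by apply: idealD => //; apply: h.
Qed.
Lemma ideal_subr I x y : two_sided_ideal I -> I (x - y) -> I x <-> I y.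
Proof.
move=> hI Ixy; split=> [Ix|Iy]; last by rewrite -(subrK y x); apply: idealD.
by rewrite -(subKr x y); apply: idealB.
Qed.
Lemma ideal_setT I : two_sided_ideal I -> I 1 -> I = setT.
Proof.
move=> hI I1; apply/seteqP; split=> // x _.
by rewrite -[x]mulr1; apply: idealMl.
Qed.

Lemma ideal_plus I J : two_sided_ideal I -> two_sided_ideal J ->
  two_sided_ideal [set x | exists i j, [/\ I i, J j & x = i + j]].
Proof.
move=> hI hJ; split.
- by exists 0, 0; split; rewrite ?addr0 //; apply: ideal0.
- move=> x y [i [j [Ii Jj ->]]] [i' [j' [Ii' Jj' ->]]].
  exists (i + i'), (j + j'); split; [exact: idealD | exact: idealD | exact: addrACA].
- move=> a x b [i [j [Ii Jj ->]]]; exists (a * i * b), (a * j * b).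
  by split; rewrite ?mulrDr ?mulrDl //; [case: hI => _ _|case: hJ => _ _]; apply.
Qed.

Definition maximal_ideal P : Prop :=
  [/\ two_sided_ideal P, ~ P 1 &
    forall J u, two_sided_ideal J -> P `<=` J -> J u -> ~ P u -> J 1].

Lemma maximal_ideal_eq P J : maximal_ideal P -> two_sided_ideal J -> P `<=` J ->
  ~ J 1 -> J = P.
Proof.
move=> [hP P1 Pmax] hJ PJ J1; apply/seteqP; split=> // u Ju.
by apply: contrapT => Pu; apply: J1; exact: Pmax hJ PJ Ju Pu.
Qed.

Lemma maximal_prime P : maximal_ideal P -> prime_ideal P.
Proof.
move=> [hP P1 Pmax]; split=> //; first by move=> PT; apply: P1; rewrite PT.
move=> I J hI hJ IJ; apply: contrapT => /not_orP[/nonsubset[x [Ix Px]] /nonsubset[y [Jy Py]]].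
have unit_in I' v : two_sided_ideal I' -> I' v -> ~ P v -> exists i p, [/\ I' i, P p & 1 = i + p].
  move=> hI' I'v Pv; apply: (Pmax _ v (ideal_plus hI' hP)) => //.
    by move=> p Pp; exists 0, p; split; rewrite ?add0r //; apply: ideal0.
  by exists v, 0; split; rewrite ?addr0 //; apply: ideal0.
have [i [p [Ii Pp e]]] := unit_in _ _ hI Ix Px.
have [j [p' [Jj Pp' e']]] := unit_in _ _ hJ Jy Py.
apply: P1; rewrite -[1]mulr1 {1}e e' mulrDl mulrDr.
apply: idealD => //; last exact: idealMr.
by apply: idealD => //; [apply: IJ | apply: idealMl].
Qed.

End Ideals.

Lemma idealZ (K : fieldType) (S : algType K) (I : set S) (c : K) x :
  two_sided_ideal I -> I x -> I (c *: x).
Proof. by move=> hI Ix; rewrite -mulr_algl; apply: idealMl. Qed.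

Lemma ideal_scale (K : fieldType) (S : algType K) (I : set S) (c : K) x :
  two_sided_ideal I -> c != 0 -> I (c *: x) -> I x.
Proof.
by move=> hI c0 /(idealZ c^-1 hI); rewrite scalerA mulVf // scale1r.
Qed.

Lemma kernel_ideal (R S : nzRingType) (f : {rmorphism R -> S}) :
  two_sided_ideal [set u | f u = 0].
Proof.
split=> /= [|x y fx fy|a x b fx]; first exact: rmorph0.
  by rewrite rmorphD /= fx fy addr0.
by rewrite !rmorphM /= fx mulr0 mul0r.
Qed.

Section Isolation.
Variables (K : fieldType) (q : K).
Hypotheses (q0 : q != 0) (qn : forall n : nat, (0 < n)%N -> q ^+ n != 1).
Local Notation Q := (q ^+ 2).
Local Notation U := (UqB2 q).
Variable f : {lrmorphism U -> zend K}.
Hypothesis fband : forall u, band q (f u).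
Hypothesis fsep : forall r s : int * int, r <> s -> exists X e p,
  [/\ e != 0, f X = e *: lop q p & p.1 * r.2 - r.1 * p.2 <> p.1 * s.2 - s.1 * p.2].

Let Q0 : Q != 0. Proof. exact: expf_neq0. Qed.

Let lop_twist (c e la : K) (x p : int * int) :
  (e *: lop q p) * (c *: lop q x) - la *: ((c *: lop q x) * (e *: lop q p)) =
  (e * c * Q ^ (- (x.1 * p.2)) * (Q ^ (x.1 * p.2 - p.1 * x.2) - la)) *: lop q (x + p).
Proof.
have mulZZ (a b : K) (A B : zend K) : (a *: A) * (b *: B) = (a * b) *: (A * B) by nc K.
rewrite !mulZZ !(lopM q0) !scalerA [p + x]addrC -scalerBl.
have -> : Q ^ (- (p.1 * x.2)) = Q ^ (- (x.1 * p.2)) * Q ^ (x.1 * p.2 - p.1 * x.2).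
  by rewrite -expfzDr // addKr.
by congr (_ *: _); ring.
Qed.

(* Twisted commutation with monomials shortens the support of f u. *)
Lemma isolate_monomial (I : set U) u : two_sided_ideal I -> I u -> f u <> 0 ->
  exists y r c, [/\ I y, c != 0 & f y = c *: lop q r].
Proof.
move=> hI Iu fu0; have [c [s [us cs fu]]] := fband u.
have s0 : s != [::] by apply/eqP => s0; apply: fu0; rewrite fu /bsum s0 big_nil.
move: {2}(size s) (leqnn (size s)) => n; clear fu0.
elim: n s c u us cs s0 Iu fu => [|n IHn] s c u us cs s0 Iu fu sn.
  by case: s s0 sn {us cs fu}.
case: s s0 us cs fu sn => // r [|t s] _ us cs fu sn.
  exists u, r, (c r); split=> //; first by case/andP: cs.
  by rewrite fu /bsum big_seq1.
have rt : r <> t by move=> rt; move: us; rewrite rt /= mem_head.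
have [X [e [p [e0 fX hp]]]] := fsep rt.
(* The factor by which the monomial of exponent [x] fails to commute with [f X]. *)
pose la (x : int * int) := Q ^ (x.1 * p.2 - p.1 * x.2).
have la_inj x y : la x = la y -> p.1 * x.2 - x.1 * p.2 = p.1 * y.2 - y.1 * p.2.
  by move=> /(Qexp_inj q0 qn) h; rewrite -[LHS]opprB h opprB.
set s' := r :: t :: s in us cs fu sn *.
(* This cancels the term at [r], keeps the one at [t] because [X] separates them, and translates the
   surviving support by [p]. *)
pose y := X * u - la r *: (u * X).
pose c' x := e * c (x - p) * Q ^ (- ((x - p).1 * p.2)) * (la (x - p) - la r).
apply: (IHn [seq x + p | x <- s' & la x != la r] c' y).
- by rewrite map_inj_uniq ?filter_uniq //; apply: addIr.
- apply/allP => _ /mapP[x + ->]; rewrite mem_filter => /andP[lx xs].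
  rewrite /c' addrK mulf_neq0 ?subr_eq0 // mulf_neq0 ?expfz_neq0 // mulf_neq0 //.
  exact: (allP cs).
- rewrite -size_eq0 size_map size_eq0 -has_filter; apply/hasP; exists t.
    by rewrite !inE eqxx orbT.
  by apply/eqP => /la_inj h; apply: hp.
- apply: idealB => //; first exact: idealMl.
  by apply: idealZ => //; apply: idealMr.
- have -> : f y = (e *: lop q p) * f u - la r *: (f u * (e *: lop q p)).
    by rewrite /y rmorphB /= linearZ /= !rmorphM /= fX.
  rewrite fu /bsum big_map big_filter.
  rewrite mulr_sumr mulr_suml scaler_sumr -sumrB [RHS]big_mkcond; apply: eq_bigr => x _.
  etransitivity; first exact: lop_twist.
  have -> : c' (x + p) = e * c x * Q ^ (- (x.1 * p.2)) * (la x - la r) by rewrite /c' addrK.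
  by rewrite -/(la x); case: eqP => [->|//]; rewrite subrr mulr0 scale0r.
- rewrite size_map size_filter /= eqxx /= add0n.
  by move: sn; rewrite ltnS; apply: leq_trans; exact: (count_size _ (t :: s)).
Qed.

End Isolation.

Section Maximality.
Variables (K : fieldType) (q : K).
Hypotheses (q0 : q != 0) (qn : forall n : nat, (0 < n)%N -> q ^+ n != 1).
Local Notation Q := (q ^+ 2).
Local Notation U := (UqB2 q).

Let Q0 : Q != 0. Proof. exact: expf_neq0. Qed.
Let Qz m : Q ^ m != 0. Proof. by rewrite expfz_neq0. Qed.

Definition regular (a b : K) (f : {lrmorphism U -> zend K}) : Prop :=
  [/\ f (e1 q) = top1 q, f (e2 q) = top2 q a b, f (e3 q) = top3 q,
      f (z q) = a%:A & f (z' q) = b%:A].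

Lemma regular_band a b f : regular a b f -> forall u, band q (f u).
Proof.
case=> f1 f2 _ _ _; apply: (@band_morph _ _ q0 f [:: (1, (1, 0))]
  [:: ((Q - 1)^-1 * - (1 + Q^-1)^-1, (-1, 1));
      ((Q - 1)^-1 * (b / (1 - q ^- 4)), (-1, -1)); (- ((Q - 1)^-1 * a), (0, -1))]).
  by rewrite f1 big_seq1 scale1r.
rewrite f2 !big_cons big_nil /= addr0 /top2 /lij scalerBr scalerDr !scalerA addrA.
by rewrite scaleNr.
Qed.

Lemma regular_sep a b f : regular a b f -> forall r s : int * int, r <> s ->
  exists X e p, [/\ e != 0, f X = e *: lop q p &
    p.1 * r.2 - r.1 * p.2 <> p.1 * s.2 - s.1 * p.2].
Proof.
move=> [f1 _ f3 _ _] [i j] [i' j'] /= rs.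
have [ij|ij] := eqVneq j j'; last first.
  by exists (e1 q), 1, (1, 0); rewrite oner_neq0 scale1r f1 /= !mulr0; split=> //; lia.
exists (e3 q), 1, (0, 1); rewrite oner_neq0 scale1r f3 /= !mulr1 !mul0r; split=> //.
by move=> h; apply: rs; congr (_, _); [lia | exact: ij].
Qed.

Section Descent.
Variables (a b : K) (f : {lrmorphism U -> zend K}) (I : set U).
Hypotheses (fr : regular a b f) (ab : (a != 0) || (b != 0)).
Hypotheses (hI : two_sided_ideal I) (kerI : forall u, f u = 0 -> I u).

(** The ideal contains an element acting as a multiple of [x^i t^j]. Multiplying by [e1] and [e3]
    makes the exponents nonnegative; [mono_w] then brings [i] down to 0, [mono_down] brings [j] down
    to 0, and a nonzero scalar is reached. *)
Let mono (i j : int) : Prop := exists y c, [/\ I y, c != 0 & f y = c *: lij q i j].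

Let monoP y c i j : c != 0 -> I y -> f y = c *: lij q i j -> mono i j.
Proof. by move=> c0 Iy fy; exists y, c. Qed.

Let lM i j k l : lij q i j * lij q k l = Q ^ (- (i * l)) *: lij q (i + k) (j + l).
Proof. exact: lijM. Qed.

Let mono_e1 i j : mono i j -> mono (1 + i) j.
Proof.
case=> y [c [Iy c0 fy]]; have [f1 _ _ _ _] := fr.
apply: (@monoP (e1 q * y) (c * Q ^ (- (1 * j)))); rewrite ?mulf_neq0 //; first exact: idealMl.
by rewrite rmorphM /= f1 fy -scalerAr lM scalerA add0r.
Qed.

Let mono_e3 i j : mono i j -> mono i (1 + j).
Proof.
case=> y [c [Iy c0 fy]]; have [_ _ f3 _ _] := fr.
apply: (@monoP (e3 q * y) c) => //; first exact: idealMl.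
by rewrite rmorphM /= f3 fy -scalerAr lM mul0r oppr0 expr0z scale1r add0r.
Qed.

Let A : K := - (1 + Q^-1)^-1.
Let B : K := b / (1 - q ^- 4).
Let A0 : A != 0.
Proof.
rewrite oppr_eq0 invr_neq0 //.
have -> : 1 + Q^-1 = (Q + 1) / Q by rewrite mulrDl divff ?expf_neq0 // mul1r.
by rewrite mulf_neq0 ?q2D1 ?invr_neq0 ?expf_neq0.
Qed.

Let fw : f (ww q) = A *: lij q (-1) 2 + B *: lij q (-1) 0.
Proof.
have [_ f2 f3 _ _] := fr; have h1 : q * q - 1 != 0 by rewrite -expr2 q2B1.
rewrite /ww rmorphB /= !rmorphM /= f2 f3 /top2 -/A -/B /top3.
rewrite -scalerAl -scalerAr mulrBl mulrBr mulrDl mulrDr -!scalerAl -!scalerAr.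
rewrite (@lijM _ _ q0 (-1) 1 0 1 (-1) 2 1) // (@lijM _ _ q0 (-1) (-1) 0 1 (-1) 0 1) //.
rewrite (@lijM _ _ q0 0 (-1) 0 1 0 0 0) // (@lijM _ _ q0 0 1 (-1) 1 (-1) 2 0) //.
rewrite (@lijM _ _ q0 0 1 (-1) (-1) (-1) 0 0) // (@lijM _ _ q0 0 1 0 (-1) 0 0 0) //.
rewrite expr0z !scale1r expr1z.
by nc_coefs K; field; rewrite ?h1 ?q0.
Qed.

(** [ww] acts as [A x^-1 t^2 + B x^-1]; the twist [Q ^ j] in the commutator cancels the [B] terms,
    and the [A] terms do not cancel because the exponent of [x] is positive. *)
Let mono_w (n : nat) j : mono n.+1 j -> mono n (j + 2).
Proof.
case=> y [c [Iy c0 fy]].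
have An : A * (1 - Q ^ (- (n.+1%:Z * 2))) != 0.
  rewrite mulf_neq0 // subr_eq0 eq_sym; apply/eqP => /(Qexp_inj q0 qn (n := 0)); clear; lia.
apply: (@monoP (ww q * y - Q ^ j *: (y * ww q)) (c * Q ^ j * (A * (1 - Q ^ (- (n.+1%:Z * 2)))))).
- exact: mulf_neq0 (mulf_neq0 c0 (Qz j)) An.
- apply: idealB => //; [exact: idealMl | apply: idealZ => //; exact: idealMr].
rewrite rmorphB /= linearZ /= !rmorphM /= fw fy.
rewrite -scalerAl -scalerAr mulrDl mulrDr -!scalerAl -!scalerAr.
rewrite (@lijM _ _ q0 (-1) 2 n.+1 j n (j + 2) j); try (by clear; lia).
rewrite (@lijM _ _ q0 (-1) 0 n.+1 j n j j); try (by clear; lia).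
rewrite (@lijM _ _ q0 n.+1 j (-1) 2 n (j + 2) (- (n.+1%:Z * 2))); try (by clear; lia).
rewrite (@lijM _ _ q0 n.+1 j (-1) 0 n j 0); try (by clear; lia).
rewrite expr0z scale1r.
by nc_coefs K; ring.
Qed.

(** For [a != 0], the commutator with [e2] twisted by [Q ^ j] cancels the two terms in [x^-1] and
    leaves [a t^(j-1)] up to a nonzero factor. For [a = 0], [e2 e1] acts as a combination of [t] and
    [t^-1], from which the [t] part is removed by means of [e3]. *)
Let mono_down j : 0 < j -> mono 0 j -> mono 0 (j - 1).
Proof.
move=> j0 [y [c [Iy c0 fy]]]; have [f1 f2 f3 _ _] := fr.
have k0 : (Q - 1)^-1 != 0 by rewrite invr_neq0 ?q2B1.
have [a0|a0] := boolP (a == 0); last first.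
  have jn : Q ^ j - 1 != 0 by rewrite subr_eq0; apply/eqP => /(Qexp_inj q0 qn (n := 0)); clear -j0; lia.
  apply: (@monoP (e2 q * y - Q ^ j *: (y * e2 q)) (c * (Q - 1)^-1 * a * (Q ^ j - 1))).
  - exact: mulf_neq0 (mulf_neq0 (mulf_neq0 c0 k0) a0) jn.
  - apply: idealB => //; [exact: idealMl | apply: idealZ => //; exact: idealMr].
  rewrite rmorphB /= linearZ /= !rmorphM /= f2 fy /top2 -/A -/B.
  rewrite -!scalerAl -!scalerAr mulrBl mulrBr mulrDl mulrDr -!scalerAl -!scalerAr.
  rewrite (@lijM _ _ q0 (-1) 1 0 j (-1) (j + 1) j); try (by clear; lia).
  rewrite (@lijM _ _ q0 (-1) (-1) 0 j (-1) (j - 1) j); try (by clear; lia).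
  rewrite (@lijM _ _ q0 0 (-1) 0 j 0 (j - 1) 0); try (by clear; lia).
  rewrite (@lijM _ _ q0 0 j (-1) 1 (-1) (j + 1) 0); try (by clear; lia).
  rewrite (@lijM _ _ q0 0 j (-1) (-1) (-1) (j - 1) 0); try (by clear; lia).
  rewrite (@lijM _ _ q0 0 j 0 (-1) 0 (j - 1) 0); try (by clear; lia).
  rewrite expr0z !scale1r.
  by nc_coefs K; ring.
have b0 : b != 0 by move: ab; rewrite a0.
have B0 : B != 0.
  by rewrite mulf_neq0 // invr_neq0 // subr_eq0 eq_sym invr_eq1 qn.
apply: (@monoP (y * (e2 q * e1 q) - (Q - 1)^-1 * A *: (y * e3 q)) (c * (Q - 1)^-1 * B)).
- exact: mulf_neq0 (mulf_neq0 c0 k0) B0.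
- apply: idealB => //; [exact: idealMr | apply: idealZ => //; exact: idealMr].
rewrite rmorphB /= linearZ /= !rmorphM /= f1 f2 f3 fy /top1 /top2 /top3 -/A -/B (eqP a0) scale0r subr0.
rewrite -!scalerAl mulrDl -!scalerAl.
rewrite (@lijM _ _ q0 (-1) 1 1 0 0 1 0) // (@lijM _ _ q0 (-1) (-1) 1 0 0 (-1) 0) //.
rewrite -!scalerAr mulrDr -!scalerAr.
rewrite (@lijM _ _ q0 0 j 0 1 0 (j + 1) 0); try (by clear; lia).
rewrite (@lijM _ _ q0 0 j 0 (-1) 0 (j - 1) 0); try (by clear; lia).
rewrite expr0z !scale1r.
by nc_coefs K; ring.
Qed.

Let mono0 (n : nat) : mono 0 n -> I 1.
Proof.
elim: n => [|n IHn] h; last first.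
  apply: IHn; have := mono_down (j := n.+1) isT h.
  by have -> : n.+1%:Z - 1 = n by clear; lia.
have [y [c [Iy c0 fy]]] := h.
have : I (y - c%:A).
  apply: kerI; rewrite rmorphB /= fy linearZ /= rmorph1.
  by rewrite (_ : lij q 0 0%:Z = 1) ?subrr //; exact: lij00.
by move=> Iyc; have [/(_ Iy) + _] := ideal_subr hI Iyc; exact: ideal_scale.
Qed.

Let mono_nat (n : nat) j : mono n j -> I 1.
Proof.
elim: n j => [|n IHn] j; last by move=> /mono_w/IHn.
suff up (k : nat) : mono 0 j -> mono 0 (k%:Z + j).
  have [m hm] : exists m : nat, (absz j)%:Z + j = m.
    by exists (absz ((absz j)%:Z + j)); clear; lia.
  move=> h; have := up (absz j) h; rewrite hm.
  exact: mono0.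
elim: k => [|k IHk] h; first by rewrite add0r.
by have := mono_e3 (IHk h); rewrite addrA; congr (mono 0 (_ + j)); clear; lia.
Qed.

Lemma mono_unit i j : mono i j -> I 1.
Proof.
suff up (k : nat) : mono i j -> mono (k%:Z + i) j.
  have [m hm] : exists m : nat, (absz i)%:Z + i = m.
    by exists (absz ((absz i)%:Z + i)); clear; lia.
  move=> h; have := up (absz i) h; rewrite hm.
  exact: mono_nat.
elim: k => [|k IHk] h; first by rewrite add0r.
by have := mono_e1 (IHk h); rewrite addrA; congr (mono (_ + i) j); clear; lia.
Qed.

End Descent.

Lemma regular_ker_maximal a b f : regular a b f -> (a != 0) || (b != 0) ->
  maximal_ideal [set u | f u = 0].
Proof.
move=> fr ab; split; first exact: kernel_ideal.
  by move=> /= /eqP; rewrite rmorph1 oner_eq0.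
move=> J u hJ kerJ Ju fu.
have [y [[i j] [c [Jy c0 fy]]]] :=
  isolate_monomial q0 qn (regular_band fr) (regular_sep fr) hJ Ju fu.
by apply: (mono_unit fr ab hJ kerJ (i := i) (j := j)); exists y, c.
Qed.

End Maximality.

Section CentralIdeals.
Variables (K : fieldType) (q : K).
Hypotheses (q0 : q != 0) (qn : forall n : nat, (0 < n)%N -> q ^+ n != 1).
Local Notation U := (UqB2 q).

Definition pab (a b : K) : set U := ideal_gen [set z q - a%:A; z' q - b%:A].

Lemma horner_alg_mod (I : set U) (zeta : U) (a : K) (c : {poly K}) :
  two_sided_ideal I -> I (zeta - a%:A) -> I (horner_alg zeta c - c.[a]%:A).
Proof.
move=> hI Ia; elim/poly_ind: c => [|c d IHc].
  by rewrite rmorph0 horner0 scale0r subrr; apply: ideal0.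
rewrite rmorphD rmorphM /= horner_algX horner_algC hornerMXaddC.
have -> : horner_alg zeta c * zeta + d%:A - (c.[a] * a + d)%:A =
    (horner_alg zeta c - c.[a]%:A) * zeta + c.[a] *: (zeta - a%:A).
  by move: (horner_alg zeta c) => X; nc K.
by apply: idealD => //; [apply: idealMr | apply: idealZ].
Qed.

Lemma cen_mod (I : set U) (a b : K) (p : {poly {poly K}}) : two_sided_ideal I ->
  I (z q - a%:A) -> I (z' q - b%:A) -> I (cen q p - (p.[b%:P].[a])%:A).
Proof.
move=> hI Ia Ib; elim/poly_ind: p => [|p c IHp].
  by rewrite raddf0 !horner0 scale0r subrr; apply: ideal0.
rewrite raddfD /= cenMX cenC hornerMXaddC hornerD hornerM hornerC.
have -> : cen q p * 'z'_q + horner_alg 'z_q c - (p.[b%:P].[a] * b + c.[a])%:A =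
    (cen q p - p.[b%:P].[a]%:A) * z' q + p.[b%:P].[a] *: (z' q - b%:A)
    + (horner_alg (z q) c - c.[a]%:A).
  rewrite -!lock; move: (cen q p) (horner_alg (z q) c) (z' q) => X Y Z.
  by nc K.
apply: idealD => //; last exact: horner_alg_mod.
by apply: idealD => //; [apply: idealMr | apply: idealZ].
Qed.

Lemma nf_sum_mod (I : set U) (a b : K) s (p : nat * nat * nat -> {poly {poly K}}) :
  two_sided_ideal I -> I (z q - a%:A) -> I (z' q - b%:A) ->
  I (\sum_(t <- s) cen q (p t) * nf q t - \sum_(t <- s) (p t).[b%:P].[a] *: nf q t).
Proof.
move=> hI Ia Ib; rewrite -sumrB; apply: ideal_sum => // t _.
by rewrite -mulr_algl -mulrBl; apply: idealMr => //; apply: cen_mod.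
Qed.

Lemma regular_ker_gens a b f : regular a b f ->
  [set u | f u = 0] (z q - a%:A) /\ [set u : U | f u = 0] (z' q - b%:A).
Proof.
case=> _ _ _ fz fz'; split; rewrite /= rmorphB /=.
  by rewrite fz rmorph_alg subrr.
by rewrite fz' rmorph_alg subrr.
Qed.

Lemma regular_coef0 a b f s (p : nat * nat * nat -> {poly {poly K}}) :
  regular a b f -> (a != 0) || (b != 0) -> uniq s -> all is_nf s ->
  f (\sum_(t <- s) cen q (p t) * nf q t) = 0 ->
  forall t, t \in s -> (p t).[b%:P].[a] = 0.
Proof.
move=> fr ab us snf fu t ts; have [f1 f2 f3 fz fz'] := fr.
have [g1 g2] := regular_ker_gens fr.
have hker : two_sided_ideal [set u | f u = 0] by exact: kernel_ideal.
have [/(_ fu) fs _] := ideal_subr hker (nf_sum_mod s p hker g1 g2).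
apply: contrapT => /eqP pt.
pose c t := (p t).[b%:P].[a].
set s' := [seq t <- s | c t != 0].
have us' : uniq s' by rewrite filter_uniq.
have sn : s' != [::].
  by rewrite -size_eq0 size_filter -lt0n -has_count; apply/hasP; exists t.
have snf' : all is_nf s' by apply/allP => x; rewrite mem_filter => /andP[_ /(allP snf)].
have c0 : all (fun t => c t != 0) s' by apply: filter_all.
have {}fs : f (\sum_(t <- s') c t *: nf q t) = 0.
  rewrite -[RHS]fs big_filter big_mkcond; congr (f _); apply: eq_bigr => x _.
  by rewrite -/(c x); case: eqP => //= ->; rewrite scale0r.
have [a0|a0] := eqVneq a 0.
  have b0 : b != 0 by move: ab; rewrite a0 eqxx.
  have [m [n]] := nf_indep_b q0 qn f1 f2 f3 us' sn snf' c0 b0.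
  by rewrite fs eqxx.
have [m [n []]] := nf_indep_a q0 qn f1 f2 f3 us' sn snf' c0 a0.
by rewrite fs eqxx.
Qed.

Lemma pab_gens a b : pab a b (z q - a%:A) /\ pab a b (z' q - b%:A).
Proof. by split; apply: ideal_gen_sub; [left | right]. Qed.

Lemma pab_ideal a b : two_sided_ideal (pab a b).
Proof. exact: ideal_gen_ideal. Qed.

(** Modulo [pab a b] an element is a [K]-combination of normal monomials, whose coefficients all
    vanish if [f] kills it. *)
Lemma pab_ker a b f : regular a b f -> (a != 0) || (b != 0) -> pab a b = [set u | f u = 0].
Proof.
move=> fr ab; have [g1 g2] := regular_ker_gens fr.
apply/seteqP; split; first by apply: ideal_gen_min; [exact: kernel_ideal | move=> _ [->|->]].
move=> u fu; have [s [p [us snf uE]]] := nf_repr q0 qn u.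
have [h1 h2] := pab_gens a b; have hI := pab_ideal a b.
have coef0 := regular_coef0 fr ab us snf.
rewrite uE; apply/(ideal_subr hI (nf_sum_mod s p hI h1 h2)).
rewrite big_seq; apply: ideal_sum => // t ts; rewrite coef0 ?scale0r -?uE //.
exact: ideal0.
Qed.

Lemma pab_maximal a b : (a != 0) || (b != 0) -> maximal_ideal (pab a b).
Proof.
move=> ab; have [f fr] := regular_rep q0 qn a b.
by rewrite (pab_ker fr ab); apply: (regular_ker_maximal q0 qn fr ab).
Qed.

Lemma pab_coef0 a b s (p : nat * nat * nat -> {poly {poly K}}) :
  (a != 0) || (b != 0) -> uniq s -> all is_nf s ->
  pab a b (\sum_(t <- s) cen q (p t) * nf q t) ->
  forall t, t \in s -> (p t).[b%:P].[a] = 0.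
Proof.
move=> ab us snf; have [f fr] := regular_rep q0 qn a b.
by rewrite (pab_ker fr ab); exact: regular_coef0.
Qed.

Lemma pab_scalars a b c d : (a != 0) || (b != 0) ->
  pab a b (z q - c%:A) -> pab a b (z' q - d%:A) -> a = c /\ b = d.
Proof.
move=> ab; have [g1 g2] := pab_gens a b; have hI := pab_ideal a b.
have [_ P1 _] := pab_maximal ab.
have sc (u : U) (x y : K) : pab a b (u - x%:A) -> pab a b (u - y%:A) -> x = y.
  move=> hx hy; apply/eqP; rewrite -subr_eq0; apply: contrapT => /negP xy; apply: P1.
  apply: (ideal_scale hI xy); have -> : (x - y)%:A = (u - y%:A) - (u - x%:A) by nc K.
  exact: idealB hI hy hx.
by move=> h1 h2; split; [exact: sc g1 h1 | exact: sc g2 h2].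
Qed.

(** The powers of [q] provide [size c] distinct nonzero points, more than [c] can have roots. *)
Lemma poly_nonroot (c : {poly K}) : c != 0 -> exists2 a, a != 0 & c.[a] != 0.
Proof.
move=> c0; pose rs := [seq q ^+ n | n <- iota 0 (size c)].
have urs : uniq rs.
  rewrite map_inj_in_uniq ?iota_uniq // => m n _ _.
  wlog: m n / (m <= n)%N => [hw|mn /eqP].
    by case: (leqP m n) => [/hw//|/ltnW/hw h /esym/h].
  rewrite -(subnKC mn) exprD -{1}[q ^+ m]mulr1 => /eqP/(mulfI (expf_neq0 _ q0))/esym/eqP h.
  case: (posnP (n - m)) => [->|/qn]; first by rewrite addn0.
  by rewrite h.
have [/allP h|/allPn[_ /mapP[n _ ->] h]] := boolP (all (root c) rs).
  have := max_poly_roots c0 (introT allP h) urs.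
  by rewrite size_map size_iota ltnn.
by exists (q ^+ n); rewrite ?expf_neq0.
Qed.

Lemma poly2_nonroot (p : {poly {poly K}}) : p != 0 ->
  exists a b, [/\ a != 0, b != 0 & p.[b%:P].[a] != 0].
Proof.
move=> p0; have [|a a0 ha] := @poly_nonroot (lead_coef p); first by rewrite lead_coef_eq0.
have pa : map_poly (horner_eval a) p != 0.
  apply/eqP => /(congr1 (fun r : {poly K} => r`_(size p).-1)).
  by rewrite coef_map coef0 /= => /eqP; rewrite (negPf ha).
have [b b0 hb] := poly_nonroot pa; exists a, b; split=> //.
by rewrite (_ : _.[a] = (map_poly (horner_eval a) p).[b]) // -{2}(hornerC b a) -horner_evalE horner_map.
Qed.

End CentralIdeals.

Arguments pab {K} q a b _.

(** An intersection of primes need not be prime; it is when two elements outside [P] can always be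
    avoided by one and the same member of the family. *)
Lemma prime_from_family (R : nzRingType) (P : set R) (D : set (set R)) :
  two_sided_ideal P -> P <> setT ->
  (forall Q, D Q -> prime_ideal Q /\ P `<=` Q) ->
  (forall x y, ~ P x -> ~ P y -> exists Q, [/\ D Q, ~ Q x & ~ Q y]) -> prime_ideal P.
Proof.
move=> hP PT DP sep; split=> // I J hI hJ IJ; apply: contrapT.
move=> /not_orP[/nonsubset[x [Ix Px]] /nonsubset[y [Jy Py]]].
have [Q [/DP[[_ _ Qp] PQ] Qx Qy]] := sep x y Px Py.
have [h|h] := Qp I J hI hJ (fun a b Ia Jb => PQ _ (IJ a b Ia Jb)).
  exact/Qx/h.
exact/Qy/h.
Qed.

(** * Primality of the ideals generated by 0, [z] and [z'] *)

Section HeightOne.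
Variables (K : fieldType) (q : K).
Hypotheses (q0 : q != 0) (qn : forall n : nat, (0 < n)%N -> q ^+ n != 1).
Local Notation U := (UqB2 q).

Lemma ideal_gen0 : ideal_gen [set (0 : U)] = [set 0].
Proof.
apply/seteqP; split; last by move=> _ ->; apply: ideal_gen_sub.
apply: ideal_gen_min => //; split=> //= [x y -> ->|a x b ->]; first by rewrite addr0.
by rewrite mulr0 mul0r.
Qed.

Lemma horner2E (p : {poly {poly K}}) a b :
  p.[b%:P].[a] = (map_poly (horner_eval a) p).[b].
Proof. by rewrite -[in RHS](hornerC b a) -horner_evalE horner_map. Qed.

Let nf_ideal (I : set U) s (p : nat * nat * nat -> {poly {poly K}}) : two_sided_ideal I ->
  ~ I (\sum_(t <- s) cen q (p t) * nf q t) -> exists2 t, t \in s & ~ I (cen q (p t)).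
Proof.
move=> hI h; apply: contrapT => hs; apply: h; rewrite big_seq.
apply: ideal_sum => // t ts; apply: idealMr => //.
by apply: contrapT => ht; apply: hs; exists t.
Qed.

Lemma cen_z (p : {poly {poly K}}) :
  map_poly (horner_eval 0) p = 0 -> ideal_gen [set z q] (cen q p).
Proof.
move=> p0; have -> : p = 'X%:P * map_poly (fun c => c %/ 'X) p.
  apply/polyP => i; rewrite coefCM coef_map_id0 ?div0p // mulrC divpK //.
  rewrite -[X in X %| _]subr0 dvdp_XsubCl rootE.
  have := congr1 (fun r : {poly K} => r`_i) p0.
  by rewrite coef_map coef0 /= horner_evalE => ->.
rewrite (cenCM q) horner_algX -lock; apply: (idealMr _ (ideal_gen_ideal _)).
exact: ideal_gen_sub.
Qed.

Lemma cen_z' (p : {poly {poly K}}) : p`_0 = 0 -> ideal_gen [set z' q] (cen q p).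
Proof.
elim/poly_ind: p => [_|p c _]; first by rewrite raddf0; exact: (ideal0 (ideal_gen_ideal _)).
rewrite coefD coefMX coefC /= add0r => ->; rewrite addr0 cenMX -lock.
by apply: (idealMl _ (ideal_gen_ideal _)); exact: ideal_gen_sub.
Qed.

(** A common point [(a, b)] for [u] and [v] comes from the product of a nonzero coefficient of each.
    The next two lemmas do the same on the lines [a = 0] and [b = 0]. *)
Lemma not0_pab (u v : U) : u <> 0 -> v <> 0 ->
  exists a b, [/\ a != 0, b != 0, ~ pab q a b u & ~ pab q a b v].
Proof.
have h0 : two_sided_ideal [set (0 : U)] by rewrite -ideal_gen0; exact: ideal_gen_ideal.
have [s [p [us snf ->]]] := nf_repr q0 qn u; have [s' [p' [us' snf' ->]]] := nf_repr q0 qn v.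
move=> /(@nf_ideal [set 0] s p h0)[t ts ht] /(@nf_ideal [set 0] s' p' h0)[t' ts' ht'].
have [|a [b [a0 b0 hab]]] := @poly2_nonroot _ _ q0 qn (p t * p' t').
  by rewrite mulf_neq0 //; apply/eqP => h; [case: ht | case: ht']; rewrite h raddf0.
have ab : (a != 0) || (b != 0) by rewrite a0.
exists a, b; move: hab; rewrite !hornerM mulf_eq0 => /norP[h h'].
split=> //; first by move=> /(pab_coef0 q0 qn ab us snf)/(_ t ts)/eqP; apply/negP.
by move=> /(pab_coef0 q0 qn ab us' snf')/(_ t' ts')/eqP; apply/negP.
Qed.

Lemma notz_pab (u v : U) : ~ ideal_gen [set z q] u -> ~ ideal_gen [set z q] v ->
  exists b, [/\ b != 0, ~ pab q 0 b u & ~ pab q 0 b v].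
Proof.
have hI := ideal_gen_ideal [set z q].
have [s [p [us snf ->]]] := nf_repr q0 qn u; have [s' [p' [us' snf' ->]]] := nf_repr q0 qn v.
move=> /(nf_ideal hI)[t ts ht] /(nf_ideal hI)[t' ts' ht'].
pose g (r : {poly {poly K}}) := map_poly (horner_eval 0) r.
have [|b b0 hb] := @poly_nonroot _ _ q0 qn (g (p t) * g (p' t')).
  by rewrite mulf_neq0 //; apply/eqP => h; [case: ht | case: ht']; apply: cen_z.
have ab : ((0 : K) != 0) || (b != 0) by rewrite b0 orbT.
exists b; move: hb; rewrite hornerM mulf_eq0 => /norP[h h'].
split=> //.
  move=> /(pab_coef0 q0 qn ab us snf)/(_ t ts)/eqP.
  by rewrite horner2E; apply/negP.
move=> /(pab_coef0 q0 qn ab us' snf')/(_ t' ts')/eqP.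
by rewrite horner2E; apply/negP.
Qed.

Lemma notz'_pab (u v : U) : ~ ideal_gen [set z' q] u -> ~ ideal_gen [set z' q] v ->
  exists a, [/\ a != 0, ~ pab q a 0 u & ~ pab q a 0 v].
Proof.
have hI := ideal_gen_ideal [set z' q].
have [s [p [us snf ->]]] := nf_repr q0 qn u; have [s' [p' [us' snf' ->]]] := nf_repr q0 qn v.
move=> /(nf_ideal hI)[t ts ht] /(nf_ideal hI)[t' ts' ht'].
have [|a a0 ha] := @poly_nonroot _ _ q0 qn ((p t)`_0 * (p' t')`_0).
  by rewrite mulf_neq0 //; apply/eqP => h; [case: ht | case: ht']; apply: cen_z'.
have ab : (a != 0) || ((0 : K) != 0) by rewrite a0.
exists a; move: ha; rewrite hornerM mulf_eq0 => /norP[h h'].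
split=> //.
  move=> /(pab_coef0 q0 qn ab us snf)/(_ t ts)/eqP.
  by rewrite polyC0 horner_coef0; apply/negP.
move=> /(pab_coef0 q0 qn ab us' snf')/(_ t' ts')/eqP.
by rewrite polyC0 horner_coef0; apply/negP.
Qed.

Lemma pab_prime a b : (a != 0) || (b != 0) -> prime_ideal (pab q a b).
Proof. by move=> ab; apply: maximal_prime; apply: pab_maximal. Qed.

Let gen_pab (x : U) (I : set U) : two_sided_ideal I -> I x -> ideal_gen [set x] `<=` I.
Proof. by move=> hI Ix; apply: ideal_gen_min => // _ ->. Qed.

Let proper (P Q : set U) : P `<=` Q -> prime_ideal Q -> P <> setT.
Proof.
move=> PQ [_ QT _] PT; apply: QT; apply/seteqP; split=> // x _.
by apply: PQ; rewrite PT.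
Qed.

Lemma z_in_pab b : pab q 0 b (z q).
Proof. by have [h _] := pab_gens q 0 b; rewrite scale0r subr0 in h. Qed.

Lemma z'_in_pab a : pab q a 0 (z' q).
Proof. by have [_ h] := pab_gens q a 0; rewrite scale0r subr0 in h. Qed.

Lemma prime_gen0 : prime_ideal (ideal_gen [set (0 : U)]).
Proof.
have sub a b : ideal_gen [set 0] `<=` pab q a b.
  by apply: gen_pab; [exact: pab_ideal | exact: (ideal0 (pab_ideal _ _ _))].
have ab11 : ((1 : K) != 0) || ((1 : K) != 0) by rewrite oner_neq0.
apply: (@prime_from_family _ _ [set P | exists a b, [/\ a != 0, b != 0 & P = pab q a b]]).
- exact: ideal_gen_ideal.
- by apply: (proper (sub 1 1)); exact: pab_prime.
- by move=> _ [a [b [a0 b0 ->]]]; split; [apply: pab_prime; rewrite a0 | exact: sub].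
move=> x y; rewrite ideal_gen0 => x0 y0; have [a [b [a0 b0 hx hy]]] := not0_pab x0 y0.
by exists (pab q a b); split=> //; exists a, b.
Qed.

Lemma prime_genz : prime_ideal (ideal_gen [set z q]).
Proof.
have sub b : ideal_gen [set z q] `<=` pab q 0 b.
  by apply: gen_pab; [exact: pab_ideal | exact: z_in_pab].
have ab (b : K) : b != 0 -> ((0 : K) != 0) || (b != 0) by move=> ->; rewrite orbT.
apply: (@prime_from_family _ _ [set P | exists b, b != 0 /\ P = pab q 0 b]).
- exact: ideal_gen_ideal.
- by apply: (proper (sub 1)); apply: pab_prime; rewrite oner_neq0 orbT.
- by move=> _ [b [b0 ->]]; split; [apply/pab_prime/ab | exact: sub].
move=> x y x0 y0; have [b [b0 hx hy]] := notz_pab x0 y0.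
by exists (pab q 0 b); split=> //; exists b.
Qed.

Lemma prime_genz' : prime_ideal (ideal_gen [set z' q]).
Proof.
have sub a : ideal_gen [set z' q] `<=` pab q a 0.
  by apply: gen_pab; [exact: pab_ideal | exact: z'_in_pab].
have ab (a : K) : a != 0 -> (a != 0) || ((0 : K) != 0) by move=> ->.
apply: (@prime_from_family _ _ [set P | exists a, a != 0 /\ P = pab q a 0]).
- exact: ideal_gen_ideal.
- by apply: (proper (sub 1)); apply: pab_prime; rewrite oner_neq0.
- by move=> _ [a [a0 ->]]; split; [apply/pab_prime/ab | exact: sub].
move=> x y x0 y0; have [a [a0 hx hy]] := notz'_pab x0 y0.
by exists (pab q a 0); split=> //; exists a.
Qed.

End HeightOne.

(** * Quantum planes *)

(** From ideals to elements: [I] gathers what annihilates [y] from the left modulo [P] through any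
    factors, and [J] is the right annihilator of [I] modulo [P]; then [x] is in [I] and [y] in
    [J]. *)
Lemma prime_elem (R : nzRingType) (P : set R) x y : prime_ideal P ->
  (forall u, P (x * u * y)) -> P x \/ P y.
Proof.
move=> [hP _ Pp] h.
pose I := [set a | forall u v, P (u * a * v * y)].
pose J := [set b | forall a, I a -> P (a * b)].
have hI : two_sided_ideal I.
  split=> [u v|a b Ia Ib u v|c a d Ia u v].
  - by rewrite mulr0 !mul0r; apply: ideal0.
  - by rewrite mulrDr !mulrDl; apply: idealD.
  - by rewrite !mulrA -(mulrA _ d v); apply: Ia.
have hJ : two_sided_ideal J.
  split=> [a _|b c Jb Jc a Ia|c b d Jb a Ia].
  - by rewrite mulr0; apply: ideal0.
  - by rewrite mulrDr; apply: idealD => //; [apply: Jb | apply: Jc].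
  - by rewrite !mulrA; apply: idealMr => //; apply: Jb; exact: (idealMr c hI Ia).
have [hIP|hJP] := Pp I J hI hJ (fun a b Ia Jb => Jb a Ia).
  by left; apply: hIP => u v; rewrite -!mulrA; apply: idealMl => //; rewrite mulrA.
right; apply: hJP => a Ia; have := Ia 1 1; by rewrite mul1r mulr1.
Qed.

Lemma prime_normal (R : nzRingType) (P : set R) x y : prime_ideal P ->
  (forall u, exists v, P (x * u - v * x)) -> P (x * y) -> P x \/ P y.
Proof.
move=> hP xn xy; apply: prime_elem => // u; have [v huv] := xn u.
have [h _ _] := hP.
have -> : x * u * y = (x * u - v * x) * y + v * (x * y) by rewrite mulrBl !mulrA subrK.
by apply: idealD => //; [apply: idealMr | apply: idealMl].
Qed.

Lemma gens_normal (K : fieldType) (q : K) (P : set (UqB2 q)) (w : UqB2 q) (c1 c2 : K) :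
  two_sided_ideal P -> P (w * e1 q - c1 *: (e1 q * w)) -> P (w * e2 q - c2 *: (e2 q * w)) ->
  forall u, exists v, P (w * u - v * w).
Proof.
move=> hP h1 h2; have step (x u v : UqB2 q) c : P (w * x - c *: (x * w)) -> P (w * u - v * w) ->
    P (w * (x * u) - c *: (x * v) * w).
  move=> hx hu; have -> : w * (x * u) - c *: (x * v) * w =
    (w * x - c *: (x * w)) * u + c *: (x * (w * u - v * w)) by nc K.
  exact: (idealD hP (idealMr _ hP hx) (idealZ _ hP (idealMl _ hP hu))).
apply: Uq_ind => [c u v [u' hu] [v' hv]||u [u' hu]|u [u' hu]].
- exists (c *: u' + v').
  have -> : w * (c *: u + v) - (c *: u' + v') * w = c *: (w * u - u' * w) + (w * v - v' * w) by nc K.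
  exact: (idealD hP (idealZ _ hP hu) hv).
- by exists 1; rewrite mulr1 mul1r subrr; exact: ideal0.
- by exists (c1 *: (e1 q * u')); exact: step.
- by exists (c2 *: (e2 q * u')); exact: step.
Qed.

Section Plane.
Variables (K : fieldType) (q : K).
Hypotheses (q0 : q != 0) (qn : forall n : nat, (0 < n)%N -> q ^+ n != 1).
Local Notation Q := (q ^+ 2).
Local Notation U := (UqB2 q).
Local Notation x1 := (e1 q).
Local Notation x2 := (e2 q).
Variable l : int.
Hypothesis hl : (l == 1) || (l == -1).
Local Notation la := (Q ^ (- l)).

Let Q0 : Q != 0. Proof. exact: expf_neq0. Qed.
Let Qz m : Q ^ m != 0. Proof. by rewrite expfz_neq0. Qed.
Let la_sum : q ^+ 2 + q ^- 2 = la + la^-1.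
Proof.
case/orP: hl => /eqP ->; last by rewrite opprK expr1z.
by rewrite exprN1 invrK addrC.
Qed.

(** A common treatment of [<e3>], which is [l = -1], and of [<e3bar>], which is [l = 1]. *)
Definition plane : set U := ideal_gen [set x1 * x2 - la *: (x2 * x1)].

Lemma plane_ideal : two_sided_ideal plane. Proof. exact: ideal_gen_ideal. Qed.

Lemma plane_gen : plane (x1 * x2 - la *: (x2 * x1)).
Proof. exact: ideal_gen_sub. Qed.

(** The exponents (1, 0) and (-1, [l]) form a basis of Z^2, and both products of the generators are
    multiples of [t^l]. *)
Definition plane_map (f : {lrmorphism U -> zend K}) : Prop :=
  f x1 = lij q 1 0 /\ f x2 = lij q (-1) l.

(** As [q^2 + q^-2 = la + la^-1] for either sign of [l], both Serre expressions are combinations of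
    multiples of [x y - la y x]. *)
Lemma plane_rep : exists f, plane_map f.
Proof.
have [||f [f1 f2]] := @Uq_lift K q (zend K) (lij q 1 0) (lij q (-1) l); last by exists f.
  set x := lij q 1 0; set y := lij q (-1) l.
  have xy : x * y = la *: (y * x).
    rewrite (@lijM _ _ q0 1 0 (-1) l 0 l (- l)) ?mul1r ?add0r //.
    by rewrite (@lijM _ _ q0 (-1) l 1 0 0 l 0) ?expr0z ?scale1r ?addr0.
  rewrite /serre1 la_sum; transitivity (x * (x * y - la *: (y * x)) - la^-1 *: ((x * y - la *: (y * x)) * x)).
    by move: la (Qz (- l)) => mu mu0; nc K.
  by rewrite xy subrr mulr0 mul0r scaler0 subrr.
set x := lij q 1 0; set y := lij q (-1) l.
have xy : x * y = la *: (y * x).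
  rewrite (@lijM _ _ q0 1 0 (-1) l 0 l (- l)) ?mul1r ?add0r //.
  by rewrite (@lijM _ _ q0 (-1) l 1 0 0 l 0) ?expr0z ?scale1r ?addr0.
rewrite /serre2 (addrAC _ 1) la_sum.
transitivity (- ((x * y - la *: (y * x)) * y * y - (1 + la^-1) *: (y * (x * y - la *: (y * x)) * y)
  + la^-1 *: (y * y * (x * y - la *: (y * x))))).
  by move: la (Qz (- l)) => mu mu0; nc K.
by rewrite xy subrr !(mulr0, mul0r, scaler0, subr0, addr0, oppr0).
Qed.

Section Map.
Variable f : {lrmorphism U -> zend K}.
Hypothesis fp : plane_map f.

Let f1 : f x1 = lij q 1 0. Proof. by case: fp. Qed.
Let f2 : f x2 = lij q (-1) l. Proof. by case: fp. Qed.

Lemma plane_band u : band q (f u).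
Proof.
move: u; apply: (@band_morph _ _ q0 f [:: (1, (1, 0))] [:: (1, (-1, l))]).
  by rewrite f1 big_seq1 scale1r.
by rewrite f2 big_seq1 scale1r.
Qed.

Lemma plane_sep (r s : int * int) : r <> s -> exists X e p,
  [/\ e != 0, f X = e *: lop q p & p.1 * r.2 - r.1 * p.2 <> p.1 * s.2 - s.1 * p.2].
Proof.
move: r s => [i j] [i' j'] /= rs.
have [ij|ij] := eqVneq j j'; last first.
  exists x1, 1, (1, 0); rewrite oner_neq0 scale1r f1 /= !mulr0; split=> //.
  by clear -ij; lia.
exists x2, 1, (-1, l); rewrite oner_neq0 scale1r f2 /=; split=> //.
rewrite ij => h; apply: rs; congr (_, _); last exact: ij.
by case/orP: hl => /eqP hl'; move: h; rewrite hl'; clear; lia.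
Qed.

Lemma plane_sub_ker : plane `<=` [set u | f u = 0].
Proof.
apply: ideal_gen_min; first exact: kernel_ideal.
move=> _ -> /=; rewrite rmorphB /= linearZ /= !rmorphM /= f1 f2.
rewrite (@lijM _ _ q0 1 0 (-1) l 0 l (- l)) ?mul1r ?add0r //.
by rewrite (@lijM _ _ q0 (-1) l 1 0 0 l 0) ?expr0z ?scale1r ?addr0 ?subrr.
Qed.

Lemma plane_fmono j i : exists2 c, c != 0 & f (x2 ^+ j * x1 ^+ i) = c *: lij q (i%:Z - j%:Z) (j%:Z * l).
Proof.
elim: j => [|j [c c0 IHj]].
  exists 1; rewrite ?oner_neq0 // scale1r expr0 mul1r subr0 mul0r.
  elim: i => [|i IHi]; first by rewrite expr0 rmorph1 lij00.
  rewrite exprS rmorphM /= IHi f1 (@lijM _ _ q0 1 0 i 0 i.+1 0 0) ?mulr0 //.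
  by rewrite expr0z scale1r.
exists (c * Q ^ (j%:Z * l)); first by rewrite mulf_neq0.
rewrite exprS -mulrA rmorphM /= IHj f2 -scalerAr.
rewrite (@lijM _ _ q0 (-1) l (i%:Z - j%:Z) (j%:Z * l) (i%:Z - j.+1%:Z) (j.+1%:Z * l) (j%:Z * l)) ?scalerA //.
- by clear; lia.
- by clear; lia.
- by rewrite mulN1r opprK.
Qed.

End Map.

Lemma plane_e1_e2X j : plane (x1 * x2 ^+ j - (la ^+ j) *: (x2 ^+ j * x1)).
Proof.
elim: j => [|j IHj]; first by rewrite !expr0 mulr1 mul1r scale1r subrr; exact: ideal0 plane_ideal.
rewrite exprS; have -> : x1 * (x2 * x2 ^+ j) - la ^+ j.+1 *: (x2 * x2 ^+ j * x1) =
   (x1 * x2 - la *: (x2 * x1)) * x2 ^+ j + la *: (x2 * (x1 * x2 ^+ j - la ^+ j *: (x2 ^+ j * x1))).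
  by rewrite exprS; move: (x2 ^+ j) (la ^+ j) la => X c d; nc K.
apply: (idealD plane_ideal); first exact: idealMr plane_ideal plane_gen.
by apply: (idealZ _ plane_ideal); exact: idealMl plane_ideal IHj.
Qed.

Lemma plane_nf u : exists l : seq (K * (nat * nat)),
  plane (u - \sum_(x <- l) x.1 *: (x2 ^+ x.2.1 * x1 ^+ x.2.2)).
Proof.
have hI := plane_ideal.
move: u; apply: Uq_ind => [c u v [m hm] [n hn]||u [m hm]|u [m hm]].
- exists ([seq (c * x.1, x.2) | x <- m] ++ n).
  rewrite big_cat big_map /=.
  under eq_bigr do rewrite -scalerA.
  by rewrite -scaler_sumr opprD addrACA -scalerBr; apply: (idealD hI) => //; apply: (idealZ _ hI).
- by exists [:: (1, (0, 0)%N)]; rewrite big_seq1 scale1r !expr0 mulr1 subrr; exact: ideal0 hI.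
- exists [seq (x.1 * la ^+ x.2.1, (x.2.1, x.2.2.+1)) | x <- m].
  rewrite big_map /=; set S := \sum_(x <- m) _ in hm *.
  have -> : x1 * u - \sum_(x <- m) (x.1 * la ^+ x.2.1) *: (x2 ^+ x.2.1 * x1 ^+ x.2.2.+1) =
    x1 * (u - S) + \sum_(x <- m) x.1 *: ((x1 * x2 ^+ x.2.1 - (la ^+ x.2.1) *: (x2 ^+ x.2.1 * x1)) * x1 ^+ x.2.2).
    rewrite mulrBr /S mulr_sumr -addrA; congr (_ + _).
    rewrite addrC -sumrB -sumrN; apply: eq_bigr => x _.
    rewrite (exprS x1); move: (x2 ^+ _) (la ^+ _) (x1 ^+ _) => A c B.
    by nc K.
  apply: (idealD hI); first exact: idealMl hI hm.
  apply: (ideal_sum _ hI) => x _; apply: (idealZ _ hI); apply: (idealMr _ hI).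
  exact: plane_e1_e2X.
- exists [seq (x.1, (x.2.1.+1, x.2.2)) | x <- m].
  have -> : x2 * u - \sum_(x <- [seq (x.1, (x.2.1.+1, x.2.2)) | x <- m]) x.1 *: (x2 ^+ x.2.1 * x1 ^+ x.2.2)
     = x2 * (u - \sum_(x <- m) x.1 *: (x2 ^+ x.2.1 * x1 ^+ x.2.2)); last exact: idealMl hI hm.
  rewrite mulrBr mulr_sumr big_map; congr (_ - _); apply: eq_bigr => x _ /=.
  by rewrite exprS -mulrA scalerAr.
Qed.

Lemma plane_ker f : plane_map f -> plane = [set u | f u = 0].
Proof.
move=> fp; apply/seteqP; split; first exact: plane_sub_ker.
move=> u fu; have hI := plane_ideal; have [m hm] := plane_nf u.
apply/(ideal_subr hI hm).
have := plane_sub_ker fp hm; rewrite /= rmorphB /= fu sub0r => /eqP.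
rewrite oppr_eq0 (big_fiber snd) => /eqP fS.
pose c t := \sum_(x <- m | x.2 == t) x.1.
have cE t : \sum_(x <- m | x.2 == t) x.1 *: (x2 ^+ x.2.1 * x1 ^+ x.2.2) =
    c t *: (x2 ^+ t.1 * x1 ^+ t.2) by rewrite scaler_suml; apply: eq_bigr => x /eqP ->.
rewrite big_seq; apply: (ideal_sum _ hI) => t ts.
suff -> : \sum_(x <- m | x.2 == t) x.1 *: (x2 ^+ x.2.1 * x1 ^+ x.2.2) = 0 by exact: ideal0 hI.
rewrite cE; suff -> : c t = 0 by rewrite scale0r.
have h := fS; move: h; under eq_bigr do rewrite cE.
(* The monomials [x2^j x1^i] act as multiples of distinct lattice monomials; evaluating at the
   lattice point of [t] extracts [c t]. *)
move=> h; have {h} : (\sum_(s <- undup (map snd m)) c s *: f (x2 ^+ s.1 * x1 ^+ s.2))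
     (@dirac0 K) (t.2%:Z - t.1%:Z, t.1%:Z * l) = 0.
  have -> : \sum_(s <- undup (map snd m)) c s *: f (x2 ^+ s.1 * x1 ^+ s.2) = 0.
    by rewrite -[RHS]h rmorph_sum; apply: eq_bigr => s _ /=; rewrite linearZ.
  by [].
rewrite zend_sum (bigD1_seq t) ?undup_uniq //= big1 ?addr0 => [|s st].
  have [d d0 ->] := plane_fmono fp t.1 t.2.
  rewrite !zendZ lijE !subrr /dirac0 eqxx mulr1 => /eqP.
  by rewrite !mulf_eq0 (negPf d0) (negPf (Qz _)) !orbF => /eqP.
have [d d0 ->] := plane_fmono fp s.1 s.2.
rewrite !zendZ lijE /dirac0 -[0]/(0, 0) xpair_eqE.
rewrite [_ && _]negbTE ?mulr0 //; apply: contra st.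
case: s t {ts d d0} => [j i] [j' i'] /=; rewrite xpair_eqE.
by case/orP: hl => /eqP ->; clear; lia.
Qed.

Lemma plane_not1 : ~ plane 1.
Proof.
have [f fp] := plane_rep; rewrite (plane_ker fp) /= rmorph1 => /eqP.
by rewrite oner_eq0.
Qed.

Lemma plane_isolate (I : set U) u : two_sided_ideal I -> I u -> ~ plane u ->
  forall f, plane_map f -> exists y r c, [/\ I y, c != 0 & f y = c *: lop q r].
Proof.
move=> hI Iu Pu f fp; move: Pu; rewrite (plane_ker fp) => fu.
exact: (isolate_monomial q0 qn (plane_band fp) (plane_sep fp) hI Iu fu).
Qed.

(** Two ideals not contained in [plane] each contain an element acting as a nonzero monomial, and
    the product of two monomials is not zero. *)
Lemma plane_prime : prime_ideal plane.
Proof.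
split; [exact: plane_ideal | by move=> PT; apply: plane_not1; rewrite PT |].
move=> I J hI hJ IJ; apply: contrapT => /not_orP[/nonsubset[x [Ix Px]] /nonsubset[y [Jy Py]]].
have [f fp] := plane_rep.
have [a [r [c [Ia c0 fa]]]] := plane_isolate hI Ix Px fp.
have [b [s [d [Jb d0 fb]]]] := plane_isolate hJ Jy Py fp.
have := IJ a b Ia Jb; rewrite (plane_ker fp) /= rmorphM /= fa fb -scalerAl -scalerAr (lopM q0).
move=> /(congr1 (fun g : zend K => g (@dirac0 K) (r + s))).
rewrite !zendZ lopE subrr /dirac0 eqxx mulr1 => /eqP.
by rewrite !mulf_eq0 (negPf c0) (negPf d0) !(negPf (Qz _)).
Qed.

(** A strictly larger prime contains an element acting as a monomial, hence, after multiplication by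
    generators, some [x2^j x1^i]; both generators are normal modulo [P], so primality strips the
    factors one by one. *)
Lemma plane_prime_above P : prime_ideal P -> plane `<=` P -> P <> plane -> P x1 \/ P x2.
Proof.
move=> Pp PlP Pne; have [hP PT _] := Pp; have [f fp] := plane_rep.
have [f1 f2] := fp.
have [u [Pu nu]] : exists u, P u /\ ~ plane u.
  apply: contrapT => h; apply: Pne; apply/seteqP; split=> // u Pu.
  by apply: contrapT => nu; apply: h; exists u.
have [y [[m n] [c [Py c0 fy]]]] := plane_isolate hP Pu nu fp.
have lM i j k k' : lij q i j * lij q k k' = Q ^ (- (i * k')) *: lij q (i + k) (j + k').
  exact: lijM.
(* Each factor [x2] adds (-1, [l]) to the exponent; after [absz n] of them the second coordinate is
   [j * l] with [j] the natural number [absz n + n * l]. *)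
have [j [hj [y' [c' [Py' c0' fy']]]]] : exists j : nat, True /\ exists y' c', [/\ P y', c' != 0
    & f y' = c' *: lij q (m + n * l - j%:Z) (j%:Z * l)].
  suff up (k : nat) : exists y' c', [/\ P y', c' != 0 & f y' = c' *: lij q (m - k%:Z) (n + k%:Z * l)].
    have [y' [c' [Py' c0' fy']]] := up (absz n); exists (absz ((absz n)%:Z + n * l)); split=> //.
    exists y', c'; split=> //; rewrite fy'; congr (_ *: lij q _ _).
      by case/orP: hl => /eqP ->; clear; lia.
    by case/orP: hl => /eqP ->; clear; lia.
  elim: k => [|k [y' [c' [Py' c0' fy']]]]; first by exists y, c; rewrite subr0 mul0r addr0.
  exists (x2 * y'), (c' * Q ^ (- (-1 * (n + k%:Z * l)))); split.
  - exact: idealMl.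
  - by rewrite mulf_neq0.
  - rewrite rmorphM /= f2 fy' -scalerAr lM scalerA; congr (_ *: lij q _ _); first by clear; lia.
    by clear; lia.
(* Factors [x1] then raise the first coordinate to [i - j] with [i] natural: this is the exponent of
   [x2^j x1^i]. *)
have [i [y'' [c'' [Py'' c0'' fy'']]]] : exists i : nat, exists y' c', [/\ P y', c' != 0
    & f y' = c' *: lij q (i%:Z - j%:Z) (j%:Z * l)].
  suff up (k : nat) : exists y' c', [/\ P y', c' != 0 & f y' = c' *: lij q (k%:Z + (m + n * l - j%:Z)) (j%:Z * l)].
    have [z [d [Pz d0 fz]]] := up (absz (m + n * l)).
    exists (absz ((absz (m + n * l))%:Z + (m + n * l))), z, d; split=> //.
    by rewrite fz; congr (_ *: lij q _ _); move: (m + n * l); clear; lia.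
  elim: k => [|k [z [d [Pz d0 fz]]]]; first by exists y', c'; rewrite add0r.
  exists (x1 * z), (d * Q ^ (- (1 * (j%:Z * l)))); split.
  - exact: idealMl.
  - by rewrite mulf_neq0.
  - rewrite rmorphM /= f1 fz -scalerAr lM scalerA add0r; congr (_ *: lij q _ _).
    by move: (m + n * l - j%:Z); clear; lia.
have [d d0 fd] := plane_fmono fp j i.
have Pji : P (x2 ^+ j * x1 ^+ i).
  have : plane (y'' - (c'' / d) *: (x2 ^+ j * x1 ^+ i)).
    rewrite (plane_ker fp) /= rmorphB /= linearZ /= fy''.
    by rewrite fd scalerA divfK // subrr.
  move=> /PlP h; have [/(_ Py'') h' _] := ideal_subr hP h.
  by apply: (ideal_scale hP _ h'); rewrite mulf_neq0 // invr_neq0.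
have Pxy := PlP _ plane_gen.
have n2 : forall u, exists v, P (x2 * u - v * x2).
  apply: (gens_normal (c1 := la^-1) (c2 := 1) hP); last by rewrite scale1r subrr; exact: ideal0.
  have -> : x2 * x1 - la^-1 *: (x1 * x2) = - la^-1 *: (x1 * x2 - la *: (x2 * x1)).
    by move: la (Qz (- l)) => mu mu0; nc K.
  exact: idealZ.
have n1 : forall u, exists v, P (x1 * u - v * x1).
  by apply: (gens_normal (c1 := 1) hP _ Pxy); rewrite scale1r subrr; exact: ideal0.
have {Pji} : P x2 \/ P (x1 ^+ i).
  elim: j Pji {hj fy' fy'' fd} => [|j' IHj]; first by rewrite expr0 mul1r; right.
  by rewrite exprS -mulrA => /(prime_normal Pp n2)[]; [left | exact: IHj].
case; first by right.
move=> h; left; elim: i h {fy'' fd} => [|i' IHi].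
  by rewrite expr0 => /(ideal_setT hP).
by rewrite exprS => /(prime_normal Pp n1)[].
Qed.

End Plane.

Arguments plane {K} q l _.

(** * Primitive ideals *)

Section LeftIdeals.
Variable R : nzRingType.
Implicit Types L P I J : set R.

Definition left_ideal L : Prop :=
  [/\ L 0, forall x y, L x -> L y -> L (x + y) & forall a x, L x -> L (a * x)].

Definition avoids (s : R) L : Prop := forall k, ~ L (s ^+ k).

Lemma left_idealB L x y : left_ideal L -> L x -> L y -> L (x - y).
Proof. by case=> _ LD LM Lx Ly; apply: LD => //; rewrite -mulN1r; apply: LM. Qed.

Lemma two_sided_left L : two_sided_ideal L -> left_ideal L.
Proof.
move=> hL; split; first exact: ideal0 hL.
  by move=> x y; apply: idealD hL.
by move=> a x; apply: idealMl hL.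
Qed.

(** For [s = 1] these are the maximal left ideals. For a general central [s] they play the part of
    maximal left ideals of the localisation at [s]. *)
Definition max_avoiding s L : Prop :=
  [/\ left_ideal L, avoids s L &
    forall L', left_ideal L' -> L `<=` L' -> avoids s L' -> L' `<=` L].

Lemma exists_max_avoiding s L0 : left_ideal L0 -> avoids s L0 ->
  exists2 L, max_avoiding s L & L0 `<=` L.
Proof.
(* Zorn's lemma is applied to sets united with [L0], so that the empty chain, whose union is empty,
   also satisfies the condition. *)
move=> hL0 aL0; pose good A := left_ideal (A `|` L0) /\ avoids s (A `|` L0).
have [F FP Ftot|A [[hA aA] Amax]] := @Zorn_bigcup R good.
  split; last first.
    move=> k [[X FX Xk]|]; last exact: aL0.
    by have [_ /(_ k)] := FP X FX; apply; left.
  split.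
  - by right; case: hL0.
  - move=> x y [[X FX Xx]|L0x] [[Y FY Yy]|L0y].
    + have [XY|YX] := Ftot X Y FX FY.
        have [[_ hD _] _] := FP Y FY.
        have [] := hD x y (or_introl (XY _ Xx)) (or_introl Yy); [by left; exists Y | by right].
      have [[_ hD _] _] := FP X FX.
      have [] := hD x y (or_introl Xx) (or_introl (YX _ Yy)); [by left; exists X | by right].
    + have [[_ hD _] _] := FP X FX.
      have [] := hD x y (or_introl Xx) (or_intror L0y); [by left; exists X | by right].
    + have [[_ hD _] _] := FP Y FY.
      have [] := hD x y (or_intror L0x) (or_introl Yy); [by left; exists Y | by right].
    + by right; case: hL0 => _ hD _; apply: hD.
  - move=> a x [[X FX Xx]|L0x].
      have [[_ _ hM] _] := FP X FX.
      by have [] := hM a x (or_introl Xx); [left; exists X | right].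
    by right; case: hL0 => _ _ hM; apply: hM.
exists (A `|` L0); last by move=> x; right.
split=> // L' hL' AL' aL' x L'x; left; apply: contrapT => Ax.
have LL : L' `|` L0 = L'.
  by apply/seteqP; split=> [y [//|L0y]|y]; [apply: AL'; right | left].
apply: (Amax L'); last by rewrite /good LL.
split; first by move=> y Ay; apply: AL'; left.
by move=> h; apply: Ax; exact: h.
Qed.

Section Quotient.
Variables (L : set R) (hL : left_ideal L).

(** The proof that [L] is a left ideal is an argument, so that closedness under subtraction can be
    attached to the predicate as an instance. *)
Definition lpred of left_ideal L : {pred R} := fun x => `[< L x >].

Fact lpred_zmod_closed : zmod_closed (lpred hL).
Proof.
split; first by apply/asboolP; case: hL.
by move=> x y /asboolP Lx /asboolP Ly; apply/asboolP; apply: left_idealB.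
Qed.
HB.instance Definition _ := GRing.isZmodClosed.Build R (lpred hL) lpred_zmod_closed.

Definition lquot : Type := Quotient.quot (lpred hL : zmodClosed R).
HB.instance Definition _ := Choice.on lquot.
HB.instance Definition _ := EqQuotient.on lquot.
HB.instance Definition _ := GRing.Zmodule.on lquot.

Definition lpi (x : R) : lquot := (\pi_lquot x)%qT.

Lemma lpi_eq x y : lpi x = lpi y <-> L (x - y).
Proof.
have := @Quotient.idealrBE _ (lpred hL : zmodClosed R) x y; rewrite /in_mem /= => h.
by split=> [/eqP|Lxy]; [rewrite -h => /asboolP | apply/eqP; rewrite -h; apply/asboolP].
Qed.

Lemma lpiK u : lpi (repr u) = u. Proof. exact: reprK. Qed.

Fact lpiD : {morph lpi : x y / x + y}.
Proof. by move=> x y; rewrite /lpi; exact: Quotient.pi_add. Qed.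

Lemma lpi0 : lpi 0 = 0.
Proof. by apply: (@addrI _ (lpi 0)); rewrite -lpiD !addr0. Qed.

Definition lscale (a : R) (u : lquot) : lquot := lpi (a * repr u).

Fact lpiZ a x : lscale a (lpi x) = lpi (a * x).
Proof.
apply/lpi_eq; rewrite -mulrBr; case: hL => _ _; apply.
by apply/lpi_eq; rewrite lpiK.
Qed.

Fact lscaleA a b u : lscale a (lscale b u) = lscale (a * b) u.
Proof. by rewrite -(lpiK u) !lpiZ mulrA. Qed.
Fact lscale1 : left_id 1 lscale.
Proof. by move=> u; rewrite -(lpiK u) !lpiZ mul1r. Qed.
Fact lscaleDr : right_distributive lscale +%R.
Proof. by move=> a u v; rewrite -(lpiK u) -(lpiK v) -lpiD !lpiZ mulrDr lpiD. Qed.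
Fact lscaleDl u : {morph lscale^~ u : a b / a + b}.
Proof. by move=> a b; rewrite -(lpiK u) !lpiZ mulrDl lpiD. Qed.
HB.instance Definition _ := GRing.Zmodule_isLmodule.Build R lquot
  lscaleA lscale1 lscaleDr lscaleDl.

Lemma lpi_scale a x : a *: lpi x = lpi (a * x). Proof. exact: lpiZ. Qed.

Lemma lquot_simple : ~ L 1 ->
  (forall L', left_ideal L' -> L `<=` L' -> ~ L' 1 -> L' `<=` L) -> simple_module lquot.
Proof.
move=> L1 Lmax; split.
  by exists (lpi 1); rewrite -lpi0 => /lpi_eq; rewrite subr0.
move=> N [N0 ND NZ]; pose L' := [set x | N (lpi x)].
have hL' : left_ideal L'.
  split; rewrite /L' /=; first by rewrite lpi0.
    by move=> x y Nx Ny; rewrite lpiD; apply: ND.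
  by move=> a x Nx; rewrite -lpi_scale; apply: NZ.
have LL' : L `<=` L' by move=> x Lx; rewrite /L' /= (_ : lpi x = 0) // -lpi0; apply/lpi_eq; rewrite subr0.
have [L'1|L'1] := pselect (L' 1).
  right; apply/seteqP; split=> // u _; rewrite -(lpiK u) -[repr u]mulr1 -lpi_scale.
  exact: NZ.
left; apply/seteqP; split=> [u Nu|_ -> //].
have : L' (repr u) by rewrite /L' /= lpiK.
by move/(Lmax L' hL' LL' L'1) => h; rewrite /= -(lpiK u) -lpi0; apply/lpi_eq; rewrite subr0.
Qed.

End Quotient.

(** [L] is a maximal left ideal above [L0], and the annihilator of the simple quotient by [L] is the
    largest two-sided ideal inside [L]. *)
Lemma exists_primitive L0 : left_ideal L0 -> ~ L0 1 -> exists P L : set R,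
  [/\ left_primitive (P : set R), left_ideal L, L0 `<=` L, ~ L 1 &
     P `<=` L /\ (forall I : set R, two_sided_ideal I -> I `<=` L -> I `<=` P)].
Proof.
move=> hL0 L01; have [|L [hL aL Lmax] L0L] := @exists_max_avoiding 1 L0 hL0.
  by move=> k; rewrite expr1n.
have L1 : ~ L 1 by have := aL 0%N; rewrite expr0.
exists (annihilator (lquot hL)), L; split=> //.
  exists (lquot hL); split=> //; apply: lquot_simple => // L' hL' LL' L'1.
  by apply: Lmax => // k; rewrite expr1n.
split=> [a ha|I hI IL a Ia u].
  by have := ha (lpi hL 1); rewrite lpi_scale mulr1 -(lpi0 hL) => /lpi_eq; rewrite subr0.
rewrite -(lpiK u) lpi_scale -(lpi0 hL); apply/lpi_eq; rewrite subr0.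
by apply: IL; apply: idealMr.
Qed.

Lemma primitive_ideal P : left_primitive P -> two_sided_ideal P.
Proof.
case=> M [_ ->]; split=> [m|x y hx hy m|a x b hx m]; first by rewrite scale0r.
  by rewrite scalerDl hx hy addr0.
by rewrite -!scalerA hx scaler0.
Qed.

(** [L] is the annihilator of one nonzero vector [m] of the simple module. It is maximal because any
    nonzero [x *: m] generates [m] back. *)
Lemma primitive_left P : left_primitive P -> exists2 L, max_avoiding 1 L & P `<=` L /\
  (forall I : set R, two_sided_ideal I -> I `<=` L -> I `<=` P).
Proof.
case=> M [[[m m0] Msimple] ->]; pose L := [set a : R | a *: m = 0].
have gen N : submodule N -> N m -> N = setT.
  by move=> hN Nm; have [N0|//] := Msimple N hN; move: Nm; rewrite N0 => /m0.
have orbit x : x *: m <> 0 -> exists b, b *: (x *: m) = m.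
  move=> xm; pose N := [set v | exists b, v = b *: (x *: m)].
  have hN : submodule N.
    split; first by exists 0; rewrite scale0r.
      by move=> _ _ [b ->] [c ->]; exists (b + c); rewrite scalerDl.
    by move=> a _ [b ->]; exists (a * b); rewrite -scalerA.
  have NT : N = setT.
    have [N0|//] := Msimple N hN; have : N (x *: m) by exists 1; rewrite scale1r.
    by rewrite N0 => /xm.
  have [b hb] : N m by rewrite NT.
  by exists b.
have hL : left_ideal L.
  split; rewrite /L /=; first by rewrite scale0r.
    by move=> x y hx hy; rewrite scalerDl hx hy addr0.
  by move=> a x hx; rewrite -scalerA hx scaler0.
exists L; last first.
  split; first by move=> a ha; exact: ha.
  move=> I hI IL a Ia v; have [->|] := pselect (v = 0); first by rewrite scaler0.
  have : [set v | exists b, v = b *: m] = setT.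
    apply: gen; last by exists 1; rewrite scale1r.
    split; first by exists 0; rewrite scale0r.
      by move=> _ _ [b ->] [c ->]; exists (b + c); rewrite scalerDl.
    by move=> c _ [b ->]; exists (c * b); rewrite -scalerA.
  move=> /seteqP[_ /(_ v Logic.I) [b ->]] _; rewrite scalerA.
  by apply: IL; apply: idealMr.
split=> //; first by move=> k; rewrite expr1n /L /= scale1r.
move=> L' [_ L'D L'M] LL' aL' x L'x; apply: contrapT => /orbit[b hb].
apply: (aL' 0%N); rewrite expr0 -(subrK (b * x) 1); apply: L'D; last exact: L'M.
by apply: LL'; rewrite /L /= scalerBl scale1r -scalerA hb subrr.
Qed.

Lemma primitive_not1 P : left_primitive P -> ~ P 1.
Proof.
by move=> /primitive_left[L [_ aL _] [PL _]] /PL; have := aL 0%N; rewrite expr0.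
Qed.

Lemma primitive_prime P : left_primitive P -> prime_ideal P.
Proof.
move=> hP; have hI := primitive_ideal hP; split=> //.
  by move=> PT; apply: (primitive_not1 hP); rewrite PT.
move=> I J hI' hJ IJ; apply: contrapT => /not_orP[IP /nonsubset[y [Jy Py]]].
case: hP hI IJ IP Py => M [[_ Msimple] ->] hI IJ IP Py.
apply: IP => a Ia v; have [m ym] : exists m : M, y *: m <> 0.
  by apply: contrapT => h; apply: Py => m; apply: contrapT => ym; apply: h; exists m.
pose N := [set w : M | exists b, w = b *: (y *: m)].
have [N0|NT] : N = [set 0] \/ N = setT.
  apply: Msimple; split; first by exists 0; rewrite scale0r.
    by move=> _ _ [b ->] [c ->]; exists (b + c); rewrite scalerDl.
  by move=> c _ [b ->]; exists (c * b); rewrite -scalerA.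
  by case: ym; have : N (y *: m) by [exists 1; rewrite scale1r]; rewrite N0.
have [b ->] : N v by rewrite NT.
by have := IJ a (b * y) Ia (idealMl b hJ Jy) m; rewrite -!scalerA.
Qed.

Lemma maximal_primitive P : maximal_ideal P -> left_primitive P.
Proof.
move=> hP; have [hI P1 _] := hP.
have [P' [L [hP' hL PL L1 [P'L h]]]] := exists_primitive (two_sided_left hI) P1.
rewrite -(maximal_ideal_eq hP (primitive_ideal hP') (h _ hI PL)) //.
exact: primitive_not1.
Qed.

End LeftIdeals.

Definition uncountable (T : Type) : Prop := forall g : T -> nat, ~ injective g.

(** Nested intervals: step [n] passes to a subinterval that misses the point numbered [n], and the
    supremum of the left endpoints lies in all of them. *)
Lemma realType_uncountable (R : realType) : uncountable R.
Proof.
move=> g ginj; pose x n : R := xget 0 [set r | g r = n].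
have xg r : x (g r) = r.
  by apply: ginj; apply: (@xgetPex _ 0 [set s | g s = g r]); exists r.
pose step (n : nat) (ab : R * R) := let m := (ab.1 + ab.2) / 2 in
  if x n <= m then ((m + ab.2) / 2, ab.2) else (ab.1, m).
pose I := fix I n := if n is n'.+1 then step n' (I n') else (0, 1).
have I_lt n : (I n).1 < (I n).2.
  elim: n => [|n IHn] /=; first exact: ltr01.
  by rewrite /step; case: ifP => _ /=; lra.
have I_step n : (I n).1 <= (I n.+1).1 /\ (I n.+1).2 <= (I n).2.
  by have := I_lt n; rewrite /= /step; case: ifP => _ /=; lra.
have I_mono m n : (m <= n)%N -> (I m).1 <= (I n).1 /\ (I n).2 <= (I m).2.
  elim: n => [|n IHn]; first by rewrite leqn0 => /eqP ->.
  rewrite leq_eqVlt => /orP[/eqP -> //|]; rewrite ltnS => /IHn[h1 h2].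
  by have [h3 h4] := I_step n; split; [apply: le_trans h3 | apply: le_trans h2].
have I_cross m n : (I m).1 <= (I n).2.
  have [mn|/ltnW nm] := leqP m n.
    by have [h _] := I_mono _ _ mn; apply: le_trans h (ltW (I_lt n)).
  by have [_ h] := I_mono _ _ nm; apply: le_trans (ltW (I_lt m)) h.
pose E := [set (I n).1 | n in [set: nat]].
have supE : has_sup E.
  split; first by exists (I 0%N).1, 0%N.
  by exists (I 0%N).2 => _ [n _ <-]; exact: I_cross.
have lo n : (I n).1 <= sup E by apply: sup_upper_bound => //; exists n.
have hi n : sup E <= (I n).2.
  by apply: ge_sup; [case: supE | move=> _ [m _ <-]; exact: I_cross].
have := lo (g (sup E)).+1; have := hi (g (sup E)).+1; have := I_lt (g (sup E)).
rewrite /= /step xg; case: ifP => /=; first by lra.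
by move=> /negbT; rewrite -ltNge; lra.
Qed.

(** Otherwise every fiber is finite, and the fiber together with the position in a list of it
    numbers the elements of [T]. *)
Lemma uncountable_fiber (T : eqType) (h : T -> nat) (N : nat -> nat) : uncountable T ->
  exists k s, [/\ uniq s, size s = N k & forall x, x \in s -> h x = k].
Proof.
move=> Tunc; apply: contrapT => noS.
have /choice[l hl] : forall k, exists l : seq T, forall x, h x = k -> x \in l.
  move=> k; apply: contrapT => nol; apply: noS; exists k.
  suff ex n : exists s, [/\ uniq s, size s = n & forall x, x \in s -> h x = k] by [].
  elim: n => [|n [s [us sn hs]]]; first by exists [::].
  have [x hx xs] : exists2 x, h x = k & x \notin s.
    apply: contrapT => hc; apply: nol; exists s => x hx.
    by apply: contrapT => /negP xs; apply: hc; exists x.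
  exists (x :: s); split; rewrite /= ?xs ?sn //.
  by move=> y; rewrite inE => /orP[/eqP -> //|/hs].
apply: (Tunc (fun x => pickle (h x, index x (l (h x))))) => x y.
move=> /(pcan_inj pickleK)[hxy]; rewrite hxy => e.
by rewrite -(nth_index x (hl _ x hxy)) e nth_index // hl.
Qed.

(** * Eigenvalues of central elements *)

Section CentralCharacters.
Variables (F : closedFieldType) (A : algType F) (B : nat -> A).
Hypothesis F_uncountable : uncountable F.
Hypothesis B_span : forall u, exists n (c : nat -> F), u = \sum_(i < n) c i *: B i.

(* Dixmier's argument: were every z - g invertible modulo L, its inverses would
   form an uncountable linearly independent family in a space of countable dimension. *)
Lemma central_eigenvalue (s z : A) (L : set A) : (forall u, s * u = u * s) ->
  (forall u, z * u = u * z) -> max_avoiding s L -> exists g : F, L (z - g%:A).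
Proof.
move=> sC zC [hL aL Lmax]; have [L0 LD LM] := hL; apply: contrapT => noL.
have {}noL g : ~ L (z - g%:A) by move=> h; apply: noL; exists g.
have zgC g u : (z - g%:A) * u = u * (z - g%:A).
  by rewrite mulrBl mulrBr zC -scalerAl -scalerAr mul1r mulr1.
have sXC k u : s ^+ k * u = u * s ^+ k.
  by elim: k => [|k IHk]; rewrite ?expr0 ?mul1r ?mulr1 // exprS -mulrA IHk mulrA sC mulrA.
(* The left ideal generated by [L] and [z - g] is strictly larger than [L], hence contains a power
   of [s]. *)
have inv g : exists ku : nat * A, L (s ^+ ku.1 - ku.2 * (z - g%:A)).
  pose L' := [set x | exists u, L (x - u * (z - g%:A))].
  have hL' : left_ideal L'.
    split; first by exists 0; rewrite mul0r subr0.
      by move=> x y [u hu] [v hv]; exists (u + v); rewrite mulrDl opprD addrACA; apply: LD.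
    by move=> a x [u hu]; exists (a * u); rewrite -mulrA -mulrBr; apply: LM.
  apply: contrapT => no; apply: (noL g); apply: (Lmax L' hL').
  - by move=> x Lx; exists 0; rewrite mul0r subr0.
  - by move=> k [u hu]; apply: no; exists (k, u).
  - by exists 1; rewrite mul1r subrr.
(* Cancellation of [z - g] modulo [L], again by maximality: if the left ideal of all such [y]
   contained [s^m], then [L] would contain [s^(m + k)]. *)
have prime_zg g y : L (y * (z - g%:A)) -> L y.
  pose L' := [set y | L (y * (z - g%:A))].
  have hL' : left_ideal L'.
    split; first by rewrite /L' /= mul0r.
      by move=> u v hu hv; rewrite /L' /= mulrDl; apply: LD.
    by move=> a u hu; rewrite /L' /= -mulrA; apply: LM.
  apply: (Lmax L' hL').
  - by move=> x Lx; rewrite /L' /= -zgC; apply: LM.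
  - move=> m hm; have [[k u] /= hu] := inv g; apply: (aL (m + k)%N).
    have -> : s ^+ (m + k) = s ^+ m * (s ^+ k - u * (z - g%:A)) + u * (s ^+ m * (z - g%:A)).
      move: (z - g%:A) => y'.
      by rewrite mulrBr exprD [s ^+ m * (u * y')]mulrA (sXC m u) -[u * s ^+ m * y']mulrA subrK.
    by apply: LD; apply: LM.
have prime_poly (p : {poly F}) y : p != 0 -> L (y * horner_alg z p) -> L y.
  have [rs pE] := closed_field_poly_normal p.
  rewrite pE scaler_eq0 negb_or linearZ /= => /andP[c0 _].
  rewrite mulr_algl -scalerAr => h.
  have {h} : L (y * horner_alg z (\prod_(r <- rs) ('X - r%:P))).
    have := LM (lead_coef p)^-1%:A _ h; rewrite mulr_algl scalerA mulVf ?scale1r //.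
  elim: rs {pE} y => [|r rs IHrs] y; first by rewrite big_nil rmorph1 mulr1.
  rewrite big_cons rmorphM mulrA => /IHrs.
  by rewrite rmorphB /= horner_algX horner_algC; exact: prime_zg.
have /choice[ku hku] := inv.
have /choice[n] : forall g, exists n (c : nat -> F), (ku g).2 = \sum_(i < n) c i *: B i.
  by move=> g; exact: B_span.
move=> /choice[c hc].
pose code g := pickle ((ku g).1, n g).
(* Some code [(k, m)] is shared by [m + 1] distinct scalars, whose inverses lie in the span of the
   first [m] vectors and are therefore dependent. The default size 1 makes the fiber nonempty, so
   that [k0] really encodes a pair. *)
have [k0 [rs [urs rsN hrs]]] := @uncountable_fiber F code
  (fun k => if (unpickle k : option (nat * nat)) is Some km then km.2.+1 else 1%N) F_uncountable.
have [k [m k0E]] : exists k m : nat, k0 = pickle (k, m).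
  case: rs rsN hrs {urs} => [|r rs'] hsz hrs; last first.
    by exists (ku r).1, (n r); rewrite -(hrs r) ?mem_head.
  by move: hsz; case: (unpickle _).
rewrite k0E pickleK in rsN.
have hk g : g \in rs -> (ku g).1 = k /\ n g = m.
  by move=> /hrs; rewrite k0E => /(pcan_inj pickleK) [-> ->].
pose M := \matrix_(i < m.+1, j < m) c rs`_i j.
have [v v0 vM] : exists2 v : 'rV_m.+1, v != 0 & v *m M = 0.
  have : kermx M != 0.
    by rewrite kermx_eq0 /row_free neq_ltn (leq_ltn_trans (rank_leq_col M)).
  by move=> /rowV0Pn[v /sub_kermxP vM v0]; exists v.
pose u (i : 'I_m.+1) := (ku rs`_i).2.
have hi (i : 'I_m.+1) : rs`_i \in rs by rewrite mem_nth // rsN.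
have sum0 : \sum_i v 0 i *: u i = 0.
  have uE i : u i = \sum_(j < m) M i j *: B j.
    rewrite /u hc; have [_ ->] := hk _ (hi i).
    by apply: eq_bigr => j _; rewrite mxE.
  under eq_bigr do rewrite uE scaler_sumr.
  rewrite exchange_big /= big1 // => j _.
  have := congr1 (fun w : 'rV_m => w 0 j) vM; rewrite !mxE => h.
  by rewrite -[RHS](scale0r (B j)) -h scaler_suml; apply: eq_bigr => i _; rewrite scalerA.
(* Clearing denominators in the dependence [sum0]. As in Lagrange interpolation, [e i] vanishes at
   all the scalars but the one of index [i], so [p] is nonzero. *)
pose e (i : 'I_m.+1) : {poly F} := \prod_(j | j != i) ('X - (rs`_j)%:P).
pose p := \sum_i v 0 i *: e i.
have p0 : p != 0.
  have [i vi] : exists i, v 0 i != 0 by apply/rV0Pn.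
  apply: contraNneq vi => /(congr1 (fun r : {poly F} => r.[rs`_i])).
  rewrite horner_sum horner0 (bigD1 i) //= big1 ?addr0 => [|j ji]; last first.
    rewrite hornerZ /e (bigD1 i) ?(eq_sym i) //= hornerM hornerXsubC subrr mul0r mulr0 //.
  rewrite hornerZ => /eqP; rewrite mulf_eq0 => /orP[//|].
  rewrite /e horner_prod prodf_seq_eq0 => /hasP[j _ /andP[ji]].
  rewrite hornerXsubC subr_eq0 nth_uniq ?rsN // => /eqP ij.
  by move: ji; rewrite -val_eqE /= ij eqxx.
apply: (aL k); apply: (prime_poly p) => //.
(* Every summand on the right lies in [L]; the terms in [u i] add up to the full product of the
   linear factors times [sum0], which is zero. *)
have -> : s ^+ k * horner_alg z p =
   \sum_i (v 0 i *: horner_alg z (e i)) * (s ^+ k - u i * (z - (rs`_i)%:A)).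
  under [RHS]eq_bigr do rewrite mulrBr.
  rewrite sumrB [X in _ - X](_ : _ = 0) ?subr0.
    rewrite /p rmorph_sum /= mulr_sumr; apply: eq_bigr => i _.
    by rewrite sXC linearZ /= mulr_algl.
  transitivity (horner_alg z (\prod_(i < m.+1) ('X - (rs`_i)%:P)) * \sum_i v 0 i *: u i).
    rewrite mulr_sumr; apply: eq_bigr => i _.
    rewrite [in RHS](bigD1 i) //= -/(e i) mulrC rmorphM /= rmorphB /= horner_algX horner_algC.
    by rewrite -!scalerAl -!scalerAr -!mulrA -zgC.
  by rewrite sum0 mulr0.
have sumL (I : Type) (r : seq I) (G : I -> A) : (forall i, L (G i)) -> L (\sum_(i <- r) G i).
  by move=> h; elim/big_rec: _ => // i x _ Lx; apply: LD.
apply: sumL => i; apply: LM; have := hku rs`_i.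
by have [-> _] := hk _ (hi i).
Qed.

End CentralCharacters.

Section CountableSpan.
Variables (K : fieldType) (q : K).

Definition Uq_enum (i : nat) : UqB2 q := if unpickle i is Some w then Uq_word q w else 0.

Lemma Uq_enum_span (u : UqB2 q) : exists n (c : nat -> K), u = \sum_(i < n) c i *: Uq_enum i.
Proof.
have [l ->] := Uq_decomp u; elim: l => [|[t w] l [n [c IHl]]].
  by exists 0%N, (fun=> 0); rewrite big_nil big_ord0.
pose m := maxn n (pickle w).+1.
exists m, (fun i => t *+ (i == pickle w) + (if (i < n)%N then c i else 0)).
rewrite big_cons IHl; under [RHS]eq_bigr do rewrite scalerDl.
rewrite big_split /=; congr (_ + _).
  have wm : (pickle w < m)%N by rewrite leq_maxr.
  rewrite (bigD1 (Ordinal wm)) //= eqxx mulr1n big1 ?addr0 => [|i].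
    by rewrite /Uq_enum pickleK.
  by rewrite -val_eqE /= => /negPf ->; rewrite scale0r.
rewrite (big_ord_widen_cond m (fun=> true) (fun i => c i *: Uq_enum i)) ?leq_maxl //.
rewrite big_mkcond; apply: eq_bigr => i _ /=.
by case: ltnP => _ //=; rewrite scale0r.
Qed.

End CountableSpan.

(** * One-dimensional representations *)

Section Characters.
Variables (K : fieldType) (q : K).
Hypotheses (q0 : q != 0).
Local Notation U := (UqB2 q).

Definition pch (al be : K) : set U := ideal_gen [set e1 q - al%:A; e2 q - be%:A].

Lemma pch_ideal al be : two_sided_ideal (pch al be).
Proof. exact: ideal_gen_ideal. Qed.

Lemma pch_gens al be : pch al be (e1 q - al%:A) /\ pch al be (e2 q - be%:A).
Proof. by split; apply: ideal_gen_sub; [left | right]. Qed.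

Lemma scalar_mod (I : set U) al be : two_sided_ideal I ->
  I (e1 q - al%:A) -> I (e2 q - be%:A) -> forall u, exists c : K, I (u - c%:A).
Proof.
move=> hI h1 h2; apply: Uq_ind => [c u v [a ha] [b hb]||u [a ha]|u [a ha]].
- exists (c * a + b); have -> : c *: u + v - (c * a + b)%:A = c *: (u - a%:A) + (v - b%:A) by nc K.
  by apply: (idealD hI) => //; apply: (idealZ _ hI).
- by exists 1; rewrite scale1r subrr; exact: ideal0 hI.
- exists (al * a); have -> : e1 q * u - (al * a)%:A = (e1 q - al%:A) * u + al *: (u - a%:A) by nc K.
  by apply: (idealD hI); [exact: idealMr hI h1 | exact: idealZ hI ha].
- exists (be * a); have -> : e2 q * u - (be * a)%:A = (e2 q - be%:A) * u + be *: (u - a%:A) by nc K.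
  by apply: (idealD hI); [exact: idealMr hI h2 | exact: idealZ hI ha].
Qed.

(** In a commutative algebra the second Serre expression is identically zero and the first is a
    multiple of [x y]. *)
Lemma commutative_lift (S : comAlgType K) (x y : S) : x * y = 0 ->
  exists f : {lrmorphism U -> S}, f (e1 q) = x /\ f (e2 q) = y.
Proof.
move=> xy; apply: Uq_lift.
  have -> : serre1 q x y = x * y * (x + x - (q ^+ 2 + q ^- 2)%:A * x).
    by rewrite /serre1 -[_ *: (x * y * x)]mulr_algl; ring.
  by rewrite xy mul0r.
by rewrite /serre2 -[_ *: (y ^+ 2 * x * y)]mulr_algl -[_ *: (y * x * y ^+ 2)]mulr_algl; ring.
Qed.

Lemma pch_not1 al be : al * be = 0 -> ~ pch al be 1.
Proof.
move=> ab; have [f [f1 f2]] := @commutative_lift (K^o : comAlgType K) al be ab.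
suff sub : pch al be `<=` [set u | f u = 0].
  by move=> /sub /= /eqP; rewrite rmorph1 oner_eq0.
apply: ideal_gen_min; first exact: kernel_ideal.
move=> _ [->|->] /=; rewrite rmorphB /= rmorph_alg ?f1 ?f2.
  by rewrite -[al%:A]mulr_algl mulr1 /GRing.scale /= !mulr1 subrr.
by rewrite /GRing.scale /= mulr1 subrr.
Qed.

Lemma pch_maximal al be : al * be = 0 -> maximal_ideal (pch al be).
Proof.
move=> ab; have hI := pch_ideal al be; have [g1 g2] := pch_gens al be.
split=> //; first exact: pch_not1.
move=> J u hJ IJ Ju Pu; have [c hc] := scalar_mod hI g1 g2 u.
have c0 : c != 0.
  by apply/eqP => c0; apply: Pu; rewrite c0 scale0r subr0 in hc.
apply: (ideal_scale hJ c0); have -> : c%:A = u - (u - c%:A) by rewrite subKr.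
by apply: (idealB hJ) => //; apply: IJ.
Qed.

End Characters.

Arguments pch {K} q al be _.

Section QuantumPlaneIdeals.
Variables (K : fieldType) (q : K).
Hypotheses (q0 : q != 0) (qn : forall n : nat, (0 < n)%N -> q ^+ n != 1).
Local Notation Q := (q ^+ 2).
Local Notation U := (UqB2 q).

Lemma plane_e3 : plane q (-1) = ideal_gen [set e3 q].
Proof. by rewrite /plane opprK expr1z. Qed.

Lemma plane_e3bar : plane q 1 = ideal_gen [set e3bar q].
Proof. by rewrite /plane exprN1. Qed.

Section OnePlane.
Variable l : int.
Hypothesis hl : (l == 1) || (l == -1).

Lemma plane_z : plane q l (z q) /\ plane q l (z' q).
Proof.
have [f fp] := plane_rep q0 hl; have [f1 f2] := fp.
have Q0 : Q != 0 by exact: expf_neq0.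
have xy : f (e1 q) * f (e2 q) = Q ^ (- l) *: (f (e2 q) * f (e1 q)).
  rewrite f1 f2 (@lijM _ _ q0 1 0 (-1) l 0 l (- l)) ?mul1r ?add0r //.
  by rewrite (@lijM _ _ q0 (-1) l 1 0 0 l 0) ?expr0z ?scale1r ?addr0.
have f3 : f (e3 q) = (Q ^ (- l) - Q) *: (f (e2 q) * f (e1 q)).
  by rewrite /e3 rmorphB /= linearZ /= !rmorphM /= xy scalerBl.
have fb : f (e3bar q) = (Q ^ (- l) - Q^-1) *: (f (e2 q) * f (e1 q)).
  by rewrite /e3bar rmorphB /= linearZ /= !rmorphM /= xy scalerBl.
have fz : f (z q) = 0.
  rewrite /z rmorphB /= linearZ /= !rmorphM /= f3 -!scalerAl -scalerAr -[f (e2 q) * f (e1 q) * f (e2 q)]mulrA xy.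
  rewrite -scalerAr !scalerA -scalerBl.
  rewrite [X in X *: _](_ : _ = 0) ?scale0r //.
  by case/orP: hl => /eqP ->; rewrite ?exprN1 ?opprK ?expr1z; field.
rewrite (plane_ker q0 hl fp); split; first exact: fz.
rewrite /z' /= linearZ /= rmorphD /= linearZ /= !rmorphM /= fz mul0r scaler0 addr0 f3 fb.
rewrite -scalerAl -scalerAr !scalerA.
rewrite [X in X *: _](_ : _ = 0) ?scale0r //.
by case/orP: hl => /eqP ->; rewrite ?exprN1 ?opprK ?expr1z ?subrr ?(mulr0, mul0r).
Qed.

(** The primitive ideal [P] attached to a maximal left ideal [L] containing both the plane ideal and
    [e1 e2 - 1]: were [P] larger than the plane ideal, it would contain [e1] or [e2], hence [e1 e2],
    and [L] would contain 1. *)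
Lemma plane_primitive : left_primitive (plane q l).
Proof.
have Q0 : Q != 0 by exact: expf_neq0.
have [f fp] := plane_rep q0 hl; have [f1 f2] := fp.
(* A vector fixed by [e1 e2], which acts as [Q ^ (- l) *: lij q 0 l]. *)
pose v (r : int * int) : K := (r.1 == 0)%:R * Q ^ (- r.2).
pose L0 := [set u : U | f u v = fun=> 0].
have f0 (g : zend K) : g (fun=> 0) = fun=> 0.
  have := zend_lin g (-1) (fun=> 0) (fun=> 0).
  under [X in g X]eq_fun do rewrite mulr0 addr0.
  by move=> ->; apply/funext => r; rewrite mulN1r addNr.
have hL0 : left_ideal L0.
  split; rewrite /L0 /=; first by rewrite rmorph0.
    by move=> x y hx hy; apply/funext => r; rewrite rmorphD zendD hx hy addr0.
  by move=> a x hx; rewrite rmorphM zendM hx f0.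
have L01 : ~ L0 1.
  rewrite /L0 /= rmorph1 => /(congr1 (fun w => w (0, 0))) /= /eqP.
  by rewrite /v /= ?eqxx oppr0 expr0z mulr1 oner_eq0.
have e12 : L0 (e1 q * e2 q - 1).
  rewrite /L0 /=; apply/funext => -[m n].
  have -> : f (e1 q * e2 q - 1) = f (e1 q) * f (e2 q) + (-1) *: 1.
    by rewrite rmorphB rmorphM rmorph1 scaleN1r.
  rewrite zendD zendZ f1 f2.
  rewrite (@lijM _ _ q0 1 0 (-1) l 0 l (- l)) ?mul1r ?add0r // zendZ lijE /v /= subr0.
  case: eqP => [->|_]; last by rewrite !(mul0r, mulr0) addr0.
  by rewrite mul0r expr0z !mul1r -expfzDr // opprB addrA addNr add0r mulN1r subrr.
have [P [L [hP hL L0L L1 [PL h]]]] := exists_primitive hL0 L01.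
have PlP : plane q l `<=` P.
  apply: h; first exact: plane_ideal.
  by move=> u; rewrite (plane_ker q0 hl fp) => fu; apply: L0L; rewrite /L0 /= fu.
suff <- : P = plane q l by [].
apply: contrapT => ne; have [hP' _ _] := primitive_prime hP.
have P12 : P (e1 q * e2 q).
  have [h1|h2] := plane_prime_above q0 qn hl (primitive_prime hP) PlP ne.
    exact: idealMr hP' h1.
  exact: idealMl hP' h2.
apply: L1; have := left_idealB hL (PL _ P12) (L0L _ e12).
by rewrite subKr.
Qed.

End OnePlane.
End QuantumPlaneIdeals.

(** * The list of primitive ideals *)

Section Classification.
Variables (K : closedFieldType) (q : K).
Hypotheses (q0 : q != 0) (qn : forall n : nat, (0 < n)%N -> q ^+ n != 1).
Hypothesis K_uncountable : uncountable K.
Local Notation U := (UqB2 q).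

Lemma max_avoiding_central s (zeta : U) L : (forall u, s * u = u * s) ->
  (forall u, zeta * u = u * zeta) -> max_avoiding s L -> exists g : K, L (zeta - g%:A).
Proof.
move=> sC zC hL; exact: (central_eigenvalue K_uncountable (@Uq_enum_span K q) sC zC hL).
Qed.

(** [J] is the sum of [I] and the multiples of [zeta]; centrality makes it two-sided and keeps it
    inside [L]. *)
Lemma left_ideal_central (L : set U) (zeta : U) : left_ideal L -> (forall u, zeta * u = u * zeta) ->
  L zeta -> forall I : set U, two_sided_ideal I -> I `<=` L ->
  exists J : set U, [/\ two_sided_ideal J, J `<=` L, I `<=` J & J zeta].
Proof.
move=> [L0 LD LM] zC Lz I hI IL; have hJ : two_sided_ideal [set x | exists u, x = u * zeta].
  split; first by exists 0; rewrite mul0r.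
    by move=> _ _ [u ->] [v ->]; exists (u + v); rewrite mulrDl.
  by move=> a _ b [u ->]; exists (a * u * b); rewrite -!mulrA zC.
exists [set x | exists i j, [/\ I i, (exists u, j = u * zeta) & x = i + j]]; split.
- exact: ideal_plus hI hJ.
- by move=> _ [i [j [Ii [u ->] ->]]]; apply: LD; [apply: IL | apply: LM].
- by move=> i Ii; exists i, 0; split; rewrite ?addr0 //; exists 0; rewrite mul0r.
- exists 0, zeta; split; rewrite ?add0r //; first exact: ideal0 hI.
  by exists 1; rewrite mul1r.
Qed.

Lemma primitive_central (P : set U) (zeta : U) : left_primitive P ->
  (forall u, zeta * u = u * zeta) -> exists g : K, P (zeta - g%:A).
Proof.
move=> hP zC; have [L hL [PL h]] := primitive_left hP.
have [|g Lg] := @max_avoiding_central 1 zeta L _ zC hL.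
  by move=> u; rewrite mulr1 mul1r.
have zgC u : (zeta - g%:A) * u = u * (zeta - g%:A).
  by rewrite mulrBl mulrBr zC -scalerAl -scalerAr mul1r mulr1.
have [hL' _ _] := hL.
have [J [hJ JL PJ Jz]] := left_ideal_central hL' zgC Lg (primitive_ideal hP) PL.
by exists g; apply: h hJ JL _ Jz.
Qed.

Lemma prime_poly_root (P : set U) (x : U) (r : {poly K}) : prime_ideal P ->
  (forall v, P (x * v - v * x)) -> r != 0 -> P (horner_alg x r) -> exists g : K, P (x - g%:A).
Proof.
move=> hP xC r0 Pr; have [hI PT _] := hP.
have [rs rE] := closed_field_poly_normal r.
have {}Pr : P (horner_alg x (\prod_(g <- rs) ('X - g%:P))).
  apply: (@ideal_scale _ _ _ (lead_coef r)) => //; first by rewrite lead_coef_eq0.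
  by move: Pr; rewrite {1}rE linearZ /= mulr_algl.
elim: rs Pr {rE} => [|g rs IHrs].
  by rewrite big_nil rmorph1 => /(ideal_setT hI).
rewrite big_cons rmorphM /= rmorphB /= horner_algX horner_algC => Pg.
have [|//|/IHrs//] := prime_normal hP _ Pg; last by move=> Pxg; exists g.
move=> v; exists v; have -> : (x - g%:A) * v - v * (x - g%:A) = x * v - v * x by nc K.
exact: xC.
Qed.

(** The quotient is commutative, so [L] is two-sided and contained in [P]: the quotient is a field
    generated by one element over an algebraically closed field. *)
Lemma primitive_polynomial (P : set U) (x : U) : left_primitive P ->
  (forall u, exists p, P (u - horner_alg x p)) -> exists g : K, P (x - g%:A).
Proof.
move=> hP hx; have hI := primitive_ideal hP; have [L hL [PL h]] := primitive_left hP.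
have Pcomm u v : P (u * v - v * u).
  have [p hp] := hx u; have [r hr] := hx v.
  have prC : horner_alg x p * horner_alg x r = horner_alg x r * horner_alg x p.
    by rewrite -!rmorphM mulrC.
  have -> : u * v - v * u = (u - horner_alg x p) * v + horner_alg x p * (v - horner_alg x r)
      - (v - horner_alg x r) * u - horner_alg x r * (u - horner_alg x p)
      + (horner_alg x p * horner_alg x r - horner_alg x r * horner_alg x p).
    by move: (horner_alg x p) (horner_alg x r) => X Y; nc K.
  rewrite prC subrr addr0.
  exact: (idealB hI (idealB hI (idealD hI (idealMr _ hI hp) (idealMl _ hI hr))
    (idealMr _ hI hr)) (idealMl _ hI hp)).
have [hL' aL Lmax] := hL; have [L0 LD LM] := hL'.
have L2 : two_sided_ideal L.
  split=> // a y b Ly; rewrite -mulrA; apply: (LM).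
  by rewrite -(subrK (b * y) (y * b)); apply: LD; [apply: PL | apply: LM].
have LP : L `<=` P by exact: h.
have [Px|Px] := pselect (P x); first by exists 0; rewrite scale0r subr0.
have [u Pu] : exists u, P (1 - u * x).
  apply: contrapT => no; pose L' := [set y | exists u, L (y - u * x)].
  have hL2 : left_ideal L'.
    split; first by exists 0; rewrite mul0r subr0.
      by move=> y y' [u hu] [v hv]; exists (u + v); rewrite mulrDl opprD addrACA; apply: LD.
    by move=> a y [u hu]; exists (a * u); rewrite -mulrA -mulrBr; apply: LM.
  apply/Px/LP; apply: (Lmax L' hL2); last by exists 1; rewrite mul1r subrr.
    by move=> y Ly; exists 0; rewrite mul0r subr0.
  by move=> k [u]; rewrite expr1n => /LP hu; apply: no; exists u.
(* The inverse of [x] being a polynomial in [x], [x] is a root of [r] modulo [P]; [r] is nonzero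
   since its value at 0 is 1. *)
have [p hp] := hx u; pose r := 1 - p * 'X.
have Pr : P (horner_alg x r).
  rewrite /r rmorphB rmorph1 rmorphM /= horner_algX.
  have -> : 1 - horner_alg x p * x = 1 - u * x + (u - horner_alg x p) * x.
    by move: (horner_alg x p) => X; nc K.
  by apply: (idealD hI) => //; apply: (idealMr _ hI).
have r0 : r != 0.
  apply/eqP => /(congr1 (fun s : {poly K} => s.[0])).
  by rewrite hornerD hornerN hornerM hornerX mulr0 hornerC horner0 subr0 => /eqP; rewrite oner_eq0.
apply: (prime_poly_root (primitive_prime hP) _ r0 Pr) => v; exact: Pcomm.
Qed.

Lemma e3_normal (P : set U) : two_sided_ideal P -> P (z q) ->
  forall u, exists v, P (e3 q * u - v * e3 q).
Proof.
move=> hP Pz; apply: (gens_normal (c1 := q ^+ 2) (c2 := q ^- 2) hP).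
  by rewrite (e1e3 q0) scalerA divff ?expf_neq0 // scale1r subrr; exact: ideal0.
have -> : e3 q * e2 q - q ^- 2 *: (e2 q * e3 q) = - q ^- 2 *: z q.
  by rewrite e2e3; move: (e3 q) (z q) => X Z; nc_coefs K; field.
exact: idealZ.
Qed.

Lemma prime_e3_e3bar (P : set U) : prime_ideal P -> P (z q) -> P (z' q) ->
  P (e3 q) \/ P (e3bar q).
Proof.
move=> hP Pz Pz'; have [hI _ _] := hP; apply: (prime_normal hP (e3_normal hI Pz)).
have c0 : 1 - q ^- 2 != 0 by rewrite subr_eq0 eq_sym invr_eq1 qn.
have {Pz'} : P (e3 q * e3bar q + (1 + q ^- 2) *: (z q * e1 q)) by apply: (ideal_scale hI c0).
move=> h; rewrite -(addrK ((1 + q ^- 2) *: (z q * e1 q)) (e3 q * e3bar q)).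
by apply: (idealB hI h); apply: (idealZ _ hI); apply: (idealMr _ hI).
Qed.

Definition gen (b : bool) : U := if b then e1 q else e2 q.

Lemma mod_gen b (P : set U) : two_sided_ideal P -> P (gen b) ->
  forall u, exists p, P (u - horner_alg (gen (~~ b)) p).
Proof.
move=> hP Pb; have step d u p : P (u - horner_alg (gen (~~ b)) p) ->
    exists p', P (gen d * u - horner_alg (gen (~~ b)) p').
  move=> hu; have [->|] := eqVneq d b.
    by exists 0; rewrite rmorph0 subr0; exact: idealMr.
  move=> db; have -> : d = ~~ b by case: (d) (b) db => [] [].
  exists ('X * p); rewrite rmorphM /= horner_algX -mulrBr.
  exact: idealMl.
apply: Uq_ind => [c u v [p hp] [r hr]||u [p hp]|u [p hp]].
- exists (c *: p + r); rewrite rmorphD /= linearZ /= mulr_algl.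
  move: (horner_alg _ p) (horner_alg _ r) hp hr => X Y hp hr.
  have -> : c *: u + v - (c *: X + Y) = c *: (u - X) + (v - Y) by nc K.
  exact: (idealD hP (idealZ _ hP hp) hr).
- by exists 1; rewrite rmorph1 subrr; exact: ideal0.
- exact: (step true _ _ hp).
- exact: (step false _ _ hp).
Qed.

Lemma above_pch (P : set U) al be : al * be = 0 -> prime_ideal P ->
  P (e1 q - al%:A) -> P (e2 q - be%:A) -> P = pch q al be.
Proof.
move=> ab [hP PT _] h1 h2; apply: maximal_ideal_eq => //; first exact: pch_maximal.
  by apply: ideal_gen_min => // _ [->|->].
by move=> P1; apply: PT; apply: ideal_setT.
Qed.

Lemma above_pab (P : set U) a b : (a != 0) || (b != 0) -> prime_ideal P ->
  P (z q - a%:A) -> P (z' q - b%:A) -> P = pab q a b.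
Proof.
move=> ab [hP PT _] h1 h2; apply: maximal_ideal_eq => //; first exact: pab_maximal.
  by apply: ideal_gen_min => // _ [->|->].
by move=> P1; apply: PT; apply: ideal_setT.
Qed.

Lemma primitive_cases (P : set U) : left_primitive P ->
  [\/ exists a b, (a != 0) || (b != 0) /\ P = pab q a b,
      P = ideal_gen [set e3 q], P = ideal_gen [set e3bar q] |
      exists al be, al * be = 0 /\ P = pch q al be].
Proof.
move=> hP; have Pp := primitive_prime hP; have [hI PT _] := Pp.
have [a ha] := primitive_central hP (z_central q0).
have [b hb] := primitive_central hP (z'_central q0).
have [ab|/norP[]] := boolP ((a != 0) || (b != 0)).
  by constructor 1; exists a, b; split=> //; apply: above_pab.
rewrite !negbK => /eqP a0 /eqP b0; rewrite a0 scale0r subr0 in ha; rewrite b0 scale0r subr0 in hb.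
have chars : P (e1 q) \/ P (e2 q) -> exists al be, al * be = 0 /\ P = pch q al be.
  case=> [P1|P2].
    have [be hbe] := primitive_polynomial hP (@mod_gen true _ hI P1).
    exists 0, be; rewrite mul0r; split=> //; apply: above_pch; rewrite ?mul0r //.
    by rewrite scale0r subr0.
  have [al hal] := primitive_polynomial hP (@mod_gen false _ hI P2).
  exists al, 0; rewrite mulr0; split=> //; apply: above_pch; rewrite ?mulr0 //.
  by rewrite scale0r subr0.
have dichotomy l : (l == 1) || (l == -1) -> plane q l `<=` P ->
    P = plane q l \/ exists al be, al * be = 0 /\ P = pch q al be.
  move=> hl PlP; have [|ne] := pselect (P = plane q l); first by left.
  by right; apply/chars/(plane_prime_above q0 qn hl Pp PlP ne).
have [P3|P3] := prime_e3_e3bar Pp ha hb.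
  have [||->|] := dichotomy (-1); rewrite ?plane_e3 //; last by constructor 4.
    by apply: ideal_gen_min => // _ ->.
  by constructor 2.
have [||->|] := dichotomy 1; rewrite ?plane_e3bar //; last by constructor 4.
  by apply: ideal_gen_min => // _ ->.
by constructor 3.
Qed.

End Classification.

(** * Strata *)

Section Twist.
Variables (K : fieldType) (S : algType K).

Lemma lrmorphism_inverse (phi : {lrmorphism S -> S}) : bijective phi ->
  exists psi : {lrmorphism S -> S}, cancel phi psi /\ cancel psi phi.
Proof.
case=> g phiK gK.
have gB : zmod_morphism g.
  by move=> u v; apply: (can_inj phiK); rewrite rmorphB /= !gK.
have gM : monoid_morphism g.
  split=> [|u v]; apply: (can_inj phiK); first by rewrite gK rmorph1.
  by rewrite rmorphM /= !gK.
have gZ : scalable g.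
  by move=> c u; apply: (can_inj phiK); rewrite linearZ /= !gK.
pose f : {lrmorphism S -> S} := HB.pack g
  (GRing.isZmodMorphism.Build S S g gB) (GRing.isMonoidMorphism.Build S S g gM)
  (GRing.isScalable.Build K S S _ g gZ).
by exists f.
Qed.

Variables (phi psi : {lrmorphism S -> S}).
Hypotheses (phiK : cancel phi psi) (psiK : cancel psi phi).

Lemma imageE (P : set S) : phi @` P = [set u | P (psi u)].
Proof.
apply/seteqP; split=> [_ [u Pu <-]|u Pu] /=; first by rewrite phiK.
by exists (psi u).
Qed.

Lemma twist_ideal (P : set S) : two_sided_ideal P -> two_sided_ideal [set u | P (psi u)].
Proof.
move=> hP; split=> /= [|x y hx hy|a x b hx]; first by rewrite rmorph0; exact: ideal0 hP.
  by rewrite rmorphD; apply: (idealD hP).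
by rewrite !rmorphM; case: hP => _ _; apply.
Qed.

Lemma twist_left (L : set S) : left_ideal L -> left_ideal [set u | L (psi u)].
Proof.
case=> L0 LD LM; split=> /= [|x y hx hy|a x hx]; first by rewrite rmorph0.
  by rewrite rmorphD; apply: LD.
by rewrite rmorphM; apply: LM.
Qed.

End Twist.

Section TwistPrime.
Variables (K : fieldType) (S : algType K) (phi psi : {lrmorphism S -> S}).
Hypotheses (phiK : cancel phi psi) (psiK : cancel psi phi).

Lemma twist_sub (I J : set S) : [set u | I (phi u)] `<=` J -> I `<=` [set u | J (psi u)].
Proof. by move=> h u Iu; apply: h; rewrite /= psiK. Qed.

Lemma twist_prime (P : set S) : prime_ideal P -> prime_ideal [set u | P (psi u)].
Proof.
move=> [hP PT Pp]; split; first exact: twist_ideal.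
  move=> h; apply: PT; apply/seteqP; split=> // u _.
  by have : [set v | P (psi v)] (phi u) by [rewrite h]; rewrite /= phiK.
move=> I J hI hJ IJ.
have [| |x y Ix Jy|h|h] := Pp [set u | I (phi u)] [set u | J (phi u)].
- exact: twist_ideal.
- exact: twist_ideal.
- by have := IJ _ _ Ix Jy; rewrite /= -rmorphM /= phiK.
- by left; apply: twist_sub.
- by right; apply: twist_sub.
Qed.

Lemma twist_maximal (P : set S) : maximal_ideal P -> maximal_ideal [set u | P (psi u)].
Proof.
move=> [hP P1 Pmax]; split; [exact: twist_ideal | by rewrite /= rmorph1|].
move=> J u hJ PJ Ju Pu.
have := Pmax [set v | J (phi v)] (psi u) (twist_ideal _ hJ); rewrite /= rmorph1; apply=> //.
  by move=> v Pv; apply: PJ; rewrite /= phiK.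
by rewrite psiK.
Qed.

End TwistPrime.

(** Replaces the module by a maximal left ideal, a form in which primitivity is easily carried along
    an automorphism. *)
Lemma primitiveP (R : nzRingType) (P : set R) : left_primitive P <->
  two_sided_ideal P /\ exists2 L, max_avoiding 1 L & P `<=` L /\
  (forall I : set R, two_sided_ideal I -> I `<=` L -> I `<=` P).
Proof.
split=> [hP|[hP [L [hL aL Lmax] [PL h]]]].
  by split; [exact: primitive_ideal | exact: primitive_left].
have L1 : ~ L 1 by have := aL 0%N; rewrite expr0.
have Lsimple : simple_module (lquot hL).
  apply: lquot_simple => // L' hL' LL' L'1; apply: Lmax => // k; by rewrite expr1n.
exists (lquot hL); split=> //; apply/seteqP; split.
  move=> a Pa u; rewrite -(lpiK u) lpi_scale -(lpi0 hL); apply/lpi_eq; rewrite subr0.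
  by apply: PL; apply: (idealMr _ hP).
apply: h; first by apply: primitive_ideal; exists (lquot hL).
move=> a /(_ (lpi hL 1)); rewrite lpi_scale mulr1 -(lpi0 hL) => /lpi_eq.
by rewrite subr0.
Qed.

Lemma twist_primitive (K : fieldType) (S : algType K) (phi psi : {lrmorphism S -> S}) (P : set S) :
  cancel phi psi -> cancel psi phi -> left_primitive P -> left_primitive [set u | P (psi u)].
Proof.
move=> phiK psiK /primitiveP[hP [L [hL aL Lmax] [PL h]]]; apply/primitiveP.
split; first exact: twist_ideal.
exists [set u | L (psi u)]; first split.
- exact: twist_left.
- by move=> k; rewrite expr1n /= rmorph1; have := aL 0%N; rewrite expr0.
- move=> L' hL' LL' aL'; apply: (twist_sub psiK); apply: Lmax; first exact: twist_left.
    by move=> u Lu; apply: LL'; rewrite /= phiK.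
  by move=> k; rewrite expr1n /= rmorph1; have := aL' 0%N; rewrite expr0.
split; first by move=> u; exact: PL.
move=> I hI IL; apply: (twist_sub psiK); apply: h; first exact: twist_ideal.
by move=> u Iu; have := IL _ Iu; rewrite /= phiK.
Qed.

Section Torus.
Variables (K : fieldType) (q : K).
Hypotheses (q0 : q != 0).
Local Notation U := (UqB2 q).
Local Notation tact h := (torus_act h : {lrmorphism U -> U}).

Lemma torus_act_e3 h : torus_act h (e3 q) = (h.1 * h.2) *: e3 q.
Proof.
rewrite /e3 rmorphB /= linearZ /= !rmorphM /= torus_act_e1 torus_act_e2.
by nc K.
Qed.

Lemma torus_act_e3bar h : torus_act h (e3bar q) = (h.1 * h.2) *: e3bar q.
Proof.
rewrite /e3bar rmorphB /= linearZ /= !rmorphM /= torus_act_e1 torus_act_e2.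
by nc K.
Qed.

Lemma torus_act_z h : torus_act h (z q) = (h.1 * h.2 ^+ 2) *: z q.
Proof.
rewrite /z rmorphB /= linearZ /= !rmorphM /= torus_act_e3 torus_act_e2.
by move: (e3 q) => X; nc K.
Qed.

Lemma torus_act_z' h : torus_act h (z' q) = (h.1 * h.2) ^+ 2 *: z' q.
Proof.
rewrite /z' linearZ /= rmorphD /= linearZ /= !rmorphM /= torus_act_e3 torus_act_e3bar torus_act_z torus_act_e1.
by move: (e3 q) (e3bar q) (z q) => X Y Z; nc K.
Qed.

Definition hinv (h : K * K) : K * K := (h.1^-1, h.2^-1).

Lemma torus_hinv h : torus h -> torus (hinv h).
Proof. by case=> h1 h2; split; rewrite /= invr_neq0. Qed.

Lemma torus_act1 : torus_act (1, 1) =1 @id U.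
Proof.
apply: (@Uq_hom_ext _ _ _ (tact (1, 1)) idfun); rewrite /= ?torus_act_e1 ?torus_act_e2.
  by rewrite scale1r.
by rewrite scale1r.
Qed.

Lemma torus_actK h : torus h -> cancel (torus_act h : U -> U) (torus_act (hinv h)).
Proof.
case=> h1 h2; apply: (@Uq_hom_ext _ _ _ (tact (hinv h) \o tact h) idfun) => /=.
  by rewrite torus_act_e1 linearZ /= torus_act_e1 scalerA mulfV // scale1r.
by rewrite torus_act_e2 linearZ /= torus_act_e2 scalerA mulfV // scale1r.
Qed.

Lemma hinvK : involutive hinv.
Proof. by case=> a b; rewrite /hinv /= !invrK. Qed.

Lemma torus_actVK h : torus h -> cancel (torus_act (hinv h) : U -> U) (torus_act h).
Proof. by move=> /torus_hinv/torus_actK; rewrite hinvK. Qed.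

Lemma torus_image h (P : set U) : torus h ->
  torus_act h @` P = [set u | P (torus_act (hinv h) u)].
Proof. by move=> th; apply: (@imageE _ _ (tact h) (tact (hinv h))); [exact: torus_actK | exact: torus_actVK]. Qed.

Lemma torus_cap (P : set U) : \bigcap_(h in @torus K) (torus_act h @` P) =
  [set u | forall h, torus h -> P (torus_act h u)].
Proof.
apply/seteqP; split=> u hu h th.
  by have := hu _ (torus_hinv th); rewrite torus_image ?hinvK //; exact: torus_hinv.
by rewrite torus_image //=; apply: hu; exact: torus_hinv.
Qed.

Lemma torus_twist_prime h (P : set U) : torus h -> prime_ideal P -> prime_ideal [set u | P (torus_act h u)].
Proof.
move=> th; apply: (@twist_prime _ _ (tact (hinv h)) (tact h)); [exact: torus_actVK | exact: torus_actK].
Qed.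

End Torus.

Section Families.
Variables (K : closedFieldType) (q : K).
Hypotheses (q0 : q != 0) (qn : forall n : nat, (0 < n)%N -> q ^+ n != 1).
Hypothesis K_uncountable : uncountable K.
Local Notation U := (UqB2 q).

(** Generators of the invariant primes, and below the explicit strata, numbered from 0 in the order
    of the eight orbits. *)
Definition hgens (i : nat) : set U :=
  match i with
  | 0 => [set 0] | 1 => [set z' q] | 2 => [set z q] | 3 => [set e3 q]
  | 4 => [set e3bar q] | 5 => [set e1 q] | 6 => [set e2 q] | _ => [set e1 q; e2 q]
  end.

Definition family (i : nat) : set (set U) :=
  match i with
  | 0 => [set P | exists a b : K, a != 0 /\ b != 0 /\
           P = ideal_gen [set z q - a%:A; z' q - b%:A]]
  | 1 => [set P | exists a : K, a != 0 /\ P = ideal_gen [set z q - a%:A; z' q]]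
  | 2 => [set P | exists b : K, b != 0 /\ P = ideal_gen [set z q; z' q - b%:A]]
  | 3 => [set ideal_gen [set e3 q]]
  | 4 => [set ideal_gen [set e3bar q]]
  | 5 => [set P | exists b : K, b != 0 /\ P = ideal_gen [set e1 q; e2 q - b%:A]]
  | 6 => [set P | exists a : K, a != 0 /\ P = ideal_gen [set e1 q - a%:A; e2 q]]
  | _ => [set ideal_gen [set e1 q; e2 q]]
  end.

(* The index of the family of a primitive ideal, read off from the generators
   it contains. *)
Definition code (P : set U) : nat :=
  if `[< P (z q) >] then
    if `[< P (z' q) >] then
      if `[< P (e3 q) >] then
        if `[< P (e1 q) >] then if `[< P (e2 q) >] then 7 else 5
        else if `[< P (e2 q) >] then 6 else 3
      else 4
    else 2
  else if `[< P (z' q) >] then 1 else 0.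

Lemma code_ext (P P' : set U) : (P (z q) <-> P' (z q)) -> (P (z' q) <-> P' (z' q)) ->
  (P (e3 q) <-> P' (e3 q)) -> (P (e1 q) <-> P' (e1 q)) -> (P (e2 q) <-> P' (e2 q)) ->
  code P = code P'.
Proof.
by move=> /asbool_equiv_eq h1 /asbool_equiv_eq h2 /asbool_equiv_eq h3
  /asbool_equiv_eq h4 /asbool_equiv_eq h5; rewrite /code h1 h2 h3 h4 h5.
Qed.

Lemma pab_a0 a : ideal_gen [set z q - a%:A; z' q] = pab q a 0.
Proof. by rewrite /pab scale0r subr0. Qed.

Lemma pab_0b b : ideal_gen [set z q; z' q - b%:A] = pab q 0 b.
Proof. by rewrite /pab scale0r subr0. Qed.

Lemma pch_0b b : ideal_gen [set e1 q; e2 q - b%:A] = pch q 0 b.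
Proof. by rewrite /pch scale0r subr0. Qed.

Lemma pch_a0 a : ideal_gen [set e1 q - a%:A; e2 q] = pch q a 0.
Proof. by rewrite /pch scale0r subr0. Qed.

Lemma pch_00 : ideal_gen [set e1 q; e2 q] = pch q 0 0.
Proof. by rewrite /pch scale0r !subr0. Qed.

Lemma pab_z a b : (a != 0) || (b != 0) -> pab q a b (z q) <-> a = 0.
Proof.
move=> ab; have [_ h2] := pab_gens q a b; split=> [h|->]; last exact: z_in_pab.
have [|//] := @pab_scalars _ _ q0 qn a b 0 b ab _ h2.
by rewrite scale0r subr0.
Qed.

Lemma pab_z' a b : (a != 0) || (b != 0) -> pab q a b (z' q) <-> b = 0.
Proof.
move=> ab; have [h1 _] := pab_gens q a b; split=> [h|->]; last exact: z'_in_pab.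
have [|//] := @pab_scalars _ _ q0 qn a b a 0 ab h1.
by rewrite scale0r subr0.
Qed.

Lemma pch_scalar al be (u : U) c d : al * be = 0 -> pch q al be (u - c%:A) ->
  pch q al be (u - d%:A) -> c = d.
Proof.
move=> ab hc hd; have hI := pch_ideal q al be; apply/eqP; rewrite -subr_eq0.
apply: contrapT => /negP cd; apply: (@pch_not1 _ q _ _ ab); apply: (ideal_scale hI cd).
have -> : (c - d)%:A = (u - d%:A) - (u - c%:A) by nc K.
exact: idealB hI hd hc.
Qed.

Lemma pch_e1 al be : al * be = 0 -> pch q al be (e1 q) <-> al = 0.
Proof.
move=> ab; have [h1 _] := pch_gens q al be; split=> [h|a0].
  by apply: (pch_scalar ab h1); rewrite scale0r subr0.
by rewrite a0 scale0r subr0 in h1; rewrite a0.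
Qed.

Lemma pch_e2 al be : al * be = 0 -> pch q al be (e2 q) <-> be = 0.
Proof.
move=> ab; have [_ h1] := pch_gens q al be; split=> [h|a0].
  by apply: (pch_scalar ab h1); rewrite scale0r subr0.
by rewrite a0 scale0r subr0 in h1; rewrite a0.
Qed.

Lemma pch_e3 al be : al * be = 0 ->
  [/\ pch q al be (e3 q), pch q al be (e3bar q), pch q al be (z q) & pch q al be (z' q)].
Proof.
move=> ab; have hI := pch_ideal q al be; have [h1 h2] := pch_gens q al be.
have aux c : pch q al be (e1 q * e2 q - c *: (e2 q * e1 q)).
  have -> : e1 q * e2 q - c *: (e2 q * e1 q) = (e1 q - al%:A) * e2 q + al *: (e2 q - be%:A)
    - c *: ((e2 q - be%:A) * e1 q) - (c * be) *: (e1 q - al%:A) + ((1 - c) * (al * be)) *: 1.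
    by nc K.
  rewrite ab mulr0 scale0r addr0.
  exact: (idealB hI (idealB hI (idealD hI (idealMr _ hI h1) (idealZ _ hI h2))
    (idealZ _ hI (idealMr _ hI h2))) (idealZ _ hI h1)).
have H3 : pch q al be (e3 q) by exact: aux.
have Hb : pch q al be (e3bar q) by exact: aux.
have Hz : pch q al be (z q).
  exact: (idealB hI (idealMl _ hI H3) (idealZ _ hI (idealMr _ hI H3))).
split=> //; apply: (idealZ _ hI); apply: (idealD hI); first exact: idealMl hI Hb.
by apply: (idealZ _ hI); apply: (idealMr _ hI).
Qed.

Lemma plane_e1_e2 l : (l == 1) || (l == -1) -> ~ plane q l (e1 q) /\ ~ plane q l (e2 q).
Proof.
move=> hl; have [f fp] := plane_rep q0 hl; have [f1 f2] := fp.
rewrite (plane_ker q0 hl fp) /= f1 f2; split.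
  move=> /(congr1 (fun g : zend K => g (@dirac0 K) (1, 0))) /eqP.
  by rewrite lijE mulr0 expr0z mul1r /dirac0 !subrr eqxx oner_eq0.
move=> /(congr1 (fun g : zend K => g (@dirac0 K) (-1, l))) /eqP.
by rewrite lijE /dirac0 !subrr eqxx mulr1 expfz_eq0 expf_eq0 (negPf q0) !andbF.
Qed.

Lemma plane_e3bar_e3 : ~ ideal_gen [set e3bar q] (e3 q).
Proof.
have hl : ((1 : int) == 1) || ((1 : int) == -1) by [].
rewrite -plane_e3bar => h3; have hI := plane_ideal q 1.
have hb : plane q 1 (e3bar q) by rewrite plane_e3bar; apply: ideal_gen_sub.
have c0 : q ^- 2 - q ^+ 2 != 0.
  rewrite subr_eq0; apply: contra (qn (n := 4) isT) => /eqP h.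
  by rewrite (exprD q 2 2) -{1}h mulVf // expf_neq0.
have [f fp] := plane_rep q0 hl.
have : plane q 1 (e2 q ^+ 1 * e1 q ^+ 1).
  apply: (ideal_scale hI c0); have -> : (q ^- 2 - q ^+ 2) *: (e2 q ^+ 1 * e1 q ^+ 1) = e3 q - e3bar q.
    by rewrite /e3 /e3bar !expr1; nc K.
  exact: idealB hI h3 hb.
have [c cn0 fc] := plane_fmono q0 fp 1 1.
rewrite (plane_ker q0 hl fp) /= fc subrr mul1r.
move=> /(congr1 (fun g : zend K => g (@dirac0 K) (0, 1))) /eqP.
by rewrite zendZ lijE mul0r expr0z mul1r subr0 subrr /dirac0 eqxx mulr1 (negPf cn0).
Qed.

Lemma family_code i P : (i < 8)%N -> family i P -> left_primitive P /\ code P = i.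
Proof.
have Hab a b : (a != 0) || (b != 0) -> left_primitive (pab q a b).
  by move=> ab; apply: maximal_primitive; apply: pab_maximal.
have Hch al be : al * be = 0 -> left_primitive (pch q al be).
  by move=> ab; apply: maximal_primitive; apply: pch_maximal.
have asbF (A : Prop) : ~ A -> `[< A >] = false by move=> h; apply/asboolP.
have asbT (A : Prop) : A -> `[< A >] = true by move=> h; apply/asboolP.
have plF l (hl : (l == 1) || (l == -1)) : left_primitive (plane q l) by exact: plane_primitive.
have codech al be : al * be = 0 -> code (pch q al be) =
    (if (al == 0)%R then if (be == 0)%R then 7 else 5 else if (be == 0)%R then 6 else 3)%N.
  move=> ab; have [h3 hb hz hz'] := pch_e3 ab; rewrite /code (asbT _ hz) (asbT _ hz') (asbT _ h3).
  by rewrite (asbool_equiv_eqP eqP (pch_e1 ab)) (asbool_equiv_eqP eqP (pch_e2 ab)).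
have codeab a b : (a != 0) || (b != 0) -> code (pab q a b) =
    (if (a == 0)%R then 2 else if (b == 0)%R then 1 else 0)%N.
  move=> ab; rewrite /code (asbool_equiv_eqP eqP (pab_z ab)) (asbool_equiv_eqP eqP (pab_z' ab)).
  by move: ab; case: eqP => //=; case: eqP.
have [hl1 hl2] : (((1 : int) == 1) || ((1 : int) == -1)) /\ (((-1 : int) == 1) || ((-1 : int) == -1)) by [].
case: i => [|[|[|[|[|[|[|[|//]]]]]]]] _ /=.
- move=> [a [b [a0 [b0 ->]]]]; rewrite -/(pab q a b) codeab ?a0 // (negPf a0) (negPf b0).
  by split=> //; apply: Hab; rewrite a0.
- move=> [a [a0 ->]]; rewrite pab_a0 codeab ?a0 // (negPf a0) eqxx.
  by split=> //; apply: Hab; rewrite a0.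
- move=> [b [b0 ->]]; rewrite pab_0b codeab ?b0 ?orbT // eqxx.
  by split=> //; apply: Hab; rewrite b0 orbT.
- move=> ->; rewrite -plane_e3; split; first exact: plF.
  have [h1 h2] := plane_e1_e2 hl2; have [hz hz'] := plane_z q0 hl2.
  rewrite /code !(asbF _ h1) !(asbF _ h2) !asbT //.
  by rewrite plane_e3; apply: ideal_gen_sub.
- move=> ->; rewrite -plane_e3bar; split; first exact: plF.
  have [hz hz'] := plane_z q0 hl1.
  have h3 : ~ plane q 1 (e3 q) by rewrite plane_e3bar; exact: plane_e3bar_e3.
  by rewrite /code (asbF _ h3) !asbT.
- move=> [b [b0 ->]]; rewrite pch_0b codech ?mul0r // eqxx (negPf b0).
  by split=> //; apply: Hch; rewrite mul0r.
- move=> [a [a0 ->]]; rewrite pch_a0 codech ?mulr0 // eqxx (negPf a0).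
  by split=> //; apply: Hch; rewrite mulr0.
- move=> ->; rewrite pch_00 codech ?mulr0 // eqxx.
  by split=> //; apply: Hch; rewrite mulr0.
Qed.

Lemma primitive_family P : left_primitive P -> (code P < 8)%N /\ family (code P) P.
Proof.
move=> hP; suff [i i8 fi] : exists2 i, (i < 8)%N & family i P.
  by have [_ ->] := family_code i8 fi.
have [[a [b [ab ->]]]|->|->|[al [be [ab ->]]]] := primitive_cases q0 qn K_uncountable hP.
- have [a0|a0] := eqVneq a 0.
    rewrite a0 eqxx in ab *; exists 2%N => //=; exists b; split=> //.
    by rewrite pab_0b.
  have [b0|b0] := eqVneq b 0; first by exists 1%N => //=; exists a; rewrite pab_a0 b0.
  by exists 0%N => //=; exists a, b.
- by exists 3%N.
- by exists 4%N.
have [a0|a0] := eqVneq al 0; last first.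
  move/eqP: ab; rewrite mulf_eq0 (negPf a0) /= => /eqP ->.
  by exists 6%N => //=; exists al; rewrite pch_a0.
have [b0|b0] := eqVneq be 0; first by exists 7%N => //=; rewrite pch_00 a0 b0.
by exists 5%N => //=; exists be; rewrite pch_0b a0.
Qed.

(** The prescribed weights of [z] and [z']: [h.1 * h.2] must be a square root [r] of [t], which
    forces [h.2 = s / r]. *)
Lemma torus_weights (s t : K) : s != 0 -> t != 0 ->
  exists h : K * K, [/\ torus h, h.1 * h.2 ^+ 2 = s & (h.1 * h.2) ^+ 2 = t].
Proof.
move=> s0 t0; have [r rt] : exists r, r ^+ 2 = t.
  have [|r] := closed_rootP ('X^2 - t%:P) _; last first.
    by rewrite rootE !hornerE subr_eq0 => /eqP <-; exists r.
  by rewrite size_XnsubC.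
have r0 : r != 0 by apply: contraNneq t0 => r0; rewrite -rt r0 expr0n.
exists (r ^+ 2 / s, s / r); split=> /=; first by split; rewrite /= !mulf_neq0 ?expf_neq0 ?invr_neq0.
  by field; rewrite s0 r0.
by rewrite -rt; field; rewrite s0 r0.
Qed.

Lemma torus_pab h a b : torus h -> (a != 0) || (b != 0) ->
  [set u | pab q a b (torus_act h u)] = pab q (h.1 * h.2 ^+ 2 * a) ((h.1 * h.2) ^+ 2 * b).
Proof.
move=> th ab; have [h1 h2] := th; have hI := pab_ideal q a b; have [g1 g2] := pab_gens q a b.
have w1 : h.1 * h.2 ^+ 2 != 0 by rewrite mulf_neq0 ?expf_neq0.
have w2 : (h.1 * h.2) ^+ 2 != 0 by rewrite expf_neq0 ?mulf_neq0.
have gen (x : U) la c : torus_act h x = la *: x -> pab q a b (x - c%:A) ->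
    pab q a b (torus_act h (x - (la * c)%:A)).
  move=> hx hc; rewrite rmorphB /= linearZ /= rmorph1 hx.
  have -> : la *: x - (la * c)%:A = la *: (x - c%:A) by nc K.
  exact: idealZ hI hc.
apply: above_pab => //.
- by apply/orP; case/orP: ab => h0; [left | right]; exact: mulf_neq0.
- by apply: torus_twist_prime => //; exact: pab_prime.
- by apply: gen g1; exact: torus_act_z.
- by apply: gen g2; exact: torus_act_z'.
Qed.

Lemma torus_pch h al be : torus h -> al * be = 0 ->
  [set u | pch q al be (torus_act h u)] = pch q (h.1 * al) (h.2 * be).
Proof.
move=> th ab; have [h1 h2] := th; have hI := pch_ideal q al be; have [g1 g2] := pch_gens q al be.
have gen (x : U) la c : torus_act h x = la *: x -> pch q al be (x - c%:A) ->
    pch q al be (torus_act h (x - (la * c)%:A)).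
  move=> hx hc; rewrite rmorphB /= linearZ /= rmorph1 hx.
  have -> : la *: x - (la * c)%:A = la *: (x - c%:A) by nc K.
  exact: idealZ hI hc.
apply: above_pch => //.
- by rewrite mulrACA ab mulr0.
- by apply: torus_twist_prime => //; apply: maximal_prime; exact: pch_maximal.
- by apply: gen g1; exact: torus_act_e1.
- by apply: gen g2; exact: torus_act_e2.
Qed.

Definition hcore (P : set U) : set U := [set u | forall h, torus h -> P (torus_act h u)].

Lemma hcore_sup i P : two_sided_ideal P -> hgens i `<=` P -> ideal_gen (hgens i) `<=` hcore P.
Proof.
move=> hP giP u Ju h th.
suff : [set v | P (torus_act h v)] u by [].
apply: ideal_gen_min u Ju; first exact: (twist_ideal (torus_act h : {lrmorphism U -> U}) hP).
move=> x gx; have Px := giP x gx.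
suff [c hx] : exists c, torus_act h x = c *: x by rewrite /= hx; exact: idealZ hP Px.
move: gx; case: i {giP} => [|[|[|[|[|[|[|i]]]]]]] /=.
- by move=> ->; exists 1; rewrite rmorph0 scaler0.
- by move=> ->; exists ((h.1 * h.2) ^+ 2); exact: torus_act_z'.
- by move=> ->; exists (h.1 * h.2 ^+ 2); exact: torus_act_z.
- by move=> ->; exists (h.1 * h.2); exact: torus_act_e3.
- by move=> ->; exists (h.1 * h.2); exact: torus_act_e3bar.
- by move=> ->; exists h.1; exact: torus_act_e1.
- by move=> ->; exists h.2; exact: torus_act_e2.
- by case=> ->; [exists h.1; exact: torus_act_e1 | exists h.2; exact: torus_act_e2].
Qed.

Lemma hcore_sub P : hcore P `<=` P.
Proof.
move=> u /(_ (1, 1)); rewrite torus_act1; apply.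
by split; rewrite /= oner_neq0.
Qed.

Definition pch_gen (b : bool) (c : K) : set U := pch q (if b then 0 else c) (if b then c else 0).

Lemma pch_gen_maximal b c : maximal_ideal (pch_gen b c).
Proof. by apply: pch_maximal; case: b; rewrite ?mul0r ?mulr0. Qed.

Lemma sub_pch_gen b c : ideal_gen [set gen q b] `<=` pch_gen b c.
Proof.
apply: ideal_gen_min => [|_ ->]; first exact: ideal_gen_ideal.
by case: b; [apply/pch_e1 | apply/pch_e2]; rewrite ?mul0r ?mulr0.
Qed.

Lemma gen_pch b (u v : U) : ~ ideal_gen [set gen q b] u -> ~ ideal_gen [set gen q b] v ->
  exists c, [/\ c != 0, ~ pch_gen b c u & ~ pch_gen b c v].
Proof.
set I := ideal_gen _ => Iu Iv; have hI : two_sided_ideal I by exact: ideal_gen_ideal.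
have Ib : I (gen q b) by exact: ideal_gen_sub.
have [p hp] := mod_gen hI Ib u; have [r hr] := mod_gen hI Ib v.
have nz w (s : {poly K}) : ~ I w -> I (w - horner_alg (gen q (~~ b)) s) -> s != 0.
  by move=> Iw h; apply/eqP => s0; apply: Iw; move: h; rewrite s0 rmorph0 subr0.
have [|c c0 hc] := @poly_nonroot _ _ q0 qn (p * r).
  by apply: mulf_neq0; [exact: nz Iu hp | exact: nz Iv hr].
exists c; move: hc; rewrite hornerM mulf_eq0 => /norP[pc rc].
have [hJ J1 _] := pch_gen_maximal b c.
have gc : pch_gen b c (gen q (~~ b) - c%:A).
  by rewrite /pch_gen; case: (b); [have [_ h] := pch_gens q 0 c | have [h _] := pch_gens q c 0].
have out w (s : {poly K}) : I (w - horner_alg (gen q (~~ b)) s) -> s.[c] != 0 -> ~ pch_gen b c w.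
  move=> /(@sub_pch_gen _ c) h sc Pw; have hs := horner_alg_mod s hJ gc.
  apply: J1; apply: (ideal_scale hJ sc).
  move: (horner_alg _ s) h hs => X h hs; have -> : s.[c]%:A = w - (w - X) - (X - s.[c]%:A) by nc K.
  exact: idealB hJ (idealB hJ Pw h) hs.
by split=> //; [apply: out pc | apply: out rc].
Qed.

Lemma hgens_family i P : (i < 8)%N -> family i P -> hgens i `<=` P.
Proof.
case: i => [|[|[|[|[|[|[|[|//]]]]]]]] _ /=.
- move=> [a [b [_ [_ ->]]]] _ ->; exact: ideal0 (ideal_gen_ideal _).
- by move=> [a [_ ->]] _ ->; apply: ideal_gen_sub; right.
- by move=> [a [_ ->]] _ ->; apply: ideal_gen_sub; left.
- by move=> -> _ ->; apply: ideal_gen_sub.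
- by move=> -> _ ->; apply: ideal_gen_sub.
- by move=> [a [_ ->]] _ ->; apply: ideal_gen_sub; left.
- by move=> [a [_ ->]] _ ->; apply: ideal_gen_sub; right.
- by move=> -> x gx; apply: ideal_gen_sub.
Qed.

Lemma family_transitive i P P' : (i < 8)%N -> family i P -> family i P' ->
  exists2 h, torus h & P' = [set u | P (torus_act h u)].
Proof.
have hab a b s t : (a != 0) || (b != 0) -> s != 0 -> t != 0 ->
    exists2 h, torus h & pab q (s * a) (t * b) = [set u | pab q a b (torus_act h u)].
  move=> ab s0 t0; have [h [th <- <-]] := torus_weights s0 t0.
  by exists h => //; rewrite torus_pab.
have hch a b s t : a * b = 0 -> s != 0 -> t != 0 ->
    exists2 h, torus h & pch q (s * a) (t * b) = [set u | pch q a b (torus_act h u)].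
  by move=> ab s0 t0; exists (s, t) => //; rewrite torus_pch.
have fixed (Q : set U) : Q = [set u | Q (torus_act (1, 1) u)].
  by apply/seteqP; split=> u /=; rewrite torus_act1.
have t1 : torus ((1, 1) : K * K) by split; exact: oner_neq0.
have ratio (x y : K) : x != 0 -> y != 0 -> y / x != 0 by move=> x0 y0; rewrite mulf_neq0 ?invr_neq0.
case: i => [|[|[|[|[|[|[|[|//]]]]]]]] _ /=.
- move=> [a [b [a0 [b0 ->]]]] [a' [b' [a'0 [b'0 ->]]]].
  have [|h th hE] := hab a b _ _ _ (ratio _ _ a0 a'0) (ratio _ _ b0 b'0); first by rewrite a0.
  by exists h => //; rewrite -hE !divfK.
- move=> [a [a0 ->]] [a' [a'0 ->]]; rewrite !pab_a0.
  have [|h th hE] := hab a 0 _ _ _ (ratio _ _ a0 a'0) (oner_neq0 K); first by rewrite a0.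
  by exists h => //; rewrite -hE mulr0 divfK.
- move=> [b [b0 ->]] [b' [b'0 ->]]; rewrite !pab_0b.
  have [|h th hE] := hab 0 b _ _ _ (oner_neq0 K) (ratio _ _ b0 b'0); first by rewrite b0 orbT.
  by exists h => //; rewrite -hE mulr0 divfK.
- by move=> -> ->; exists (1, 1).
- by move=> -> ->; exists (1, 1).
- move=> [b [b0 ->]] [b' [b'0 ->]]; rewrite !pch_0b.
  have [|h th hE] := hch 0 b _ _ _ (oner_neq0 K) (ratio _ _ b0 b'0); first by rewrite mul0r.
  by exists h => //; rewrite -hE mulr0 divfK.
- move=> [a [a0 ->]] [a' [a'0 ->]]; rewrite !pch_a0.
  have [|h th hE] := hch a 0 _ _ _ (ratio _ _ a0 a'0) (oner_neq0 K); first by rewrite mulr0.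
  by exists h => //; rewrite -hE mulr0 divfK.
- by move=> -> ->; exists (1, 1).
Qed.

(** By transitivity an element of the core lies in every member of the family, whereas an element
    outside the generated ideal is avoided by some member, as in the proofs of primality. *)
Lemma family_hcore i P : (i < 8)%N -> family i P -> hcore P = ideal_gen (hgens i).
Proof.
move=> i8 fi; have [hP _] := family_code i8 fi; have hI := primitive_ideal hP.
apply/seteqP; split; last by apply: hcore_sup => //; exact: hgens_family.
move=> u hu; have {hu hP hI} all P' : family i P' -> P' u.
  by move=> /(family_transitive i8 fi)[h th ->]; exact: hu.
apply: contrapT => nu; move: all nu {fi}; case: i i8 => [|[|[|[|[|[|[|[|//]]]]]]]] _ /= all nu.
- rewrite ideal_gen0 in nu; have [a [b [a0 b0 h _]]] := not0_pab q0 qn nu nu.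
  by apply: h; apply: all; exists a, b.
- have [a [a0 h _]] := notz'_pab q0 qn nu nu.
  by apply: h; apply: all; exists a; rewrite pab_a0.
- have [b [b0 h _]] := notz_pab q0 qn nu nu.
  by apply: h; apply: all; exists b; rewrite pab_0b.
- by apply: nu; exact: all.
- by apply: nu; exact: all.
- have [b [b0 h _]] := @gen_pch true _ _ nu nu.
  by apply: h; apply: all; exists b; rewrite pch_0b.
- have [a [a0 h _]] := @gen_pch false _ _ nu nu.
  by apply: h; apply: all; exists a; rewrite pch_a0.
- by apply: nu; exact: all.
Qed.

(** [code] tests only eigenvectors of the torus, and these lie in [P] exactly when they lie in its
    core. *)
Lemma code_hcore P : two_sided_ideal P -> code (hcore P) = code P.
Proof.
move=> hP; have eig (x : U) : (forall h, torus h -> exists c, torus_act h x = c *: x) ->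
    hcore P x <-> P x.
  move=> hx; split=> [/hcore_sub //|Px h th].
  by have [c ->] := hx h th; exact: idealZ hP Px.
apply: code_ext; apply: eig => h _.
- by exists (h.1 * h.2 ^+ 2); exact: torus_act_z.
- by exists ((h.1 * h.2) ^+ 2); exact: torus_act_z'.
- by exists (h.1 * h.2); exact: torus_act_e3.
- by exists h.1; exact: torus_act_e1.
- by exists h.2; exact: torus_act_e2.
Qed.

Lemma family_inh i : (i < 8)%N -> exists P, family i P.
Proof.
case: i => [|[|[|[|[|[|[|[|//]]]]]]]] _ /=; try by eexists.
- by eexists; exists 1, 1; rewrite oner_neq0.
- by eexists; exists 1; rewrite oner_neq0.
- by eexists; exists 1; rewrite oner_neq0.
- by eexists; exists 1; rewrite oner_neq0.
- by eexists; exists 1; rewrite oner_neq0.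
Qed.

Lemma code_hgens i : (i < 8)%N -> code (ideal_gen (hgens i)) = i.
Proof.
move=> i8; have [P fP] := family_inh i8; rewrite -(family_hcore i8 fP).
by have [hP <-] := family_code i8 fP; apply: code_hcore; exact: primitive_ideal.
Qed.

Lemma prim_stratumE i : (i < 8)%N -> Prim_stratum q (ideal_gen (hgens i)) = family i.
Proof.
move=> i8; apply/seteqP; split=> P.
  move=> [[Pp]]; rewrite torus_cap -/(hcore P) => hE hP.
  have [c8 fP] := primitive_family hP; suff <- : code P = i by [].
  by rewrite -(code_hgens i8) -hE code_hcore //; exact: primitive_ideal.
move=> fP; have [hP _] := family_code i8 fP; split=> //; split; first exact: primitive_prime.
by rewrite torus_cap -/(hcore P); exact: family_hcore.
Qed.

End Families.

Arguments hgens {K} q i _.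
Arguments family {K} q i _.

Arguments pch_gen {K} q b c _.

(** * The invariant prime ideals *)

Section HSpectrum.
Variables (K : closedFieldType) (q : K).
Hypotheses (q0 : q != 0) (qn : forall n : nat, (0 < n)%N -> q ^+ n != 1).
Hypothesis K_uncountable : uncountable K.
Local Notation U := (UqB2 q).

Lemma prime_gen b : prime_ideal (ideal_gen [set gen q b]).
Proof.
apply: (@prime_from_family _ _ [set P | exists c, c != 0 /\ P = pch_gen q b c]).
- exact: ideal_gen_ideal.
- move=> JT; have [_ J1 _] := pch_gen_maximal q b 1.
  by apply: J1; apply: sub_pch_gen; rewrite JT.
- move=> _ [c [_ ->]]; split; last exact: sub_pch_gen.
  by apply: maximal_prime; exact: pch_gen_maximal.
move=> x y hx hy; have [c [c0 h1 h2]] := gen_pch q0 qn hx hy.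
by exists (pch_gen q b c); split=> //; exists c.
Qed.

Lemma hgens_Hspec i : (i < 8)%N -> H_spec q (ideal_gen (hgens q i)).
Proof.
move=> i8; split; last first.
  have hJ := ideal_gen_ideal (hgens q i).
  have Jh h u : torus h -> ideal_gen (hgens q i) u -> ideal_gen (hgens q i) (torus_act h u).
    by move=> th Ju; exact: (hcore_sup q0 hJ (@ideal_gen_sub _ _) Ju th).
  move=> h th; rewrite torus_image //; apply/seteqP; split=> u /= hu.
    by have := Jh h _ th hu; rewrite torus_actVK.
  by apply: Jh => //; exact: torus_hinv.
case: i i8 => [|[|[|[|[|[|[|[|//]]]]]]]] _ /=.
- exact: prime_gen0.
- exact: prime_genz'.
- exact: prime_genz.
- by rewrite -plane_e3; apply: plane_prime.
- by rewrite -plane_e3bar; apply: plane_prime.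
- exact: (prime_gen true).
- exact: (prime_gen false).
- by rewrite pch_00; apply: maximal_prime; apply: pch_maximal; rewrite mulr0.
Qed.

(** As [I] still avoids [s], the choices [z], [z'] and [z z'] of [s] make the corresponding scalars
    nonzero. *)
Lemma avoiding_central (J : set U) (s : U) : two_sided_ideal J -> (forall u, s * u = u * s) ->
  avoids s J -> exists a b (I : set U), [/\ two_sided_ideal I, J `<=` I, avoids s I,
    I (z q - a%:A) & I (z' q - b%:A)].
Proof.
move=> hJ sC aJ; have [L hL JL] := exists_max_avoiding (two_sided_left hJ) aJ.
have [a La] := max_avoiding_central K_uncountable sC (z_central q0) hL.
have [b Lb] := max_avoiding_central K_uncountable sC (z'_central q0) hL.
have shift (x : U) c : (forall u, x * u = u * x) -> forall u, (x - c%:A) * u = u * (x - c%:A).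
  by move=> xC u; rewrite mulrBl mulrBr xC -scalerAl -scalerAr mul1r mulr1.
have [hL' aL _] := hL.
have [I1 [hI1 I1L JI1 Ia]] := left_ideal_central hL' (shift _ a (z_central q0)) La hJ JL.
have [I2 [hI2 I2L I12 Ib]] := left_ideal_central hL' (shift _ b (z'_central q0)) Lb hI1 I1L.
exists a, b, I2; split=> //.
- by move=> u /JI1/I12.
- by move=> k /I2L; apply: aL.
- exact: I12.
Qed.

Lemma prime_avoids (J : set U) (s : U) : prime_ideal J -> (forall u, s * u = u * s) -> ~ J s ->
  avoids s J.
Proof.
move=> hJ sC Js; have [hI JT _] := hJ; elim=> [|k IHk].
  by rewrite expr0 => /(ideal_setT hI).
rewrite exprS => /(prime_normal hJ _)[|//|//] u; exists u.
by rewrite sC subrr; exact: ideal0 hI.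
Qed.

(** Unless [J] contains both [z] and [z'], some [pab q a b] with [(a, b) <> (0, 0)] lies above it;
    by invariance [J] lies in the core of that ideal, known from [family_hcore]. If [J] contains
    both, it lies above a quantum plane ideal. *)
Lemma Hspec_hgens (J : set U) : H_spec q J -> exists2 i, (i < 8)%N & J = ideal_gen (hgens q i).
Proof.
move=> [Jp Jinv]; have [hJ JT _] := Jp.
have Jh h u : torus h -> J u -> J (torus_act h u).
  by move=> th Ju; rewrite -(Jinv h th); exists u.
have Jcore P : J `<=` P -> J `<=` hcore P by move=> JP u Ju h th; apply: JP; exact: Jh.
have J1 : ~ J 1 by move=> J1; apply: JT; exact: ideal_setT.
have subJ i : hgens q i `<=` J -> ideal_gen (hgens q i) `<=` J by apply: ideal_gen_min.
have inI (I : set U) (x : U) c : two_sided_ideal I -> ~ I 1 -> I x -> I (x - c%:A) -> c = 0.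
  move=> hI I1 Ix Ixc; apply/eqP; apply: contrapT => /negP c0; apply: I1; apply: (ideal_scale hI c0).
  have -> : c%:A = x - (x - c%:A) by rewrite subKr.
  exact: idealB hI Ix Ixc.
have top (I : set U) a b : two_sided_ideal I -> ~ I 1 -> (a != 0) || (b != 0) ->
    I (z q - a%:A) -> I (z' q - b%:A) -> I = pab q a b.
  move=> hI I1 ab Ia Ib; apply: maximal_ideal_eq => //; first exact: pab_maximal.
  by apply: ideal_gen_min => // _ [->|->].
have avoid1 (I : set U) s : avoids s I -> ~ I 1 by move=> /(_ 0%N); rewrite expr0.
have sub (s : U) (I : set U) : avoids s I -> ~ I s by move=> /(_ 1%N); rewrite expr1.
have [Jz|Jz] := pselect (J (z q)); have [Jz'|Jz'] := pselect (J (z' q)).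
- have [hl1 hl2] : (((1 : int) == 1) || ((1 : int) == -1)) /\ (((-1 : int) == 1) || ((-1 : int) == -1)) by [].
  have chars : J (e1 q) \/ J (e2 q) -> exists2 i, (i < 8)%N & J = ideal_gen (hgens q i).
    have eigen b (x : K) : x != 0 -> exists h : K * K, torus h /\ torus_act h (gen q b) = x *: gen q b.
      move=> x0; exists (if b then x else 1, if b then 1 else x); case: b; split.
      - by split=> //=; exact: oner_neq0.
      - exact: torus_act_e1.
      - by split=> //=; exact: oner_neq0.
      - exact: torus_act_e2.
    (* Scaling the generator by [q^2] and comparing puts [(1 - q^2) c] into [J], so [c = 0]. *)
    have scal b c : J (gen q b - c%:A) -> J (gen q b).
      move=> Jxc; have [h [th hx]] := eigen b (q ^+ 2) (expf_neq0 _ q0).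
      have := Jh h _ th Jxc; rewrite rmorphB /= linearZ /= rmorph1 hx => Jxc'.
      have c0 : c = 0.
        apply/eqP; apply: contrapT => /negP c0; apply: J1.
        have cc : (1 - q ^+ 2) * c != 0 by rewrite mulf_neq0 // subr_eq0 eq_sym qn.
        apply: (ideal_scale hJ cc).
        have -> : ((1 - q ^+ 2) * c)%:A = q ^+ 2 *: (gen q b - c%:A) - (q ^+ 2 *: gen q b - c%:A).
          by move: (gen q b) => X; nc K.
        by apply: (idealB hJ) => //; exact: idealZ hJ Jxc.
      by rewrite c0 scale0r subr0 in Jxc.
    have one b : J (gen q b) -> J = ideal_gen [set gen q b] \/ J (gen q (~~ b)).
      move=> hb; have sub_J : ideal_gen [set gen q b] `<=` J by apply: ideal_gen_min => // _ ->.
      have [JE|/nonsubset[u [Ju nu]]] := pselect (J `<=` ideal_gen [set gen q b]).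
        by left; apply/seteqP.
      right; have [p hp] := mod_gen (ideal_gen_ideal _) (@ideal_gen_sub _ [set gen q b] _ erefl) u.
      have p0 : p != 0 by apply/eqP => p0; apply: nu; move: hp; rewrite p0 rmorph0 subr0.
      have Jp' : J (horner_alg (gen q (~~ b)) p).
        by rewrite -(subKr u (horner_alg _ _)); apply: (idealB hJ) => //; exact: sub_J.
      have [|g Jg] := prime_poly_root Jp _ p0 Jp'; last exact: scal Jg.
      move=> v; have [r hr] := mod_gen hJ hb v; move: (gen q (~~ b)) hr => y hr.
      have rC : y * horner_alg y r = horner_alg y r * y.
        by rewrite -{1 4}(horner_algX y) -!rmorphM mulrC.
      move: (horner_alg y r) hr rC => X hr rC.
      have -> : y * v - v * y = y * (v - X) - (v - X) * y + (y * X - X * y) by nc K.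
      rewrite rC subrr addr0; exact: idealB hJ (idealMl _ hJ hr) (idealMr _ hJ hr).
    have both : J (e1 q) -> J (e2 q) -> exists2 i, (i < 8)%N & J = ideal_gen (hgens q i).
      move=> h1 h2; exists 7%N => //=; rewrite pch_00.
      by apply: above_pch; rewrite ?mulr0 ?scale0r ?subr0.
    case=> h; [have [JE|h'] := one true h | have [JE|h'] := one false h].
    - by exists 5%N.
    - exact: both h h'.
    - by exists 6%N.
    - exact: both h' h.
  have [J3|Jb] := prime_e3_e3bar q0 qn Jp Jz Jz'.
    have PJ : plane q (-1) `<=` J by rewrite plane_e3; apply: (subJ 3%N) => _ ->.
    have [JE|ne] := pselect (J = plane q (-1)); first by exists 3%N; rewrite //= JE plane_e3.
    exact: chars (plane_prime_above q0 qn hl2 Jp PJ ne).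
  have PJ : plane q 1 `<=` J by rewrite plane_e3bar; apply: (subJ 4%N) => _ ->.
  have [JE|ne] := pselect (J = plane q 1); first by exists 4%N; rewrite //= JE plane_e3bar.
  exact: chars (plane_prime_above q0 qn hl1 Jp PJ ne).
- have [a [b [I [hI JI aI Ia Ib]]]] := avoiding_central hJ (z'_central q0) (prime_avoids Jp (z'_central q0) Jz').
  have a0 := inI I _ a hI (avoid1 _ _ aI) (JI _ Jz) Ia.
  have b0 : b != 0.
    by apply/eqP => b0; apply: (sub _ _ aI); move: Ib; rewrite b0 scale0r subr0.
  have ab : (a != 0) || (b != 0) by rewrite b0 orbT.
  have IE := top I a b hI (avoid1 _ _ aI) ab Ia Ib.
  exists 2%N => //; apply/seteqP; split; last by apply: (subJ 2%N) => _ ->.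
  rewrite -(@family_hcore _ _ q0 qn 2 I) //; first exact: Jcore.
  by exists b; rewrite IE a0 -pab_0b.
- have [a [b [I [hI JI aI Ia Ib]]]] := avoiding_central hJ (z_central q0) (prime_avoids Jp (z_central q0) Jz).
  have b0 := inI I _ b hI (avoid1 _ _ aI) (JI _ Jz') Ib.
  have a0 : a != 0.
    by apply/eqP => a0; apply: (sub _ _ aI); move: Ia; rewrite a0 scale0r subr0.
  have ab : (a != 0) || (b != 0) by rewrite a0.
  have IE := top I a b hI (avoid1 _ _ aI) ab Ia Ib.
  exists 1%N => //; apply/seteqP; split; last by apply: (subJ 1%N) => _ ->.
  rewrite -(@family_hcore _ _ q0 qn 1 I) //; first exact: Jcore.
  by exists a; rewrite IE b0 -pab_a0.
have sC u : (z q * z' q) * u = u * (z q * z' q).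
  by rewrite -mulrA z'_central // !mulrA z_central.
have Js : ~ J (z q * z' q).
  move=> h; have [|//|//] := prime_normal Jp _ h.
  by move=> u; exists u; rewrite z_central // subrr; exact: ideal0 hJ.
have [a [b [I [hI JI aI Ia Ib]]]] := avoiding_central hJ sC (prime_avoids Jp sC Js).
have a0 : a != 0.
  apply/eqP => a0; apply: (sub _ _ aI); apply: (idealMr _ hI).
  by move: Ia; rewrite a0 scale0r subr0.
have b0 : b != 0.
  apply/eqP => b0; apply: (sub _ _ aI); apply: (idealMl _ hI).
  by move: Ib; rewrite b0 scale0r subr0.
have ab : (a != 0) || (b != 0) by rewrite a0.
have IE := top I a b hI (avoid1 _ _ aI) ab Ia Ib.
exists 0%N => //; apply/seteqP; split; last by apply: (subJ 0%N) => _ ->; exact: ideal0 hJ.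
rewrite -(@family_hcore _ _ q0 qn 0 I) //; first exact: Jcore.
by exists a, b; rewrite IE.
Qed.

End HSpectrum.

(** * Automorphisms *)

Section Abelianization.
Variables (K : closedFieldType) (q : K).
Hypotheses (q0 : q != 0) (qn : forall n : nat, (0 < n)%N -> q ^+ n != 1).
Local Notation U := (UqB2 q).

Lemma axis_map (b : bool) : exists f : {lrmorphism U -> {poly K}},
  f (e1 q) = (if b then 'X else 0) /\ f (e2 q) = (if b then 0 else 'X).
Proof. by apply: commutative_lift; case: b; rewrite ?mulr0 ?mul0r. Qed.

Lemma axis_alg (f : {lrmorphism U -> {poly K}}) (x : U) (p : {poly K}) :
  f x = 'X -> f (horner_alg x p) = p.
Proof.
move=> fx; elim/poly_ind: p => [|p c IHp]; first by rewrite !rmorph0.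
rewrite rmorphD rmorphM /= horner_algX horner_algC rmorphD rmorphM /= IHp fx.
by rewrite rmorph_alg alg_polyC.
Qed.

Lemma axis_ker b (f : {lrmorphism U -> {poly K}}) u : f (gen q b) = 0 -> f (gen q (~~ b)) = 'X ->
  ideal_gen [set gen q b] u <-> f u = 0.
Proof.
move=> f0 fX; have hI := ideal_gen_ideal [set gen q b].
have sub : ideal_gen [set gen q b] `<=` [set u | f u = 0].
  by apply: ideal_gen_min => [|_ ->]; [exact: kernel_ideal | exact: f0].
split=> [/sub //|fu]; have [p hp] := mod_gen hI (ideal_gen_sub (erefl (gen q b))) u.
have := sub _ hp; rewrite /= rmorphB /= fu (axis_alg p fX) sub0r => /eqP.
by rewrite oppr_eq0 => /eqP p0; rewrite p0 rmorph0 subr0 in hp.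
Qed.

(* The two components of the commutative quotient F[x,y]/(xy). *)
Definition axes (f g : {lrmorphism U -> {poly K}}) : Prop :=
  [/\ f (e1 q) = 'X, f (e2 q) = 0, g (e1 q) = 0 & g (e2 q) = 'X].

Lemma axes_exist : exists f g, axes f g.
Proof.
have [f [f1 f2]] := axis_map true; have [g [g1 g2]] := axis_map false.
by exists f, g.
Qed.

Section Axes.
Variables f g : {lrmorphism U -> {poly K}}.
Hypothesis fg : axes f g.

Lemma axis1_ker u : ideal_gen [set e2 q] u <-> f u = 0.
Proof. by have [f1 f2 _ _] := fg; exact: (@axis_ker false). Qed.

Lemma axis2_ker u : ideal_gen [set e1 q] u <-> g u = 0.
Proof. by have [_ _ g1 g2] := fg; exact: (@axis_ker true). Qed.

(** For commuting images the first Serre relation is [- (q^2 - 1)^2 q^-2] times [x^2 y], and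
    polynomials form a domain. *)
Lemma poly_map_split (h : {lrmorphism U -> {poly K}}) : h (e1 q) = 0 \/ h (e2 q) = 0.
Proof.
have := congr1 h (serre1_e q); rewrite serre1_morph rmorph0 /serre1.
have -> : h (e1 q) ^+ 2 * h (e2 q) - (q ^+ 2 + q ^- 2) *: (h (e1 q) * h (e2 q) * h (e1 q)) +
    h (e2 q) * h (e1 q) ^+ 2 = (2 - (q ^+ 2 + q ^- 2)) *: (h (e1 q) ^+ 2 * h (e2 q)).
  have -> : h (e1 q) * h (e2 q) * h (e1 q) = h (e1 q) ^+ 2 * h (e2 q) by rewrite mulrAC.
  rewrite [h (e2 q) * _]mulrC.
  by move: (h (e1 q) ^+ 2 * h (e2 q)) => W; nc K.
have c0 : 2 - (q ^+ 2 + q ^- 2) != 0.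
  have -> : 2 - (q ^+ 2 + q ^- 2) = - ((q ^+ 2 - 1) ^+ 2 / q ^+ 2) by field.
  by rewrite oppr_eq0 mulf_neq0 ?invr_neq0 ?expf_neq0 ?q2B1.
move/eqP; rewrite scaler_eq0 (negPf c0) /= mulf_eq0 expf_eq0 /=.
by case/orP => /eqP; [left | right].
Qed.

(** Both are the value at the origin, where the two axes meet. *)
Lemma axes_const u : (f u)`_0 = (g u)`_0.
Proof.
have [f1 f2 g1 g2] := fg; move: u; apply: Uq_ind => [c u v hu hv||u hu|u hu].
- by rewrite !rmorphD /= !linearZ /= !coefD !coefZ hu hv.
- by rewrite !rmorph1.
- by rewrite !rmorphM /= f1 g1 mul0r coefXM coef0.
- by rewrite !rmorphM /= f2 g2 mul0r coefXM coef0.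
Qed.

Variables phi psi : {lrmorphism U -> U}.
Hypotheses (phiK : cancel phi psi) (psiK : cancel psi phi).

Let X0 : ('X : {poly K}) <> 0. Proof. by apply/eqP; rewrite polyX_eq0. Qed.

Let e1_notin : ~ ideal_gen [set e2 q] (e1 q).
Proof. by move=> /axis1_ker; have [-> _ _ _] := fg. Qed.

Let e2_notin : ~ ideal_gen [set e1 q] (e2 q).
Proof. by move=> /axis2_ker; have [_ _ _ ->] := fg. Qed.

Let gen_sub (x : U) (I : set U) : two_sided_ideal I -> I x -> ideal_gen [set x] `<=` I.
Proof. by move=> hI Ix; apply: ideal_gen_min => // _ ->. Qed.

Let split1 (h : {lrmorphism U -> U}) :
  ideal_gen [set e2 q] (h (e1 q)) \/ ideal_gen [set e2 q] (h (e2 q)).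
Proof.
by have [h0|h0] := poly_map_split (f \o h : {lrmorphism U -> {poly K}}); [left|right]; apply/axis1_ker.
Qed.

Let split2 (h : {lrmorphism U -> U}) :
  ideal_gen [set e1 q] (h (e1 q)) \/ ideal_gen [set e1 q] (h (e2 q)).
Proof.
by have [h0|h0] := poly_map_split (g \o h : {lrmorphism U -> {poly K}}); [left|right]; apply/axis2_ker.
Qed.

(** [split1] and [split2] leave two unwanted cases, where one generator [x] is sent into both
    ideals. Applying [psi], which sends [e1] or [e2] into the ideal of the other generator [y],
    would put [x] into [<y>]. *)
Lemma aut_axes :
  (ideal_gen [set e1 q] (phi (e1 q)) /\ ideal_gen [set e2 q] (phi (e2 q))) \/
  (ideal_gen [set e2 q] (phi (e1 q)) /\ ideal_gen [set e1 q] (phi (e2 q))).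
Proof.
have hI1 := ideal_gen_ideal [set e1 q]; have hI2 := ideal_gen_ideal [set e2 q].
have [A|B] := split1 phi; have [C|D] := split2 phi; [|by right|by left|].
  case: e1_notin; rewrite -(phiK (e1 q)).
  suff: [set u | ideal_gen [set e2 q] (psi u)] (phi (e1 q)) by [].
  have hT := twist_ideal psi hI2.
  by have [h|h] := split1 psi; [apply: (gen_sub hT h) C | apply: (gen_sub hT h) A].
case: e2_notin; rewrite -(phiK (e2 q)).
suff: [set u | ideal_gen [set e1 q] (psi u)] (phi (e2 q)) by [].
have hT := twist_ideal psi hI1.
by have [h|h] := split2 psi; [apply: (gen_sub hT h) D | apply: (gen_sub hT h) B].
Qed.

(* An automorphism acts on F[X] by an invertible substitution, whose linear
   coefficient does not vanish. *)
Lemma surjective_linear_coef (h : {lrmorphism U -> {poly K}}) (x y : U) :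
  (forall u, exists p, ideal_gen [set y] (u - horner_alg x p)) ->
  h y = 0 -> (exists u, h u = 'X) -> (h x)`_1 != 0.
Proof.
move=> hx hy [u hu]; have [p hp] := hx u.
have : [set v | h v = 0] (u - horner_alg x p).
  by apply: ideal_gen_min hp => [|_ ->]; [exact: kernel_ideal | exact: hy].
rewrite /= rmorphB /= hu => /eqP; rewrite subr_eq0 => /eqP Xp.
have hc : forall r : {poly K}, h (horner_alg x r) = r \Po h x.
  elim/poly_ind => [|r c IHr]; first by rewrite !rmorph0 ?comp_poly0.
  rewrite rmorphD rmorphM /= horner_algX horner_algC rmorphD rmorphM /= IHr.
  by rewrite rmorph_alg alg_polyC comp_polyD comp_polyM comp_polyX comp_polyC.
rewrite hc in Xp; apply/eqP => h1.
have d0 : ((h x)^`()).[0] = 0 by rewrite horner_coef0 coef_deriv h1 mul0rn.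
have := congr1 (fun r : {poly K} => (r^`()).[0]) Xp.
by rewrite derivX hornerC deriv_comp hornerM d0 mulr0 => /eqP; rewrite oner_eq0.
Qed.

End Axes.

(** * Nilpotent representations by weighted shifts *)

Section WeightedShift.
Variables (a b : int -> K).

Fact wshift_lin (w : int -> K) c (v v' : int * int -> K) :
  (fun r : int * int => w r.1 * (c * v (r.1 + 1, r.2) + v' (r.1 + 1, r.2))) =
  (fun r => c * (w r.1 * v (r.1 + 1, r.2)) + w r.1 * v' (r.1 + 1, r.2)).
Proof. by apply/funext => r; ring. Qed.

(** For [w] supported on 0, 1, 2, a strictly upper triangular 4 by 4 matrix with superdiagonal
    [w 0], [w 1], [w 2]; the second coordinate is inert and allows the algebra [zend] to be
    reused. *)
Definition wshift (w : int -> K) : zend K := Zend (wshift_lin w).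

Lemma wshiftE w v r : wshift w v r = w r.1 * v (r.1 + 1, r.2).
Proof. by []. Qed.

Hypotheses (a_supp : forall m, a m != 0 -> 0 <= m < 3) (b_supp : forall m, b m != 0 -> 0 <= m < 3).
Hypothesis ab : a 0 * a 1 * b 2 - (q ^+ 2 + q ^- 2) * (a 0 * b 1 * a 2) + b 0 * a 1 * a 2 = 0.

Let out (w : int -> K) m : (forall m, w m != 0 -> 0 <= m < 3) -> (m < 0) || (3 <= m) -> w m = 0.
Proof.
move=> hw hm; apply/eqP; apply: contraT => /hw.
by case/orP: hm; clear; lia.
Qed.

(** A product of three such shifts has a single entry, where the first Serre relation is the
    hypothesis [ab]; products of four vanish, and so does the second relation. *)
Lemma wshift_rep : exists f : {lrmorphism U -> zend K},
  f (e1 q) = wshift a /\ f (e2 q) = wshift b.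
Proof.
apply: Uq_lift; apply: zend_ext => v; apply/funext => -[m n].
  rewrite /serre1 expr2 zendD zendD -scaleN1r !zendZ !zendM !wshiftE /=.
  transitivity ((a m * a (m + 1) * b (m + 1 + 1) - (q ^+ 2 + q ^- 2) * (a m * b (m + 1) * a (m + 1 + 1))
     + b m * a (m + 1) * a (m + 1 + 1)) * v (m + 1 + 1 + 1, n)); first by ring.
  have [->|m0] := eqVneq m 0; first by rewrite add0r (_ : 1 + 1 = 2 :> int) // ab mul0r.
  have [hm|hm] := boolP ((m < 0) || (3 <= m)).
    by rewrite (out a_supp hm) (out b_supp hm) !(mul0r, mulr0) subrr addr0 mul0r.
  have hm2 : (m + 1 + 1 < 0) || (3 <= m + 1 + 1) by move: m0 hm; clear; lia.
  by rewrite (out a_supp hm2) (out b_supp hm2) !(mul0r, mulr0) subrr addr0 mul0r.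
rewrite /serre2 !exprS expr0 mulr1 -!scaleN1r !zendD !zendZ !zendM !wshiftE /=.
have [hm|hm] := boolP ((m < 0) || (3 <= m)).
  by rewrite (out a_supp hm) (out b_supp hm); ring.
have hm2 : (m + 1 + 1 + 1 < 0) || (3 <= m + 1 + 1 + 1) by move: hm; clear; lia.
by rewrite (out a_supp hm2) (out b_supp hm2); ring.
Qed.

Variables (f g : {lrmorphism U -> {poly K}}) (s : {lrmorphism U -> zend K}).
Hypotheses (fg : axes f g) (s1 : s (e1 q) = wshift a) (s2 : s (e2 q) = wshift b).

(* The superdiagonal entries of s u only see the linear part of u. *)
Lemma wshift_band u : exists r2 r3 : int -> K,
  [/\ forall m, r2 m != 0 -> 0 <= m < 2, forall m, r3 m != 0 -> m = 0 &
  forall v m, s u v (m, 0) = (f u)`_0 * v (m, 0) + (a m * (f u)`_1 + b m * (g u)`_1) * v (m + 1, 0)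
    + r2 m * v (m + 1 + 1, 0) + r3 m * v (m + 1 + 1 + 1, 0)].
Proof.
have [f1 f2 g1 g2] := fg.
have supp0 (w r : int -> K) (k : int) : (forall m, w m != 0 -> 0 <= m < 3) ->
    (forall m, r m != 0 -> 0 <= m < k) -> forall m, w m * r (m + 1) != 0 -> 0 <= m < k - 1.
  move=> hw hr m; rewrite mulf_eq0 => /norP[/hw + /hr]; clear; lia.
have lift (w r2 r3 : int -> K) (x y : U) : (forall m, w m != 0 -> 0 <= m < 3) -> s x = wshift w ->
    (f (x * y))`_0 = 0 -> (forall m, a m * (f (x * y))`_1 + b m * (g (x * y))`_1 = w m * (f y)`_0) ->
    (forall m, r2 m != 0 -> 0 <= m < 2) -> (forall m, r3 m != 0 -> m = 0) ->
    (forall v m, s y v (m, 0) = (f y)`_0 * v (m, 0) + (a m * (f y)`_1 + b m * (g y)`_1) * v (m + 1, 0)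
      + r2 m * v (m + 1 + 1, 0) + r3 m * v (m + 1 + 1 + 1, 0)) ->
    exists t2 t3 : int -> K, [/\ forall m, t2 m != 0 -> 0 <= m < 2, forall m, t3 m != 0 -> m = 0 &
      forall v m, s (x * y) v (m, 0) = (f (x * y))`_0 * v (m, 0)
      + (a m * (f (x * y))`_1 + b m * (g (x * y))`_1) * v (m + 1, 0)
      + t2 m * v (m + 1 + 1, 0) + t3 m * v (m + 1 + 1 + 1, 0)].
  move=> hw sx x0 x1 h2 h3 hy.
  exists (fun m => w m * (a (m + 1) * (f y)`_1 + b (m + 1) * (g y)`_1)), (fun m => w m * r2 (m + 1)); split.
  - apply: (supp0 w (fun m => a m * (f y)`_1 + b m * (g y)`_1) 3 hw) => m.
    by apply: contraNT => hm; rewrite (out a_supp) ?(out b_supp) ?mul0r ?addr0 //; move: hm; clear; lia.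
  - by move=> m /(supp0 w r2 2 hw h2); clear; lia.
  move=> v m; rewrite x0 x1 mul0r add0r (_ : s (x * y) = s x * s y) ?rmorphM // sx zendM wshiftE hy.
  have wr3 : w m * r3 (m + 1) = 0.
    apply/eqP; apply: contraT; rewrite mulf_eq0 => /norP[/hw + /h3]; clear; lia.
  by rewrite !mulrDr !mulrA wr3 mul0r addr0; ring.
move: u; apply: Uq_ind => [c u v [r2 [r3 [h2 h3 hu]]] [t2 [t3 [k2 k3 hv]]]||u [r2 [r3 [h2 h3 hu]]]|u [r2 [r3 [h2 h3 hu]]]].
- exists (fun m => c * r2 m + t2 m), (fun m => c * r3 m + t3 m); split.
  + move=> m; apply: contraNT => hm.
    have -> : r2 m = 0 by apply/eqP; apply: contraNT hm => /h2.
    have -> : t2 m = 0 by apply/eqP; apply: contraNT hm => /k2.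
    by rewrite mulr0 addr0.
  + move=> m hm; apply/eqP; apply: contraNT hm => hm.
    have -> : r3 m = 0 by apply/eqP; apply: contraNT hm => /h3 ->.
    have -> : t3 m = 0 by apply/eqP; apply: contraNT hm => /k3 ->.
    by rewrite mulr0 addr0.
  have sE : s (c *: u + v) = c *: s u + s v by rewrite rmorphD /= linearZ.
  move=> w m; rewrite sE zendD zendZ hu hv !rmorphD /= !linearZ /= !coefD !coefZ.
  by ring.
- exists (fun=> 0), (fun=> 0); split; [by move=> m; rewrite eqxx | by move=> m; rewrite eqxx |].
  move=> v m; rewrite !rmorph1 !coef1 /=.
  by rewrite !(mulr0, mul0r, addr0) mul1r.
- apply: (lift a r2 r3 _ _ a_supp s1) => //.
    by rewrite rmorphM /= f1 coefXM.
  by move=> m; rewrite !rmorphM /= f1 g1 mul0r coefXM coef0 mulr0 addr0.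
- apply: (lift b r2 r3 _ _ b_supp s2) => //.
    by rewrite rmorphM /= f2 mul0r coef0.
  by move=> m; rewrite !rmorphM /= f2 g2 mul0r coefXM coef0 mulr0 add0r (axes_const fg).
Qed.

Lemma wshift_step u k (v : int * int -> K) : (f u)`_0 = 0 -> (forall m, k < m -> v (m, 0) = 0) ->
  (forall m, k - 1 < m -> s u v (m, 0) = 0) /\
  s u v (k - 1, 0) = (a (k - 1) * (f u)`_1 + b (k - 1) * (g u)`_1) * v (k, 0).
Proof.
move=> u0 hv; have [r2 [r3 [_ _ ->]]] := wshift_band u.
split=> [m hm|].
  have [r2' [r3' [_ _ ->]]] := wshift_band u.
  by rewrite u0 mul0r !hv ?mulr0 ?addr0 //; move: hm; clear; lia.
rewrite u0 mul0r add0r subrK !(hv (_ + _)) ?mulr0 ?addr0 //; clear; lia.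
Qed.

Definition dirac_at (k : int) (r : int * int) : K := (r.1 == k)%:R.

Lemma dirac_at0 k m : k < m -> dirac_at k (m, 0) = 0.
Proof. by rewrite /dirac_at /= => h; rewrite gt_eqF. Qed.

Let wt u m := a m * (f u)`_1 + b m * (g u)`_1.

Lemma wshift_two u1 u2 : (f u1)`_0 = 0 -> (f u2)`_0 = 0 ->
  s u1 (s u2 (dirac_at 2)) (0, 0) = wt u1 0 * wt u2 1.
Proof.
move=> h1 h2; have [z2 v2] := wshift_step h2 (dirac_at0 (k := 2)).
have [_ ->] := wshift_step h1 (k := 1) z2.
by rewrite [s u2 _ _]v2 /dirac_at /= mulr1.
Qed.

Lemma wshift_three u1 u2 u3 : (f u1)`_0 = 0 -> (f u2)`_0 = 0 -> (f u3)`_0 = 0 ->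
  s u1 (s u2 (s u3 (dirac_at 3))) (0, 0) = wt u1 0 * (wt u2 1 * wt u3 2).
Proof.
move=> h1 h2 h3; have [z3 v3] := wshift_step h3 (dirac_at0 (k := 3)).
have [z2 v2] := wshift_step h2 (k := 2) z3.
have [_ ->] := wshift_step h1 (k := 1) z2.
by rewrite [s u2 _ _]v2 [s u3 _ _]v3 /dirac_at /= mulr1.
Qed.

End WeightedShift.

End Abelianization.

Section Rigidity.
Variables (K : closedFieldType) (q : K).
Hypotheses (q0 : q != 0) (qn : forall n : nat, (0 < n)%N -> q ^+ n != 1).
Local Notation U := (UqB2 q).
Variables phi psi : {lrmorphism U -> U}.
Hypotheses (phiK : cancel phi psi) (psiK : cancel psi phi).

Lemma aut_linear_coef (h : {lrmorphism U -> {poly K}}) b u : h u = 'X ->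
  h (phi (gen q b)) = 0 -> (h (phi (gen q (~~ b))))`_1 != 0.
Proof.
move=> hu h0; apply: (@surjective_linear_coef _ q (h \o phi : {lrmorphism U -> {poly K}}) _ (gen q b)) => //=.
  by apply: mod_gen; [exact: ideal_gen_ideal | exact: ideal_gen_sub].
by exists (psi u); rewrite psiK.
Qed.

(** The first Serre relation is quadratic in [e1] and linear in [e2]. If [phi] swapped the axes,
    [phi (e1 q)] would have the linear part of a multiple of [e2] and conversely, so the relation
    would be tested with the roles exchanged. *)
Lemma aut_fix_axes : ideal_gen [set e1 q] (phi (e1 q)) /\ ideal_gen [set e2 q] (phi (e2 q)).
Proof.
have [f [g fg]] := axes_exist q; have [f1 f2 g1 g2] := fg.
have [//|[h1 h2]] := aut_axes q0 qn fg phiK.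
(* Weights for which [e2 e2 e1] is the only word of length three that does not act as zero. *)
pose a (m : int) : K := (m == 2)%:R; pose b (m : int) : K := ((m == 0) || (m == 1))%:R.
have a_supp m : a m != 0 -> 0 <= m < 3.
  by rewrite /a; case: (m =P 2) => [->|] //; rewrite eqxx.
have b_supp m : b m != 0 -> 0 <= m < 3.
  by rewrite /b; case: (m =P 0) => [-> //|_]; case: (m =P 1) => [-> //|] /=; rewrite eqxx.
have ab : a 0 * a 1 * b 2 - (q ^+ 2 + q ^- 2) * (a 0 * b 1 * a 2) + b 0 * a 1 * a 2 = 0.
  by rewrite /a /b /= !(mul0r, mulr0) subrr addr0.
have [a0 a1 a2 b0 b1] : [/\ a 0 = 0, a 1 = 0, a 2 = 1, b 0 = 1 & b 1 = 1] by [].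
have [s [s1 s2]] := wshift_rep a_supp b_supp ab.
clearbody a b.
have fe1 := (axis1_ker fg (phi (e1 q))).1 h1.
have ge2 := (axis2_ker fg (phi (e2 q))).1 h2.
have ge1n : (g (phi (e1 q)))`_1 != 0 by apply: (@aut_linear_coef g false (e2 q)).
have fe2n : (f (phi (e2 q)))`_1 != 0 by apply: (@aut_linear_coef f true (e1 q)).
have c1 : (f (phi (e1 q)))`_0 = 0 by rewrite fe1 coef0.
have c2 : (f (phi (e2 q)))`_0 = 0 by rewrite (axes_const fg) ge2 coef0.
have three := wshift_three a_supp b_supp fg s1 s2.
have := congr1 s (congr1 phi (serre1_e q)); rewrite !serre1_morph !rmorph0 /serre1.
move=> /(congr1 (fun h : zend K => h (dirac_at K 3) (0, 0))).
rewrite expr2 -scaleN1r !zendD !zendZ !zendM !(three (phi (e1 q)) (phi (e1 q)) (phi (e2 q)) c1 c1 c2).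
rewrite (three (phi (e1 q)) (phi (e2 q)) (phi (e1 q)) c1 c2 c1) (three (phi (e2 q)) (phi (e1 q)) (phi (e1 q)) c2 c1 c1).
rewrite fe1 ge2 a0 a1 a2 b0 b1 coef0 [zend_fun 0 _ _]/=.
rewrite !(mul0r, mulr0, add0r, addr0, mul1r) => /eqP.
by rewrite !mulf_eq0 (negPf ge1n) (negPf fe2n).
Qed.

(** The weights 1, 1 for [e1] and 1, [q^-2] for [e2] kill [e3bar], while [phi], diagonal on linear
    parts, makes [phi (e3 q)] act with the entry [(q^-2 - q^2) x y], where [x] and [y] are its
    nonzero linear coefficients. *)
Lemma aut_e3_notin : ~ ideal_gen [set e3bar q] (phi (e3 q)).
Proof.
have [f [g fg]] := axes_exist q; have [f1 f2 g1 g2] := fg; have [h1 h2] := aut_fix_axes.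
pose a (m : int) : K := ((m == 0) || (m == 1))%:R.
pose b (m : int) : K := (m == 0)%:R + q ^- 2 * (m == 1)%:R.
have a_supp m : a m != 0 -> 0 <= m < 3.
  by rewrite /a; case: (m =P 0) => [-> //|_]; case: (m =P 1) => [-> //|] /=; rewrite eqxx.
have b_supp m : b m != 0 -> 0 <= m < 3.
  rewrite /b; case: (m =P 0) => [-> //|_]; case: (m =P 1) => [-> //|_] /=.
  by rewrite mulr0 addr0 eqxx.
have ab : a 0 * a 1 * b 2 - (q ^+ 2 + q ^- 2) * (a 0 * b 1 * a 2) + b 0 * a 1 * a 2 = 0.
  by rewrite /a /b /= !(mul0r, mulr0, addr0) subrr.
have [s [s1 s2]] := wshift_rep a_supp b_supp ab.
have ge1 := (axis2_ker fg (phi (e1 q))).1 h1.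
have fe2 := (axis1_ker fg (phi (e2 q))).1 h2.
have fe1n : (f (phi (e1 q)))`_1 != 0 by apply: (@aut_linear_coef f false (e1 q)).
have ge2n : (g (phi (e2 q)))`_1 != 0 by apply: (@aut_linear_coef g true (e2 q)).
have c1 : (f (phi (e1 q)))`_0 = 0 by rewrite (axes_const fg) ge1 coef0.
have c2 : (f (phi (e2 q)))`_0 = 0 by rewrite fe2 coef0.
have two := wshift_two a_supp b_supp fg s1 s2.
have s3b : s (e3bar q) = 0.
  apply: zend_ext => v; apply/funext => -[m n].
  have sE : s (e3bar q) = wshift a * wshift b + - q ^- 2 *: (wshift b * wshift a).
    by rewrite /e3bar rmorphB /= linearZ /= !rmorphM /= s1 s2 scaleNr.
  have -> : s (e3bar q) v (m, n) = (a m * b (m + 1) - q ^- 2 * (b m * a (m + 1))) * v (m + 1 + 1, n).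
    by rewrite sE [LHS]/= /wshiftE /=; ring.
  rewrite /a /b [RHS]/=.
  have [->|m0] := eqVneq m 0; first by rewrite /= ; ring.
  have [->|m1] := eqVneq m 1; first by rewrite /= ; ring.
  by rewrite /= ?(negPf m0) ?(negPf m1) /=; ring.
have sub : ideal_gen [set e3bar q] `<=` [set u | s u = 0].
  by apply: ideal_gen_min => [|_ ->]; [exact: kernel_ideal | exact: s3b].
move=> /sub /= s0.
have sE : s (phi (e3 q)) = s (phi (e1 q)) * s (phi (e2 q)) + - q ^+ 2 *: (s (phi (e2 q)) * s (phi (e1 q))).
  have phiE : phi (e3 q) = phi (e1 q) * phi (e2 q) + - q ^+ 2 *: (phi (e2 q) * phi (e1 q)).
    by rewrite /e3 rmorphB /= linearZ /= !rmorphM scaleNr.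
  by rewrite phiE rmorphD /= linearZ /= !rmorphM.
have : s (phi (e3 q)) (dirac_at K 2) (0, 0) = 0 by rewrite s0.
rewrite sE zendD zendZ !zendM (two (phi (e1 q)) (phi (e2 q)) c1 c2) (two (phi (e2 q)) (phi (e1 q)) c2 c1).
rewrite ge1 fe2 coef0 [a 0]/= [a 1]/= [b 0]/= [b 1]/= /a /b /=.
set x := (f _)`_1 in fe1n *; set y := (g _)`_1 in ge2n *.
have -> : (1 * x + (1 + q ^- 2 * 0) * 0) * (1 * 0 + (0 + q ^- 2 * 1) * y) +
   - q ^+ 2 * ((1 * 0 + (1 + q ^- 2 * 0) * y) * (1 * x + (0 + q ^- 2 * 1) * 0)) =
   (q ^- 2 - q ^+ 2) * (x * y) by ring.
move=> /eqP; rewrite !mulf_eq0 (negPf fe1n) (negPf ge2n) !orbF subr_eq0 => /eqP h.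
by move: (qn (n := 4) isT); rewrite (exprD q 2 2) -{1}h mulVf ?eqxx // expf_neq0.
Qed.

End Rigidity.

(** * Units of the simple quotients *)

Section TorusUnits.
Variables (K : fieldType) (q : K).
Hypotheses (q0 : q != 0) (qn : forall n : nat, (0 < n)%N -> q ^+ n != 1).
Local Notation Q := (q ^+ 2).
Implicit Types (c d : int * int -> K) (s t : seq (int * int)).

Let Qz m : Q ^ m != 0. Proof. by rewrite expfz_neq0 // expf_neq0. Qed.

Lemma bsumM_dirac0 c d s t r : (bsum q c s * bsum q d t) (@dirac0 K) r =
  \sum_(p <- s) c p * (Q ^ (r.1 * p.2) * bsum q d t (@dirac0 K) (r - p)).
Proof. by rewrite zendM /bsum zend_sum; apply: eq_bigr => p _; rewrite zendZ lopE. Qed.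

(** Used with [h] the identity and the negation, for the two ends of the supports. The coefficient
    of the product at [p + r] comes from that pair alone, so it does not vanish, whereas 1 is
    supported at the origin. *)
Lemma vertex_sum (h : int * int -> int * int) c d s t p r :
  {morph h : x y / x + y} -> injective h -> uniq s -> uniq t ->
  all (fun x => c x != 0) s -> all (fun x => d x != 0) t -> bsum q c s * bsum q d t = 1 ->
  p \in s -> r \in t -> (forall x, x \in s -> lexle (h x) (h p)) ->
  (forall x, x \in t -> lexle (h x) (h r)) -> p + r = 0.
Proof.
move=> hD hI us ut cs dt st1 ps rt pmax rmax.
have : (bsum q c s * bsum q d t) (@dirac0 K) (p + r) != 0.
  rewrite bsumM_dirac0 (bigD1_seq p) //= big_seq_cond big1 ?addr0 => [|x /andP[xs xp]].
    rewrite !(mulf_neq0 (allP cs _ ps)) // mulf_neq0 //.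
    rewrite (_ : _ - p = r); last by rewrite addrC addKr.
    by rewrite bsum_dirac0 // rt mulf_neq0 // (allP dt).
  rewrite bsum_dirac0 //; case: ifP => [yt|_]; last by rewrite !mulr0.
  case/eqP: xp; apply: hI; have := rmax _ yt; have := pmax _ xs.
  have : h (p + r - x) + h x = h p + h r by rewrite -!hD subrK.
  case: (h x) (h p) (h r) (h (p + r - x)) => [x1 x2] [p1 p2] [r1 r2] [y1 y2].
  by rewrite /lexle => -[e1 e2] /= H1 H2; congr (_, _); move: e1 e2 H1 H2; clear; lia.
by rewrite st1 /= /dirac0; case: (p + r =P 0) => //; rewrite eqxx.
Qed.

(* The units of the quantum torus are the monomials: the extreme exponents
   of two inverse elements are opposite, at both ends of their supports. *)
Lemma torus_unit (F G : zend K) : band q F -> band q G -> F * G = 1 ->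
  exists (c d : K) p, [/\ c != 0, d != 0, F = c *: lop q p & G = d *: lop q (- p)].
Proof.
move=> [c [s [us cs ->]]] [d [t [ut dt ->]]] st1.
have id_morph : {morph (@id (int * int)) : x y / x + y} by [].
have opp_morph : {morph (-%R : int * int -> int * int) : x y / x + y} by exact: opprD.
have hs : s != [::].
  apply/eqP => s0; move/eqP: st1; rewrite s0 {1}/bsum big_nil mul0r eq_sym.
  by rewrite oner_eq0.
have ht : t != [::].
  apply/eqP => t0; move/eqP: st1; rewrite t0 {2}/bsum big_nil mulr0 eq_sym.
  by rewrite oner_eq0.
have [p ps pmax] := lexmax id hs; have [r rt rmax] := lexmax id ht.
have [p' ps' pmin] := lexmax -%R hs; have [r' rt' rmin] := lexmax -%R ht.
have pr := vertex_sum id_morph (@inj_id _) us ut cs dt st1 ps rt pmax rmax.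
have pr' := vertex_sum opp_morph (@oppr_inj _) us ut cs dt st1 ps' rt' pmin rmin.
have le1 := pmax _ ps'; have le2 := rmax _ rt'.
have rE : r = - p by apply/eqP; rewrite -addr_eq0 addrC pr.
have rE' : r' = - p' by apply/eqP; rewrite -addr_eq0 addrC pr'.
have pp' : p' = p.
  move: le1 le2; rewrite rE rE' /lexle; case: (p) (p') => [x y] [x' y'] /= h1 h2.
  by congr (_, _); move: h1 h2; clear; lia.
have single (e : seq (int * int)) (k : int * int -> K) x : uniq e -> x \in e ->
    (forall y, y \in e -> y = x) -> bsum q k e = k x *: lop q x.
  move=> ue xe ye; rewrite /bsum (bigD1_seq x) //= big_seq_cond big1 ?addr0 //.
  by move=> y /andP[/ye -> /eqP].
have between (x y : int * int) : lexle x y -> lexle (- x) (- y) -> x = y.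
  by case: x y => [x1 x2] [y1 y2]; rewrite /lexle /= => h1 h2; congr (_, _); move: h1 h2; clear; lia.
exists (c p), (d (- p)), p; rewrite (allP cs) // -{1}rE (allP dt) //; split=> //.
  by apply: single => // y ys; apply: between; [exact: pmax | rewrite -pp'; exact: pmin].
rewrite -rE; apply: single => // y ys; apply: between; first exact: rmax.
have -> : r = r' by rewrite rE rE' pp'.
exact: rmin.
Qed.

End TorusUnits.

(** As [w] is normal modulo [P], its left multiples and its right multiples each form with [P] a
    two-sided ideal, which by maximality contains 1; the two inverses agree modulo [P]. *)
Lemma normal_unit (K : fieldType) (q : K) (P : set (UqB2 q)) (w : UqB2 q) (l1 l2 : K) :
  maximal_ideal P -> ~ P w -> l1 != 0 -> l2 != 0 ->
  P (w * e1 q - l1 *: (e1 q * w)) -> P (w * e2 q - l2 *: (e2 q * w)) ->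
  exists v, P (v * w - 1) /\ P (w * v - 1).
Proof.
move=> [hP P1 Pmax] Pw l10 l20 h1 h2.
have hl := gens_normal hP h1 h2.
have hr u : exists u', P (u * w - w * u').
  have swap l (x y y' : UqB2 q) : l != 0 -> P (w * x - l *: (x * w)) -> P (y * w - w * y') ->
      P (x * y * w - w * (l^-1 *: (x * y'))).
    move=> l0 hx hy.
    have -> : x * y * w - w * (l^-1 *: (x * y')) =
      x * (y * w - w * y') - l^-1 *: ((w * x - l *: (x * w)) * y').
      by nc_coefs K; field.
    exact: (idealB hP (idealMl _ hP hy) (idealZ _ hP (idealMr _ hP hx))).
  move: u; apply: Uq_ind => [c u v [u' hu] [v' hv]||u [u' hu]|u [u' hu]].
  - exists (c *: u' + v').
    have -> : (c *: u + v) * w - w * (c *: u' + v') = c *: (u * w - w * u') + (v * w - w * v').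
      by nc K.
    exact: (idealD hP (idealZ _ hP hu) hv).
  - by exists 1; rewrite mulr1 mul1r subrr; exact: ideal0.
  - by eexists; exact: swap l10 h1 hu.
  - by eexists; exact: swap l20 h2 hu.
have left_inv : exists y, P (1 - y * w).
  apply: (Pmax [set u | exists y, P (u - y * w)] w) => //.
  - split=> [|x y [x' hx] [y' hy]|a x b [x' hx]].
    + by exists 0; rewrite mul0r subr0; exact: ideal0.
    + exists (x' + y'); have -> : x + y - (x' + y') * w = (x - x' * w) + (y - y' * w) by nc K.
      exact: (idealD hP hx hy).
    + have [b' hb] := hl b; exists (a * x' * b').
      have -> : a * x * b - a * x' * b' * w = a * (x - x' * w) * b + a * x' * (w * b - b' * w) by nc K.
      exact: (idealD hP (idealMr _ hP (idealMl _ hP hx)) (idealMl _ hP hb)).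
  - by move=> u Pu; exists 0; rewrite mul0r subr0.
  - by exists 1; rewrite mul1r subrr; exact: ideal0.
have right_inv : exists y, P (1 - w * y).
  apply: (Pmax [set u | exists y, P (u - w * y)] w) => //.
  - split=> [|x y [x' hx] [y' hy]|a x b [x' hx]].
    + by exists 0; rewrite mulr0 subr0; exact: ideal0.
    + exists (x' + y'); have -> : x + y - w * (x' + y') = (x - w * x') + (y - w * y') by nc K.
      exact: (idealD hP hx hy).
    + have [a' ha] := hr a; exists (a' * x' * b).
      have -> : a * x * b - w * (a' * x' * b) = a * (x - w * x') * b + (a * w - w * a') * x' * b by nc K.
      by apply: (idealD hP); apply: (idealMr _ hP); [exact: idealMl | exact: idealMr].
  - by move=> u Pu; exists 0; rewrite mulr0 subr0.
  - by exists 1; rewrite mulr1 subrr; exact: ideal0.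
have [[y hy] [y' hy']] := (left_inv, right_inv).
have yy' : P (y - y').
  have -> : y - y' = y * (1 - w * y') - (1 - y * w) * y' by nc K.
  exact: (idealB hP (idealMl _ hP hy') (idealMr _ hP hy)).
exists y; split.
  by rewrite -opprB; exact: idealN.
have -> : w * y - 1 = w * (y - y') - (1 - w * y') by nc K.
exact: (idealB hP (idealMl _ hP yy') hy').
Qed.

(* Among the ideals <z - a, z' - b>, separates b = 0 from b <> 0. *)
Definition weyl_pair (K : fieldType) (q : K) (P : set (UqB2 q)) : Prop :=
  exists x y v c, [/\ P (x * y - q ^+ 2 *: (y * x) - c%:A),
    P (v * (x * y - y * x) - 1) & P ((x * y - y * x) * v - 1)].

(* Separates <z - a, z' - b> with a and b nonzero from <z, z' - b>. *)
Definition scalar_units (K : fieldType) (q : K) (P : set (UqB2 q)) : Prop :=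
  forall u v, P (u * v - 1) -> P (v * u - 1) -> exists c, P (u - c%:A).

Section QuotientUnits.
Variables (K : closedFieldType) (q : K).
Hypotheses (q0 : q != 0) (qn : forall n : nat, (0 < n)%N -> q ^+ n != 1).
Local Notation Q := (q ^+ 2).
Local Notation U := (UqB2 q).

Let Qz m : Q ^ m != 0. Proof. by rewrite expfz_neq0 // expf_neq0. Qed.

Section Regular.
Variables (a b : K) (f : {lrmorphism U -> zend K}).
Hypotheses (fr : regular a b f) (b0 : b != 0).

Let ab : (a != 0) || (b != 0). Proof. by rewrite b0 orbT. Qed.

(** Functions of [m] supported on [m > 0], times [eps ^ (- n)]: on them [t] is diagonal with
    eigenvalue [eps * Q ^ m] in column [m], and [x] moves the columns up. *)
Definition periodic (eps : K) (v : int * int -> K) : Prop :=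
  forall m n, (m <= 0 -> v (m, n) = 0) /\ v (m, n - 1) = eps * v (m, n).

(* The coefficients of e2 on the functions of the form v(m) eps^(-n) vanish
   at m = 0 for this value of eps. *)
Lemma periodic_stable eps u v : eps ^+ 2 = b / (1 - q ^- 2) -> periodic eps v ->
  periodic eps (f u v).
Proof.
move=> eps2; have [f1 f2 _ _ _] := fr.
have eps0 : eps != 0.
  have : eps ^+ 2 != 0 by rewrite eps2 mulf_neq0 // invr_neq0 // subr_eq0 eq_sym invr_eq1 qn.
  by rewrite expf_eq0.
have h1 : q * q - 1 != 0 by rewrite -expr2 q2B1.
have h2 : q * q + 1 != 0 by rewrite -expr2 q2D1.
have h4 : q * (q * (q * q)) - 1 != 0.
  by have := qn (n := 4) isT; rewrite !exprS expr0 mulr1 subr_eq0.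
move: u v; apply: Uq_ind => [c x y hx hy||u hu|u hu] v hv.
- have -> : f (c *: x + y) = c *: f x + f y by rewrite rmorphD /= linearZ.
  move=> m n; rewrite !zendD !zendZ; have [hx1 hx2] := hx v hv m n; have [hy1 hy2] := hy v hv m n.
  split=> [m0|]; first by rewrite hx1 ?hy1 // mulr0 addr0.
  by rewrite hx2 hy2; ring.
- by rewrite rmorph1.
- have -> : f (e1 q * u) = top1 q * f u by rewrite rmorphM /= f1.
  move=> m n; rewrite zendM /top1 !lijE mulr0 expr0z !mul1r subr0.
  have {hu}hu := hu v hv; split=> [m0|]; last by have [_ <-] := hu (m - 1) n; rewrite !subr0.
  by have [-> //] := hu (m - 1) n; move: m0; clear; lia.
- have -> : f (e2 q * u) = top2 q a b * f u by rewrite rmorphM /= f2.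
  have {}hu := hu v hv; move=> m n; rewrite zendM; move: (f u v) hu => w hw.
  have w1 k l : w (k, l) = eps * w (k, l + 1) by have [_ <-] := hw k (l + 1); rewrite addrK.
  have w2 k l : w (k, l + 1) = eps^-1 * w (k, l) by rewrite (w1 k l) mulKf.
  have tE l : top2 q a b w (m, l) = (Q - 1)^-1 * ((- (1 + Q^-1)^-1 * Q ^ m * eps
      + b / (1 - q ^- 4) * Q ^ (- m) * eps^-1) * w (m + 1, l) - a * Q ^ (- m) * eps^-1 * w (m, l)).
    rewrite /top2 zendZ !zendD -scaleN1r !zendZ !lijE mulr1 mulrN1 !subr0 !opprK !w2.
    by have [_ ->] := hw (m + 1) l; ring.
  rewrite !tE; have [_ ->] := hw (m + 1) n; have [hm ->] := hw m n.
  split=> [m0|]; last by ring.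
  rewrite hm // mulr0 subr0; have [->|mn] := eqVneq m 0; last first.
    by have [-> //] := hw (m + 1) n; rewrite ?mulr0 //; move: m0 mn; clear; lia.
  rewrite oppr0 expr0z !mulr1.
  (* The only way out of the half-plane is from column 1 to column 0, and its coefficient vanishes
     by the choice of [eps ^+ 2]. *)
  have -> : - (1 + q ^- 2)^-1 * eps + b / (1 - q ^- 4) / eps = 0; last by rewrite mul0r mulr0.
  have -> : b = eps ^+ 2 * (1 - q ^- 2) by rewrite eps2 divfK // subr_eq0 eq_sym invr_eq1 qn.
  by field; rewrite ?eps0 ?q0 ?h1 ?h2 ?h4.
Qed.

Definition ground (eps : K) (r : int * int) : K := (r.1 == 1)%:R * eps ^ (- r.2).

Lemma ground_periodic eps : eps != 0 -> periodic eps (ground eps).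
Proof.
move=> eps0 m n; rewrite /ground /=; split=> [m0|].
  by rewrite (_ : m == 1 = false) ?mul0r //; move: m0; clear; lia.
by rewrite opprB addrC expfzDr // expr1z; ring.
Qed.

Lemma root_exists : exists2 eps, eps != 0 & eps ^+ 2 = b / (1 - q ^- 2).
Proof.
have b1 : b / (1 - q ^- 2) != 0 by rewrite mulf_neq0 // invr_neq0 // subr_eq0 eq_sym invr_eq1 qn.
have [|eps] := @closed_rootP K ('X^2 - (b / (1 - q ^- 2))%:P) _.
  by rewrite size_XnsubC.
rewrite rootE !hornerE subr_eq0 => /eqP h; exists eps => //.
by apply: contra b1 => /eqP e0; rewrite -h e0 expr0n.
Qed.

(** A unit acts as a monomial [x^k t^n]. It and its inverse both preserve the functions supported on
    [m > 0], so neither can lower the column of [ground]: [k] and [- k] are nonnegative. *)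
Lemma regular_unit u v : pab q a b (u * v - 1) -> exists (c d : K) (n : int),
  [/\ c != 0, d != 0, f u = c *: lij q 0 n & f v = d *: lij q 0 (- n)].
Proof.
rewrite (pab_ker q0 qn fr ab) /= rmorphB rmorphM rmorph1 => /eqP; rewrite subr_eq0 => /eqP uv1.
have [c [d [[k n] [c0 d0 fu fv]]]] :=
  torus_unit q0 (regular_band q0 fr u) (regular_band q0 fr v) uv1.
have [eps eps0 eps2] := root_exists; have hg := ground_periodic eps0.
have low (x : U) (e : K) (i j : int) : e != 0 -> f x = e *: lop q (i, j) -> 0 <= i.
  move=> e0 fx; have := periodic_stable x eps2 hg (1 + i) 0; rewrite fx zendZ lopE /ground /=.
  rewrite addrK eqxx mul1r => -[h _]; rewrite leNgt; apply/negP => i0.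
  have /eqP : e * (Q ^ ((1 + i) * j) * eps ^ (- (0 - j))) = 0 by apply: h; move: i0; clear; lia.
  by rewrite !mulf_eq0 (negPf e0) !expfz_eq0 (negPf eps0) expf_eq0 (negPf q0) !andbF.
have k0 := low _ _ _ _ c0 fu; have k1 := low _ _ (- k) (- n) d0 fv.
have kE : k = 0 by move: k0 k1; clear; lia.
by exists c, d, n; split=> //; rewrite ?fu ?fv kE /lij // -[in RHS]oppr0.
Qed.

End Regular.
End QuotientUnits.

Lemma unit_factor (k n e : int) : k * n = e -> absz e == 1%N ->
  (k == 1) && (n == e) || (k == -1) && (n == - e).
Proof.
move=> <-; rewrite abszM muln_eq1 => /andP[/eqP k1 /eqP n1].
have [->|->] : k = 1 \/ k = -1 by move: k1; clear; lia.
  by rewrite mul1r !eqxx.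
by rewrite mulN1r opprK !eqxx orbT.
Qed.

Section PabUnits.
Variables (K : closedFieldType) (q : K).
Hypotheses (q0 : q != 0) (qn : forall n : nat, (0 < n)%N -> q ^+ n != 1).
Local Notation Q := (q ^+ 2).
Local Notation U := (UqB2 q).

Let Q0 : Q != 0. Proof. exact: expf_neq0. Qed.
Let Qz m : Q ^ m != 0. Proof. by rewrite expfz_neq0. Qed.

Lemma regular_repr a b (f : {lrmorphism U -> zend K}) y : regular a b f -> f y <> 0 ->
  exists (s : seq (nat * nat * nat)) (c : nat * nat * nat -> K), [/\ uniq s, s != [::], all is_nf s,
    all (fun t => c t != 0) s & f y = f (\sum_(t <- s) c t *: nf q t)].
Proof.
move=> fr fy; have [s [p [us snf yE]]] := nf_repr q0 qn y.
have [g1 g2] := regular_ker_gens fr.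
have := nf_sum_mod s p (kernel_ideal f) g1 g2; rewrite -yE /= rmorphB /= => /eqP.
rewrite subr_eq0 => /eqP; set c := fun t => (p t).[b%:P].[a] => yc.
have {}yc : f y = f (\sum_(t <- [seq t <- s | c t != 0]) c t *: nf q t).
  rewrite yc big_filter [in RHS]big_mkcond; congr (f _); apply: eq_bigr => x _.
  by rewrite -/(c x); case: eqP => //= ->; rewrite scale0r.
exists [seq t <- s | c t != 0], c; split; rewrite ?filter_uniq ?filter_all //.
  by apply/eqP => s0; apply: fy; rewrite yc s0 big_nil rmorph0.
by apply/allP => x; rewrite mem_filter => /andP[_ /(allP snf)].
Qed.

(** Such an operator would carry [dirac0] to the point (0, [n]) alone, a position ruled out by
    [nf_indep_a]. *)
Lemma regular_no_lowering a b (f : {lrmorphism U -> zend K}) y (e : K) (n : int) :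
  regular a b f -> a != 0 -> e != 0 -> n < 0 -> f y = e *: lij q 0 n -> False.
Proof.
move=> fr a0 e0 n0 fy; have [f1 f2 f3 _ _] := fr.
have fy0 : f y <> 0.
  rewrite fy => /(congr1 (fun h : zend K => h (fun=> 1) (0, 0))) /eqP.
  by rewrite zendZ lijE mul0r expr0z !mulr1 (negPf e0).
have [s [c [us sn snf c0 yc]]] := regular_repr fr fy0.
have [m [k []]] := nf_indep_a q0 qn f1 f2 f3 us sn snf c0 a0.
rewrite -yc fy zendZ lijE /dirac0 subr0 => h mk; case/eqP: h.
rewrite (_ : _ == 0 = false) ?mulr0 // -[0]/(0, 0) xpair_eqE.
by move: mk n0; clear; case: eqP => //=; lia.
Qed.

Lemma pab_scalar_units a b : a != 0 -> b != 0 -> scalar_units (pab q a b).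
Proof.
move=> a0 b0 u v uv _; have ab : (a != 0) || (b != 0) by rewrite a0.
have [f fr] := regular_rep q0 qn a b.
have [c [d [n [c0 d0 fu fv]]]] := regular_unit q0 qn fr b0 uv.
have nn : 0 <= n by rewrite leNgt; apply/negP => n0; apply: (regular_no_lowering fr a0 c0 n0 fu).
have nn' : 0 <= - n by rewrite leNgt; apply/negP => n0; apply: (regular_no_lowering fr a0 d0 n0 fv).
have n0 : n = 0 by move: nn nn'; clear; lia.
exists c; rewrite (pab_ker q0 qn fr ab) /= rmorphB /= fu n0 lij00 linearZ /= rmorph1.
by rewrite subrr.
Qed.

Lemma pab_e3 a b (c : K) : (a != 0) || (b != 0) -> ~ pab q a b (e3 q - c%:A).
Proof.
move=> ab; have [f fr] := regular_rep q0 qn a b; have [_ _ f3 _ _] := fr.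
rewrite (pab_ker q0 qn fr ab) /= rmorphB /= f3 linearZ /= rmorph1.
move=> /(congr1 (fun h : zend K => h (@dirac0 K) (0, 1))) /eqP.
rewrite zendD -scaleN1r !zendZ /top3 lijE mul0r expr0z mul1r.
have -> : @dirac0 K (0 - 0, 1 - 1) = 1 by [].
have -> : (1 : zend K) (@dirac0 K) (0, 1) = 0 by [].
by rewrite !mulr0 addr0 oner_eq0.
Qed.

(** With [z] in the ideal, [e3] is normal modulo it, hence a unit, and it is no scalar. *)
Lemma pab_not_scalar_units b : b != 0 -> ~ scalar_units (pab q 0 b).
Proof.
move=> b0 sc; have ab : (0 != 0 :> K) || (b != 0) by rewrite b0 orbT.
have hI := pab_ideal q 0 b; have [zI _] := pab_gens q 0 b; rewrite scale0r subr0 in zI.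
have [||||| v [h1 h2]] := @normal_unit _ q _ (e3 q) Q (q ^- 2) (pab_maximal q0 qn ab).
- by move=> h; apply: (@pab_e3 0 b 0 ab); rewrite scale0r subr0.
- by [].
- by rewrite invr_neq0.
- by rewrite (e1e3 q0) scalerA divff // scale1r subrr; exact: ideal0 hI.
- have -> : e3 q * e2 q - q ^- 2 *: (e2 q * e3 q) = - q ^- 2 *: z q.
    by rewrite e2e3; move: (e3 q) (z q) => X Z; nc_coefs K; field.
  exact: idealZ _ hI zI.
have [c] := sc _ _ h2 h1; exact: pab_e3.
Qed.

(** The pair is [e2], [e3] with constant [a]. Its commutator [ww] is normal modulo the ideal because
    [ww e1 - q^4 e1 ww = - q^4 z'], and it lies outside since otherwise [e3^2] would be in the
    ideal. *)
Lemma pab_weyl_pair a : a != 0 -> weyl_pair (pab q a 0).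
Proof.
move=> a0; have ab : (a != 0) || (0 != 0 :> K) by rewrite a0.
have hI := pab_ideal q a 0; have [zI z'I] := pab_gens q a 0; rewrite scale0r subr0 in z'I.
have Qn1 : 1 - q ^- 2 != 0 by rewrite subr_eq0 eq_sym invr_eq1 qn.
have [||||| v [h1 h2]] := @normal_unit _ q _ (ww q) (q ^+ 4) (q ^- 2) (pab_maximal q0 qn ab).
- move=> wI; have h3 : pab q a 0 (e3 q * e3 q).
    apply: (ideal_scale hI Qn1).
    have -> : (1 - q ^- 2) *: (e3 q * e3 q) = z' q - ((1 - q ^- 2) * (1 + q ^- 2)) *: (ww q * e1 q).
      by rewrite (z'E q0); move: (e3 q) (ww q) => X W; nc K.
    exact: (idealB hI z'I (idealZ _ hI (idealMr _ hI wI))).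
  have [f fr] := regular_rep q0 qn a 0; have [_ _ f3 _ _] := fr.
  move: h3; rewrite (pab_ker q0 qn fr ab) /= rmorphM /= f3.
  move=> /(congr1 (fun h : zend K => h (fun=> 1) (0, 0))) /eqP.
  by rewrite zendM /top3 !lijE mul0r expr0z !mulr1 oner_eq0.
- exact: expf_neq0.
- by rewrite invr_neq0.
- have -> : ww q * e1 q - q ^+ 4 *: (e1 q * ww q) = - q ^+ 4 *: z' q.
    rewrite (e1_w q0) (z'E q0); move: (e3 q) (ww q) => X W; nc_coefs K; field => //.
  exact: idealZ _ hI z'I.
- rewrite (e2_w q0) scalerA mulVf // scale1r subrr; exact: ideal0 hI.
by exists (e2 q), (e3 q), v, a; split.
Qed.

(** The invertible commutator acts as [d t^n] and q-commutes with [x] and [y]. Evaluation on the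
    bottom vector [ground eps] ties [c] to [eps ^ n], and the two choices of sign of [eps]
    contradict each other when [n] is odd. *)
Lemma pab_not_weyl_pair a b : 2%:R != 0 :> K -> b != 0 -> ~ weyl_pair (pab q a b).
Proof.
move=> two b0 [x [y [v [c [h hv1 hv2]]]]]; have ab : (a != 0) || (b != 0) by rewrite b0 orbT.
have [f fr] := regular_rep q0 qn a b.
have [d [d' [n [d0 _ fD _]]]] := regular_unit q0 qn fr b0 hv2.
have {}fD : f x * f y - f y * f x = d *: lij q 0 n by rewrite -fD rmorphB /= !rmorphM.
have hR : f x * f y - Q *: (f y * f x) - c%:A = 0.
  have h0 : f (x * y - Q *: (y * x) - c%:A) = 0 by move: h; rewrite (pab_ker q0 qn fr ab).
  by rewrite -[RHS]h0 !rmorphB /= !linearZ /= rmorph1 !rmorphM.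
have XD : d *: lij q 0 n * f x = q ^- 2 *: (f x * (d *: lij q 0 n)).
  rewrite -fD; move: (f x) (f y) hR => A B hR; apply/eqP; rewrite -subr_eq0; apply/eqP.
  transitivity (q ^- 2 *: ((A * B - Q *: (B * A) - c%:A) * A - A * (A * B - Q *: (B * A) - c%:A))).
    by nc_coefs K; field.
  by rewrite hR mul0r mulr0 subrr scaler0.
have YD : d *: lij q 0 n * f y = Q *: (f y * (d *: lij q 0 n)).
  rewrite -fD; move: (f x) (f y) hR => A B hR; apply/eqP; rewrite -subr_eq0; apply/eqP.
  transitivity ((A * B - Q *: (B * A) - c%:A) * B - B * (A * B - Q *: (B * A) - c%:A)).
    by nc K.
  by rewrite hR mul0r mulr0 subrr.
(* On the bottom vector the commutator is the scalar [mu = d (Q eps)^n]. If [x] kills this vector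
   then [c = mu]; if [y] does then [c = Q mu]. *)
have main eps : eps ^+ 2 = b / (1 - q ^- 2) -> eps != 0 ->
    (n != -1 -> c = d * (Q ^ n * eps ^ n)) /\ (n != 1 -> c = Q * (d * (Q ^ n * eps ^ n))).
  move=> eps2 eps0; set mu := d * _; pose g := ground eps.
  have gp : periodic eps g by exact: ground_periodic.
  have g1 : g (1, 0) = 1 by rewrite /g /ground /= oppr0 expr0z mulr1.
  have Dper w m k : periodic eps w -> (d *: lij q 0 n) w (m, k) = d * (Q ^ (m * n) * (eps ^ n * w (m, k))).
    move=> hw; rewrite zendZ lijE subr0; congr (d * (_ * _)).
    have up (i : nat) l : w (m, l - i%:Z) = eps ^+ i * w (m, l).
      elim: i l => [|i IHi] l; first by rewrite subr0 expr0 mul1r.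
      have [_ h1] := hw m (l - i%:Z); rewrite exprS -mulrA -IHi -h1.
      by congr (w (_, _)); clear; lia.
    case: (n) => i; first exact: up.
    rewrite NegzE -exprnN.
    have := up i.+1 (k - - i.+1%:Z); rewrite opprK addrK => ->.
    by rewrite mulKf // expf_neq0.
  have Dg : (d *: lij q 0 n) g = (mu%:A : zend K) g.
    apply/funext => -[m k]; rewrite Dper // zendZ /mu /g /ground /=.
    by case: eqP => [->|_]; rewrite ?mul1r ?mul0r ?mulr0 //; ring.
  (* [X g] is an eigenvector of the commutator for [Q ^ j * mu], and column [m] carries the
     eigenvalue [Q ^ ((m - 1) * n) * mu]; so [X g] vanishes unless [(m - 1) * n = j] for some
     [m > 0]. *)
  have eig (X : zend K) (lam : K) (j : int) : periodic eps (X g) -> lam = Q ^ j ->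
      d *: lij q 0 n * X = lam *: (X * (d *: lij q 0 n)) ->
      (forall m : int, 0 < m -> (m - 1) * n != j) -> X g = (0 : zend K) g.
    move=> hX lamE DX nj; apply/funext => -[m k]; have [m0|m0] := lerP m 0.
      by have [-> //] := hX m k.
    have := congr1 (fun h : zend K => h g (m, k)) DX.
    rewrite zendM (Dper _ _ _ hX) zendZ zendM Dg.
    have -> : X ((mu%:A : zend K) g) = (mu *: X) g by rewrite -zendM -scalerAr mulr1.
    rewrite zendZ /mu lamE => /eqP; rewrite -subr_eq0.
    have -> : d * (Q ^ (m * n) * (eps ^ n * X g (m, k))) - Q ^ j * (d * (Q ^ n * eps ^ n) * X g (m, k)) =
      d * eps ^ n * (Q ^ (m * n) - Q ^ j * Q ^ n) * X g (m, k) by ring.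
    rewrite !mulf_eq0 (negPf d0) expfz_eq0 (negPf eps0) andbF /= => /orP[|/eqP //].
    rewrite -expfzDr // subr_eq0 => /eqP /(Qexp_inj q0 qn) mn.
    by case/eqP: (nj m m0); rewrite mulrBl mul1r mn addrK.
  have per u := periodic_stable q0 qn fr b0 u eps2 gp.
  have Dg1 : f x (f y g) (1, 0) - f y (f x g) (1, 0) = mu.
    have := congr1 (fun h : zend K => h g (1, 0)) fD; rewrite Dg zendZ [(1 : zend K) g _]g1 mulr1 => <-.
    by rewrite zendD -[- (f y * f x)]scaleN1r zendZ !zendM mulN1r.
  have Rg : f x (f y g) (1, 0) - Q * f y (f x g) (1, 0) = c.
    have := congr1 (fun h : zend K => h g (1, 0)) hR.
    rewrite zendD zendD -[- c%:A]scaleN1r -[- (Q *: _)]scaleNr !zendZ !zendM [(1 : zend K) g _]g1 [RHS]/=.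
    by move=> /eqP; rewrite mulr1 mulN1r mulNr subr_eq0 => /eqP.
  split=> n1.
    have X0 : f x g = (0 : zend K) g.
      apply: (eig _ (q ^- 2) (-1) (per x) _ XD) => [|m m0]; first by rewrite exprN1.
      by apply: contra n1 => /eqP/unit_factor h1; move: (h1 isT) m0; clear; lia.
    have Y0 : f y (f x g) (1, 0) = 0 by rewrite X0 -zendM mulr0.
    by rewrite -Dg1 -Rg Y0 mulr0 !subr0.
  have Y0 : f y g = (0 : zend K) g.
    apply: (eig _ Q 1 (per y) _ YD) => [|m m0]; first by rewrite expr1z.
    by apply: contra n1 => /eqP/unit_factor h1; move: (h1 isT) m0; clear; lia.
  have X0 : f x (f y g) (1, 0) = 0 by rewrite Y0 -zendM mulr0.
  by rewrite -Dg1 -Rg X0; ring.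
have [eps eps0 eps2] := root_exists qn b0.
(* For [n] equal to 1 or -1 only one of the two values of [c] is available, but it changes sign with
   [eps]. For any other [n] both hold, and [c = Q c] with [c] nonzero is absurd. *)
have eps2' : (- eps) ^+ 2 = b / (1 - q ^- 2) by rewrite sqrrN.
have [h1 h2] := main _ eps2 eps0; have [] := main _ eps2'; first by rewrite oppr_eq0.
have dn0 : d * (Q ^ n * eps ^ n) != 0 by rewrite !mulf_neq0 // expfz_neq0.
have opposite (e : K) : e != 0 -> c = e -> c = - e -> False.
  move=> e0 -> /eqP; rewrite -subr_eq0 opprK -mulr2n -mulr_natl mulf_eq0 (negPf two).
  by rewrite (negPf e0).
have [n1|n1] := eqVneq n 1.
  rewrite n1 in h1 dn0 * => h3 _; apply: (opposite _ dn0); first exact: h1.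
  by rewrite h3 // !expr1z !mulrN.
have [n2|n2] := eqVneq n (-1).
  rewrite n2 in h2 dn0 * => _ h4; apply: (opposite (Q * (d * (Q ^ (-1) * eps ^ (-1))))).
  - exact: mulf_neq0.
  - exact: h2.
  by rewrite h4 // !exprN1 invrN !mulrN.
move=> _ _; have c0 : c != 0 by rewrite (h1 n2).
have /eqP := h2 n1; rewrite -(h1 n2) -subr_eq0 -{1}[c]mul1r -mulrBl mulf_eq0 (negPf c0) orbF.
by rewrite subr_eq0 eq_sym (negPf (qn (n := 2) isT)).
Qed.

End PabUnits.

(** * Orbits *)

Section AutInvariance.
Variables (K : closedFieldType) (q : K).
Hypotheses (q0 : q != 0) (qn : forall n : nat, (0 < n)%N -> q ^+ n != 1).
Hypotheses (K_uncountable : uncountable K) (two : 2%:R != 0 :> K).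
Local Notation U := (UqB2 q).

Lemma ideal_e3 (P : set U) : two_sided_ideal P -> P (e1 q) \/ P (e2 q) ->
  [/\ P (z q), P (z' q) & P (e3 q)].
Proof.
move=> hP h12; have e12 c : P (e1 q * e2 q - c *: (e2 q * e1 q)).
  apply: (idealB hP); last apply: (idealZ _ hP).
    by case: h12 => h; [exact: idealMr | exact: idealMl].
  by case: h12 => h; [exact: idealMl | exact: idealMr].
have h3 : P (e3 q) by exact: e12.
have hz : P (z q) by exact: (idealB hP (idealMl _ hP h3) (idealZ _ hP (idealMr _ hP h3))).
split=> //; apply: (idealZ _ hP); apply: (idealD hP (idealMr _ hP h3)).
by apply: (idealZ _ hP); apply: (idealMr _ hP).
Qed.

Lemma code_e1 (P : set U) : two_sided_ideal P -> P (e1 q) <-> (code P == 5) || (code P == 7).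
Proof.
move=> hP; split=> [h|].
  have [/asboolT hz /asboolT hz' /asboolT h3] := ideal_e3 hP (or_introl h).
  by rewrite /code hz hz' h3 (asboolT h); case: ifP.
by rewrite /code; do 5 (case: ifP => //); move=> _ /asboolP.
Qed.

Lemma code_e2 (P : set U) : two_sided_ideal P -> P (e2 q) <-> (code P == 6) || (code P == 7).
Proof.
move=> hP; split=> [h|].
  have [/asboolT hz /asboolT hz' /asboolT h3] := ideal_e3 hP (or_intror h).
  by rewrite /code hz hz' h3 (asboolT h); case: ifP.
by rewrite /code; do 5 (case: ifP => //) => /asboolP.
Qed.

Lemma family_maximal i P : (i < 8)%N -> family q i P -> maximal_ideal P <-> (i != 3) && (i != 4).
Proof.
have ch0 : (0 : K) * 0 = 0 by rewrite mulr0.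
have not_max (x : U) : pch q 0 0 x -> two_sided_ideal (ideal_gen [set x]) ->
    ~ ideal_gen [set x] (e1 q) -> ~ maximal_ideal (ideal_gen [set x]).
  move=> hx hJ e1J hmax; apply: e1J.
  rewrite -(maximal_ideal_eq hmax (pch_ideal q 0 0) _ (@pch_not1 _ q _ _ ch0)).
    by apply/pch_e1.
  by apply: ideal_gen_min => [|_ ->]; [exact: pch_ideal | exact: hx].
have [h3 h3b _ _] := pch_e3 q ch0.
case: i => [|[|[|[|[|[|[|[|//]]]]]]]] _ /=.
- by move=> [a [b [a0 [b0 ->]]]]; split=> // _; apply: pab_maximal; rewrite ?a0.
- by move=> [a [a0 ->]]; split=> // _; rewrite pab_a0; apply: pab_maximal; rewrite ?a0.
- by move=> [b [b0 ->]]; split=> // _; rewrite pab_0b; apply: pab_maximal; rewrite ?b0 ?orbT.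
- move=> ->; split=> // h; exfalso; move: h; apply: not_max => //; first exact: ideal_gen_ideal.
  by rewrite -plane_e3; have [] := @plane_e1_e2 _ q q0 (-1) isT.
- move=> ->; split=> // h; exfalso; move: h; apply: not_max => //; first exact: ideal_gen_ideal.
  by rewrite -plane_e3bar; have [] := @plane_e1_e2 _ q q0 1 isT.
- by move=> [b [b0 ->]]; split=> // _; rewrite pch_0b; apply: pch_maximal; rewrite mul0r.
- by move=> [b [b0 ->]]; split=> // _; rewrite pch_a0; apply: pch_maximal; rewrite mulr0.
- by move=> ->; split=> // _; rewrite pch_00; apply: pch_maximal; rewrite mulr0.
Qed.

Lemma family_weyl_pair i P : (i < 3)%N -> family q i P -> weyl_pair P <-> i = 1.
Proof.
case: i => [|[|[|//]]] _ /=.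
- by move=> [a [b [a0 [b0 ->]]]]; split=> // /(pab_not_weyl_pair q0 qn two b0).
- by move=> [a [a0 ->]]; split=> // _; rewrite pab_a0; apply: (pab_weyl_pair q0 qn).
- by move=> [b [b0 ->]]; split=> //; rewrite pab_0b => /(pab_not_weyl_pair q0 qn two b0).
Qed.

Lemma family_scalar_units i P : (i == 0) || (i == 2) -> family q i P -> scalar_units P <-> i = 0.
Proof.
case: i => [|[|[|//]]] // _ /=.
- by move=> [a [b [a0 [b0 ->]]]]; split=> // _; apply: (pab_scalar_units q0 qn).
- by move=> [b [b0 ->]]; split=> //; rewrite pab_0b => /(pab_not_scalar_units q0 qn b0).
Qed.

Lemma twist_weyl_pair (phi psi : {lrmorphism U -> U}) P : cancel phi psi ->
  weyl_pair P -> weyl_pair [set u | P (psi u)].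
Proof.
move=> phiK [x [y [v [c [h1 h2 h3]]]]]; exists (phi x), (phi y), (phi v), c; split=> /=.
- by rewrite rmorphB /= rmorph_alg rmorphB /= linearZ /= !rmorphM /= !phiK.
- by rewrite !(rmorphB, rmorphM, rmorph1) /= !phiK.
- by rewrite !(rmorphB, rmorphM, rmorph1) /= !phiK.
Qed.

Lemma twist_scalar_units (phi psi : {lrmorphism U -> U}) P : cancel phi psi ->
  scalar_units P -> scalar_units [set u | P (psi u)].
Proof.
move=> phiK hP u v; rewrite /= !rmorphB /= !rmorphM rmorph1 => h1 h2.
have [c hc] := hP _ _ h1 h2; exists c.
by rewrite rmorphB /= linearZ /= rmorph1.
Qed.

(** Membership of [e1] and of [e2] isolates the codes 5, 6 and 7; maximality isolates 3 and 4, which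
    [aut_e3_notin] keeps apart; [weyl_pair] isolates 1 among the rest, and [scalar_units] separates
    0 from 2. *)
Lemma aut_code (phi psi : {lrmorphism U -> U}) (P : set U) : cancel phi psi -> cancel psi phi ->
  left_primitive P -> code [set u | P (psi u)] = code P.
Proof.
move=> phiK psiK hP; set T := [set u | P (psi u)].
have hT : left_primitive T by exact: twist_primitive phiK psiK hP.
have PT : P = [set u | T (phi u)] by rewrite /T /=; apply/seteqP; split=> u /=; rewrite phiK.
have [iP iT] := (primitive_ideal hP, primitive_ideal hT).
have [cP fP] := primitive_family q0 qn K_uncountable hP.
have [cT fT] := primitive_family q0 qn K_uncountable hT.
have [phi1 phi2] := aut_fix_axes q0 qn phiK psiK; have [psi1 psi2] := aut_fix_axes q0 qn psiK phiK.
have gen (x : U) (I : set U) u : two_sided_ideal I -> I x -> ideal_gen [set x] u -> I u.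
  by move=> hI Ix; apply: ideal_gen_min => // _ ->.
have E1 : P (e1 q) <-> T (e1 q).
  by split=> h; [exact: gen iP h psi1 | rewrite PT; exact: gen iT h phi1].
have E2 : P (e2 q) <-> T (e2 q).
  by split=> h; [exact: gen iP h psi2 | rewrite PT; exact: gen iT h phi2].
have Emax : maximal_ideal P <-> maximal_ideal T.
  by split=> h; [exact: (twist_maximal phiK psiK) | rewrite PT; exact: (twist_maximal psiK phiK)].
have Ew : weyl_pair P <-> weyl_pair T.
  by split=> h; [exact: (twist_weyl_pair phiK) | rewrite PT; exact: (twist_weyl_pair psiK)].
have Esc : scalar_units P <-> scalar_units T.
  by split=> h; [exact: (twist_scalar_units phiK) | rewrite PT; exact: (twist_scalar_units psiK)].
have beq (b c : bool) : (b <-> c) -> b = c by move=> bc; apply/idP/idP => /bc.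
have c34 (chi xi : {lrmorphism U -> U}) (I J : set U) : cancel chi xi -> cancel xi chi ->
    family q 3 I -> family q 4 J -> I = [set u | J (chi u)] -> False.
  move=> chiK xiK -> -> IJ; apply: (aut_e3_notin q0 qn chiK xiK).
  have : ideal_gen [set e3 q] (e3 q) by exact: ideal_gen_sub.
  by rewrite IJ.
have {}c34 : ~ (family q 3 P /\ family q 4 T) /\ ~ (family q 4 P /\ family q 3 T).
  by split=> -[h1 h2]; [apply: (c34 phi psi P T) | apply: (c34 psi phi T P)].
move: E1 E2 Emax Ew Esc c34.
rewrite (code_e1 iP) (code_e1 iT) (code_e2 iP) (code_e2 iT) (family_maximal cP fP) (family_maximal cT fT).
have wP h := family_weyl_pair h fP; have wT h := family_weyl_pair h fT.
have sP h := family_scalar_units h fP; have sT h := family_scalar_units h fT.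
move: (code P) (code T) cP cT fP fT wP wT sP sT => i j i8 j8 fP fT wP wT sP sT.
move=> /beq + /beq + /beq + Ew Esc c34.
have {c34} : ~~ ((i == 3) && (j == 4)) && ~~ ((i == 4) && (j == 3)).
  by case: c34 => c1 c2; apply/andP; split; apply/negP => /andP[/eqP iE /eqP jE];
    [apply: c1 | apply: c2]; rewrite iE in fP; rewrite jE in fT.
have {Ew wP wT} : (i < 3)%N -> (j < 3)%N -> (i == 1) = (j == 1).
  by move=> i3 j3; apply: beq; split=> /eqP h; apply/eqP; apply/(wT j3)/Ew/(wP i3) || apply/(wP i3)/Ew/(wT j3).
have {Esc sP sT} : (i == 0) || (i == 2) -> (j == 0) || (j == 2) -> (i == 0) = (j == 0).
  by move=> i3 j3; apply: beq; split=> /eqP h; apply/eqP; apply/(sT j3)/Esc/(sP i3) || apply/(sP i3)/Esc/(sT j3).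
(* Only a finite check on pairs of codes below 8 remains. *)
clear -i8 j8; move: i8 j8.
case: i => [|[|[|[|[|[|[|[|//]]]]]]]]; case: j => [|[|[|[|[|[|[|[|//]]]]]]]] //= _ _ s w *;
  solve [by have := w isT isT | by have := s isT isT].
Qed.

End AutInvariance.

Section Orbits.
Variables (K : closedFieldType) (q : K).
Hypotheses (q0 : q != 0) (qn : forall n : nat, (0 < n)%N -> q ^+ n != 1).
Hypotheses (K_uncountable : uncountable K) (two : 2%:R != 0 :> K).
Local Notation U := (UqB2 q).

Lemma Aut_orbitE P : left_primitive P -> Aut_orbit P = family q (code P).
Proof.
move=> hP; have [c8 fP] := primitive_family q0 qn K_uncountable hP.
apply/seteqP; split=> [_ [phi phi_bij ->]|P' fP'].
  have [psi [phiK psiK]] := lrmorphism_inverse phi_bij.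
  rewrite (imageE phiK psiK) -(aut_code q0 qn K_uncountable two phiK psiK hP).
  by have [_] := primitive_family q0 qn K_uncountable (twist_primitive phiK psiK hP).
have [h th P'E] := family_transitive q0 qn c8 fP fP'.
have tK := torus_actK (q := q) th; have tVK := torus_actVK (q := q) th.
exists (torus_act (hinv h) : {lrmorphism U -> U}); first by exists (torus_act h).
by rewrite P'E (imageE (phi := torus_act (hinv h) : {lrmorphism U -> U})
  (psi := torus_act h : {lrmorphism U -> U}) tVK tK).
Qed.

Lemma Aut_orbitsE : Aut_orbits q = family q @` `I_8.
Proof.
apply/seteqP; split=> [_ [P hP <-]|_ [i i8 <-]].
  exists (code P); last by rewrite Aut_orbitE.
  by have [] := primitive_family q0 qn K_uncountable hP.
have [P fP] := family_inh q i8; have [hP cP] := family_code q0 qn i8 fP.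
by exists P => //; rewrite Aut_orbitE // cP.
Qed.

Lemma strata_image : Prim_stratum q @` H_spec q = family q @` `I_8.
Proof.
apply/seteqP; split=> [_ [J hJ <-]|_ [i i8 <-]].
  have [i i8 ->] := Hspec_hgens q0 qn K_uncountable hJ.
  by exists i => //; rewrite prim_stratumE.
exists (ideal_gen (hgens q i)); last by rewrite prim_stratumE.
exact: hgens_Hspec.
Qed.

Lemma card_families : (family q @` `I_8 #= `I_8)%card.
Proof.
apply: inj_card_eq => i j; rewrite !inE => i8 j8 ij.
have [P fP] := family_inh q i8; have [_ <-] := family_code q0 qn i8 fP.
by rewrite ij in fP; have [_ <-] := family_code q0 qn j8 fP.
Qed.

Lemma family_image8 : family q @` `I_8 = [set family q 0; family q 1; family q 2; family q 3;
  family q 4; family q 5; family q 6; family q 7].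
Proof.
apply/seteqP; split=> [_ [i i8 <-]|A].
  by case: i i8 => [|[|[|[|[|[|[|[|//]]]]]]]] _ /=; do ?[by right | left].
by case=> [[[[[[[]|]|]|]|]|]|] ->; [exists 0|exists 1|exists 2|exists 3|exists 4|exists 5|exists 6|exists 7].
Qed.

End Orbits.

Lemma complex_uncountable (R : realType) : uncountable R[i].
Proof.
move=> g ginj; apply: (@realType_uncountable R (fun r => g r%:C%C)) => r s /ginj.
by case.
Qed.


Theorem corollary4p5 (R : realType) (q : R[i])
    (q_neq0 : q != 0) (q_not_root1 : forall n : nat, (0 < n)%N -> q ^+ n != 1) :
  Aut_orbits q = Prim_stratum q @` H_spec q
  /\ (Aut_orbits q #= `I_8)%card
  /\ Aut_orbits q =
       [set Prim_stratum q (ideal_gen [set 0]);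
            Prim_stratum q (ideal_gen [set z' q]);
            Prim_stratum q (ideal_gen [set z q]);
            Prim_stratum q (ideal_gen [set e3 q]);
            Prim_stratum q (ideal_gen [set e3bar q]);
            Prim_stratum q (ideal_gen [set e1 q]);
            Prim_stratum q (ideal_gen [set e2 q]);
            Prim_stratum q (ideal_gen [set e1 q; e2 q])]
  /\ Prim_stratum q (ideal_gen [set 0]) =
       [set P | exists a b : R[i], a != 0 /\ b != 0 /\
                P = ideal_gen [set z q - a%:A; z' q - b%:A]]
  /\ Prim_stratum q (ideal_gen [set z' q]) =
       [set P | exists a : R[i], a != 0 /\
                P = ideal_gen [set z q - a%:A; z' q]]
  /\ Prim_stratum q (ideal_gen [set z q]) =
       [set P | exists b : R[i], b != 0 /\
                P = ideal_gen [set z q; z' q - b%:A]]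
  /\ Prim_stratum q (ideal_gen [set e3 q]) = [set ideal_gen [set e3 q]]
  /\ Prim_stratum q (ideal_gen [set e3bar q]) = [set ideal_gen [set e3bar q]]
  /\ Prim_stratum q (ideal_gen [set e1 q]) =
       [set P | exists b : R[i], b != 0 /\
                P = ideal_gen [set e1 q; e2 q - b%:A]]
  /\ Prim_stratum q (ideal_gen [set e2 q]) =
       [set P | exists a : R[i], a != 0 /\
                P = ideal_gen [set e1 q - a%:A; e2 q]]
  /\ Prim_stratum q (ideal_gen [set e1 q; e2 q]) =
       [set ideal_gen [set e1 q; e2 q]].
Proof.
have unc := @complex_uncountable R.
have two : 2%:R != 0 :> R[i] by rewrite pnatr_eq0.
have strata i (i8 : (i < 8)%N) := prim_stratumE q_neq0 q_not_root1 unc i8.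
have orbits := Aut_orbitsE q_neq0 q_not_root1 unc two.
split; first by rewrite orbits (strata_image q_neq0 q_not_root1 unc).
split; first by rewrite orbits; apply: card_families.
have [s0 s1 s2 s3] := And4 (strata 0 isT) (strata 1 isT) (strata 2 isT) (strata 3 isT).
have [s4 s5 s6 s7] := And4 (strata 4 isT) (strata 5 isT) (strata 6 isT) (strata 7 isT).
rewrite /= in s0 s1 s2 s3 s4 s5 s6 s7.
by split; first by rewrite orbits family_image8 s0 s1 s2 s3 s4 s5 s6 s7.
Qed.
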